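(* There is a deterministic polynomial-time 3-approximation algorithm for EM-opt on bipartite graphs. That is, there is a deterministic polynomial-time algorithm which, given a bipartite graph $G$ whose edges are colored red or blue and an integer $k$, outputs ''infeasible'' if $G$ has no perfect matching with at most $k$ red edges, and otherwise outputs a perfect matching $M$ of $G$ with $\frac{1}{3}k^* \le |R(M)| \le k^*$, where $k^*$ is the maximum of $|R(M')|$ over all perfect matchings $M'$ of $G$ with $|R(M')| \le k$.
   Context: For a set of edges $H$, $R(H)$ denotes the set of red edges in $H$. The problem EM-opt (Exact Matching Optimization): given a graph $G$ whose edges are colored red or blue and an integer $k$, maximize $|R(M)|$ subject to $M$ being a perfect matching of $G$ with $|R(M)|\le k$. *)

(* Defs.v *)
From mathcomp Require Import all_boot all_algebra.
Unset Printing Implicit Defensive.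

(* A graph is given by a number of vertices n (vertices 0..n-1) and a  *)
(* list E of edges (u, v, red) ; red = true means the edge is red.     *)
(* Edges are indexed by 'I_(size E).                                   *)

Definition edge := (nat * nat * bool)%type.
Definition e0 : edge := (0, 0, false).

Definition eu (e : edge) : nat := e.1.1.
Definition ev (e : edge) : nat := e.1.2.
Definition ered (e : edge) : bool := e.2.

Definition simple_graph (n : nat) (E : seq edge) : Prop :=
  [/\ all (fun e => (eu e < n) && (ev e < n)) E,
      all (fun e => eu e != ev e) E &
      uniq [seq (minn (eu e) (ev e), maxn (eu e) (ev e)) | e <- E]].

Definition bipartite (E : seq edge) : Prop :=
  exists side : nat -> bool, all (fun e => side (eu e) != side (ev e)) E.

Definition incident (e : edge) (x : nat) : bool := (eu e == x) || (ev e == x).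

Definition perfect_matching (n : nat) (E : seq edge) (M : {set 'I_(size E)}) : bool :=
  [forall x : 'I_n, #|[set i in M | incident (nth e0 E i) x]| == 1].

Definition nred (E : seq edge) (M : {set 'I_(size E)}) : nat :=
  #|[set i in M | ered (nth e0 E i)]|.

Definition feasible_pm (n : nat) (E : seq edge) (k : int) (M : {set 'I_(size E)}) : bool :=
  perfect_matching n E M && ((nred E M)%:Z <= k)%R.

Definition kstar (n : nat) (E : seq edge) (k : int) : nat :=
  \max_(M : {set 'I_(size E)} | feasible_pm n E k M) nred E M.

(* Model of computation: unit-cost RAM with addition and truncated     *)
(* subtraction only (polynomially equivalent to Turing machines),      *)
(* with indirect addressing.  Memory is nat -> nat.                    *)

Inductive instr : Type :=
| IConst of nat & nat
| IAdd of nat & nat & nat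
| ISub of nat & nat & nat
| ILoad of nat & nat
| IStore of nat & nat
| IJz of nat & nat
| IHalt.

Definition program := seq instr.

Record mstate := MState { pc : nat; ram_mem : nat -> nat }.

Definition upd (m : nat -> nat) (a v : nat) : nat -> nat :=
  fun i => if i == a then v else m i.

Definition fetch (P : program) (s : mstate) : instr := nth IHalt P (pc s).

Definition ram_step (P : program) (s : mstate) : mstate :=
  let m := ram_mem s in
  match fetch P s with
  | IConst r c => MState (pc s).+1 (upd m r c)
  | IAdd d a b => MState (pc s).+1 (upd m d (m a + m b))
  | ISub d a b => MState (pc s).+1 (upd m d (m a - m b))
  | ILoad d a => MState (pc s).+1 (upd m d (m (m a)))
  | IStore a v => MState (pc s).+1 (upd m (m a) (m v))
  | IJz r t => MState (if m r == 0 then t else (pc s).+1) m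
  | IHalt => s
  end.

Definition init_state (input : seq nat) : mstate :=
  MState 0 (fun i => nth 0 input i).

Definition ram_run (P : program) (t : nat) (input : seq nat) : mstate :=
  iter t (ram_step P) (init_state input).

Definition ram_halted (P : program) (s : mstate) : bool :=
  if fetch P s is IHalt then true else false.

Definition bitsize (input : seq nat) : nat :=
  \sum_(x <- input) (trunc_log 2 x).+1.

Definition encode (n : nat) (E : seq edge) (k : int) : seq nat :=
  [:: n; size E] ++ flatten [seq [:: eu e; ev e; nat_of_bool (ered e)] | e <- E]
  ++ [:: nat_of_bool (k < 0)%R; absz k].

Definition out_infeasible (m : nat -> nat) : bool := m 0 == 0.

Definition out_matching (E : seq edge) (m : nat -> nat) : {set 'I_(size E)} :=
  [set i : 'I_(size E) | m i.+1 != 0].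

(* Main.v *)
Require Import Defs.
From mathcomp Require Import all_boot all_algebra.
From mathcomp Require Import zify.

(* Count an edge, oriented both ways, as red only when it leaves the first colour
   class. A perfect matching then becomes an assignment: a choice of an arc leaving
   each vertex such that distinct arcs have distinct heads. The algorithm computes,
   for any two arcs, a least red assignment through both; among those with at most
   [k] red arcs it takes the reddest, and improves it along closed walks of the
   exchange digraph as long as the red arcs of the walk, added to those of the
   assignment, number at most [k].

   Let [f] be the result, [r = R(f)], let [g] be optimal, [K = R(g)], and suppose
   [3 r < K]. Any two arcs of [g] lie on an assignment [h] with [R(h) <= r]. Some
   cycle [C] of the exchange from [f] to [g] has more than [K - r] red arcs and gains
   at least [K - r > 2 r], while a closed walk with at most [K - r] red arcs gains
   nothing. Choose [v0] on [C] so that the cheapest closed walk starting with its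
   [g]-arc is as expensive as possible, and close the prefixes and suffixes of [C]
   at [v0] by cheapest walks. A closed prefix, or suffix, of cost at most [K - r]
   gains at most [r], so a prefix and the complementary suffix are not both so cheap.
   Let [v] be the vertex after which the closed prefix first exceeds [K - r], and take
   the [h] containing the [g]-arcs at [v0] and [v]. If both lie on one cycle of [h],
   the prefix just after and the suffix just before the arc at [v] together cost at
   most [K + R(h) < 4 K / 3 < 2 (K - r)], but both exceed [K - r]. Otherwise they lie
   on disjoint cycles, and by the choice of [v0] the arc at [v] closes up at cost
   below [K / 6]. Hence the longest cheap prefix, and symmetrically the longest cheap
   suffix, costs more than [K - r - K / 6] when closed; as both gain at most [r], they
   together cost at most [3 r], so [2 K < 5 r + K / 3 < 2 K].

   All this is carried out by a program in a small imperative language whose loops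
   have bounds known in advance, compiled to the random access machine. *)

Set Implicit Arguments.
Unset Strict Implicit.

(** * Walks and assignments *)

(** An assignment along edges need not be symmetric: its arcs leaving the first class and those
    leaving the second form two unrelated perfect matchings. Only the first is counted and output,
    so the second can be exchanged freely. An exchange step picks an arc leaving the present vertex
    and passes to the vertex whose current arc has the same head. Closed walks, not cycles, are
    searched for, because a table indexed by cost finds walks of prescribed cost in time polynomial
    in the weights. Nothing is lost: a closed walk with a repeated vertex splits into two shorter
    ones, one of which gains, so a shortest gaining walk is simple and is an exchange. Pairs of arcs
    are computed because the analysis must close up a cycle through two given arcs of the unknown
    optimum [g]. The least red assignment through them has at most [K <= k] red arcs, hence is
    itself a candidate and no redder than the reddest one, from which the local search starts and
    below which it never falls. Loops supply an assignment to start from; the weights of the first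
    phase make them worthless, those of the second too expensive. *)

Section Walks.
Variables (V D : eqType) (T Y : D -> V).

Fixpoint walk (x : V) (ds : seq D) (z : V) : bool :=
  if ds is d :: ds' then (T d == x) && walk (Y d) ds' z else x == z.

Definition wsum (w : D -> nat) (ds : seq D) : nat := \sum_(d <- ds) w d.

Lemma wsum_cons w d ds : wsum w (d :: ds) = w d + wsum w ds.
Proof. exact: big_cons. Qed.

Lemma wsum_cat w ds1 ds2 : wsum w (ds1 ++ ds2) = wsum w ds1 + wsum w ds2.
Proof. exact: big_cat. Qed.

Lemma walk_catP x ds1 ds2 z :
  reflect (exists2 y, walk x ds1 y & walk y ds2 z) (walk x (ds1 ++ ds2) z).
Proof.
elim: ds1 x => [|d ds1 IH] x /=.
  apply: (iffP idP) => [?|[y /eqP-> //]]; by exists x.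
apply: (iffP andP) => [[Td /IH[y w1 w2]]|[y /andP[Td w1] w2]].
  by exists y; rewrite ?Td.
by split=> //; apply/IH; exists y.
Qed.

Lemma walk_head x d ds z : walk x (d :: ds) z -> T d = x.
Proof. by case/andP => /eqP. Qed.

(** Cut at the two occurrences of a repeated tail. As [b] and [c] are nonempty, both [b] and
    [a ++ c] are shorter than the walk, which drives the inductions on size. *)
Lemma walk_loop x ds z : walk x ds z -> ~~ uniq (map T ds) ->
  exists y a b c, [/\ ds = a ++ b ++ c, 0 < size b & 0 < size c] /\
    [/\ walk x a y, walk y b y & walk y c z].
Proof.
elim: ds x => [|d ds IH] x //= /andP[/eqP Td wk].
rewrite negb_and negbK => /orP[/mapP[e eds Te]|nu].
  have [i ilt ei] : exists2 i, i < size ds & nth d ds i = e.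
    by exists (index e ds); rewrite ?index_mem ?nth_index.
  have dsE : ds = take i ds ++ (e :: drop i.+1 ds).
    by rewrite -ei -drop_nth // cat_take_drop.
  have := wk; rewrite dsE => /walk_catP[y w1 w2].
  have Ty : y = x by rewrite -(walk_head w2) -Te.
  subst y; exists x, [::], (d :: take i ds), (e :: drop i.+1 ds).
  by split; split=> //=; rewrite ?Td ?eqxx //= -dsE.
have [y [a [b [c [[-> ? ?] [w1 w2 w3]]]]]] := IH _ wk nu.
by exists y, (d :: a), b, c; split; split=> //=; rewrite Td eqxx.
Qed.

Lemma walk_shorten w x ds z : walk x ds z ->
  exists ds', [/\ walk x ds' z, uniq (map T ds') & wsum w ds' <= wsum w ds].
Proof.
have [k] := ubnP (size ds); elim: k ds => // k IH ds /ltnSE lek wk.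
have [u|/(walk_loop wk)[y [a [b [c [[E b0 c0] [wa wb wc]]]]]]] := boolP (uniq (map T ds)).
  by exists ds.
have lt' : size (a ++ c) < k by move: lek; rewrite E !size_cat; lia.
have wac : walk x (a ++ c) z by apply/walk_catP; exists y.
have [ds' [? ? le]] := IH _ lt' wac.
exists ds'; split=> //; apply: (leq_trans le).
by rewrite E !wsum_cat; lia.
Qed.

(* A non-simple closed walk splits into two closed walks, one of which gains. *)
Lemma gaining_simple (p q : D -> nat) x ds : walk x ds x -> wsum q ds < wsum p ds ->
  exists y ds', [/\ walk y ds' y, uniq (map T ds'), wsum q ds' < wsum p ds',
    wsum p ds' <= wsum p ds & size ds' + ~~ uniq (map T ds) <= size ds /\ {subset ds' <= ds}].
Proof.
have [k] := ubnP (size ds); elim: k x ds => // k IH x ds /ltnSE lek wk gain.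
have [u|/(walk_loop wk)[y [a [b [c [[E b0 c0] [wa wb wc]]]]]]] := boolP (uniq (map T ds)).
  by exists x, ds; split=> //; split=> //; rewrite addn0.
have wac : walk x (a ++ c) x by apply/walk_catP; exists y.
have pE : wsum p ds = wsum p b + wsum p (a ++ c) by rewrite E !wsum_cat; lia.
have qE : wsum q ds = wsum q b + wsum q (a ++ c) by rewrite E !wsum_cat; lia.
have sE : size ds = size b + size (a ++ c) by rewrite E !size_cat; lia.
have ac0 : 0 < size (a ++ c) by rewrite size_cat; lia.
have [gb|gac] : wsum q b < wsum p b \/ wsum q (a ++ c) < wsum p (a ++ c) by lia.
- have [|z [ds' [? ? ? ? [? sub]]]] := IH _ _ _ wb gb; first lia.
  exists z, ds'; split=> //; [lia|split; [lia|]].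
  by move=> d /sub; rewrite E !mem_cat => ->; rewrite orbT.
- have [|z [ds' [? ? ? ? [? sub]]]] := IH _ _ _ wac gac; first lia.
  exists z, ds'; split=> //; [lia|split; [lia|]].
  by move=> d /sub; rewrite E !mem_cat => /orP[]->; rewrite ?orbT.
Qed.

End Walks.

(** The orbits of an injective self-map of a finite type partition it, so the sums can be compared
    orbit by orbit. *)
Lemma orbit_sum_le (V : finType) (pi : V -> V) (F G : V -> nat) : injective pi ->
  (forall x, \sum_(y <- orbit pi x) F y <= \sum_(y <- orbit pi x) G y) ->
  \sum_x F x <= \sum_x G x.
Proof.
move=> pi_inj le_orb.
rewrite (partition_big (froot pi) predT) //= [leqRHS](partition_big (froot pi) predT) //=.
apply: leq_sum => j _.
case: (pickP (fun x => froot pi x == j)) => [x /eqP rx|no]; last first.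
  by rewrite (eq_bigl _ _ no) big_pred0_eq.
have E y : (froot pi y == j) = (y \in orbit pi x).
  by rewrite -fconnect_orbit -(root_connect (fconnect_sym pi_inj)) rx eq_sym.
rewrite !(eq_bigl _ _ E); have := le_orb x.
by rewrite !big_uniq ?orbit_uniq.
Qed.

Lemma walk_nodes (V D : eqType) (T Y : D -> V) x ds z :
  walk T Y x ds z -> rcons (map T ds) z = x :: map Y ds.
Proof.
elim: ds x => [|d ds IH] x /=; first by move/eqP->.
by case/andP=> /eqP-> /IH->.
Qed.

Section Assignments.
Variables (V : finType) (D : eqType) (T H : D -> V).

Definition assignment (f : V -> D) := (forall x, T (f x) = x) /\ injective (H \o f).

Variables (f : V -> D) (Y : D -> V).
Hypothesis Yspec : forall d, H (f (Y d)) = H d.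

(** Bringing in [h x] displaces the [f]-arc with the same head, which leaves [Y (h x)]; that vertex
    must be served next. Injectivity makes the orbits of [Y \o h] the cycles of the exchange from
    [f] to [h]. *)
Lemma target_inj h : assignment h -> injective (Y \o h).
Proof.
case=> _ hinj x y /= E; apply: hinj => /=.
by rewrite -Yspec E Yspec.
Qed.

Lemma traject_walk h x k : (forall x, T (h x) = x) ->
  walk T Y x (map h (traject (Y \o h) x k)) (iter k (Y \o h) x).
Proof.
move=> Th; elim: k x => [|k IH] x //=.
by rewrite Th eqxx [X in walk _ _ _ _ X](iterSr k (Y \o h) x) /=; apply: IH.
Qed.

Lemma orbit_walk h x : assignment h -> walk T Y x (map h (orbit (Y \o h) x)) x.
Proof.
move=> h_asg; have := traject_walk x (fingraph.order (Y \o h) x) (proj1 h_asg).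
by rewrite iter_order //; apply: target_inj.
Qed.

Lemma wsum_map (w : D -> nat) (h : V -> D) s : wsum w (map h s) = \sum_(x <- s) w (h x).
Proof. by rewrite /wsum big_map. Qed.

Lemma wsum_map_tail (w : D -> nat) h s : (forall x, T (h x) = x) ->
  wsum (fun d => w (f (T d))) (map h s) = \sum_(x <- s) w (f x).
Proof. by move=> Th; rewrite wsum_map; apply: eq_bigr => x _; rewrite Th. Qed.

Lemma sum_uniq_le (F : V -> nat) s : uniq s -> \sum_(x <- s) F x <= \sum_x F x.
Proof.
by move=> us; rewrite big_uniq // [leqRHS](bigID [in s]) /= leq_addr.
Qed.

Lemma wsum_tail_uniq (w : D -> nat) ds : uniq (map T ds) ->
  wsum (fun d => w (f (T d))) ds <= \sum_x w (f x).
Proof.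
move=> u; have -> : wsum (fun d => w (f (T d))) ds = \sum_(x <- map T ds) w (f x).
  by rewrite /wsum big_map.
exact: sum_uniq_le.
Qed.

(** The exchange from [f] to [g] splits into simple closed walks, and the difference of the two
    weights is the sum of their gains. *)
Lemma stuck_optimal (w : D -> nat) g : assignment g ->
  (forall x ds, walk T Y x ds x -> uniq (map T ds) ->
     wsum w ds <= wsum (fun d => w (f (T d))) ds) ->
  \sum_x w (g x) <= \sum_x w (f x).
Proof.
move=> g_asg stuck; apply: (orbit_sum_le (target_inj g_asg)) => x.
rewrite -wsum_map -(wsum_map_tail w _ (proj1 g_asg)); apply: stuck; first exact: orbit_walk.
rewrite -map_comp (@eq_map _ _ _ id) ?map_id ?orbit_uniq // => y /=.
by case: g_asg.
Qed.

End Assignments.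

(** * The approximation bound *)

Lemma trajectD (A : Type) (h : A -> A) x i j :
  traject h x (i + j) = traject h x i ++ traject h (iter i h x) j.
Proof. by elim: i x => [|i IH] x //=; rewrite IH -iterS iterSr. Qed.

Section Approximation.
Variables (V D : finType) (T H : D -> V) (w : D -> nat).

(** A cheapest cost is a minimum over the finitely many simple walks, to which every walk shortens.
    Pairs joined by no walk get the default 0, harmless since the specification presupposes a
    walk. *)
Lemma dist_exists (Y : D -> V) : exists dist : V -> V -> nat,
  forall x y ds0, walk T Y x ds0 y -> dist x y <= wsum w ds0 /\
    exists ds, [/\ walk T Y x ds y, uniq (map T ds) & wsum w ds = dist x y].
Proof.
pose ok x y p := [exists k : 'I_#|V|.+1, [exists t : k.-tuple D,
  [&& walk T Y x t y, uniq (map T t) & wsum w t == p]]].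
have okP x y ds : walk T Y x ds y -> uniq (map T ds) -> ok x y (wsum w ds).
  move=> wk u.
  have lt : size ds < #|V|.+1.
    by rewrite ltnS -(size_map T) -(card_uniqP u) max_card.
  by apply/existsP; exists (Ordinal lt); apply/existsP; exists (in_tuple ds); apply/and3P.
suff /fin_all_exists[dist distP] (xy : V * V) : exists d, forall ds0,
    walk T Y xy.1 ds0 xy.2 -> d <= wsum w ds0 /\
    exists ds, [/\ walk T Y xy.1 ds xy.2, uniq (map T ds) & wsum w ds = d].
  by exists (fun x y => dist (x, y)) => x y ds /(distP (x, y)).
case: xy => x y /=.
case: (boolP [exists k : 'I_#|V|.+1, [exists t : k.-tuple D,
    walk T Y x t y && uniq (map T t)]]) => [/existsP[k /existsP[t /andP[wk u]]]|no].
  have ex : exists p, ok x y p by exists (wsum w t); apply: okP.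
  case: (ex_minnP ex) => d okd mind; exists d => ds0 wk0; split.
    have [ds' [wk' u' le]] := walk_shorten w wk0.
    by apply: leq_trans le; apply/mind/okP.
  have /existsP[k' /existsP[t' /and3P[? ? /eqP]]] := okd.
  by exists t'.
exists 0 => ds0 /(walk_shorten w)[ds [wk u _]]; case/negP: no.
have /existsP[k /existsP[t /and3P[? ? _]]] := okP _ _ _ wk u.
by apply/existsP; exists k; apply/existsP; exists t; apply/andP.
Qed.

Variables (f g : V -> D) (Y : D -> V) (K : nat).
Hypothesis g_asg : assignment T H g.
Hypothesis Yspec : forall d, H (f (Y d)) = H d.

Let q d := w (f (T d)).
Let pi := Y \o g.
Let r := \sum_x w (f x).

Hypothesis stuck : forall x ds, walk T Y x ds x -> wsum w ds + r <= K ->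
  wsum w ds <= wsum q ds.
Hypothesis gK : \sum_x w (g x) = K.
Hypothesis f_small : 3 * r < K.
Hypothesis pair_small : forall x1 x2, exists h, [/\ assignment T H h, h x1 = g x1,
  h x2 = g x2 & 3 * \sum_x w (h x) < K].

Let pi_inj : injective pi := target_inj Yspec g_asg.
Let Tg x : T (g x) = x. Proof. by case: g_asg. Qed.

(** Were all cycles of cost at most [K - r], none would gain and [K <= r]. Any cycle besides the
    heavy one costs less than [r <= K - r], hence gains nothing, so the whole gain [K - r] falls on
    the heavy one. *)
Lemma heavy_orbit : exists x,
  K < \sum_(y <- orbit pi x) w (g y) + r /\
  K + \sum_(y <- orbit pi x) w (f y) <= \sum_(y <- orbit pi x) w (g y) + r.
Proof.
have orbq x : \sum_(y <- orbit pi x) w (g y) + r <= K ->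
    \sum_(y <- orbit pi x) w (g y) <= \sum_(y <- orbit pi x) w (f y).
  have wk := orbit_walk Yspec x g_asg.
  by have := stuck wk; rewrite wsum_map (wsum_map_tail f w _ Tg).
have [x xP|none] := pickP (fun x => K < \sum_(y <- orbit pi x) w (g y) + r); last first.
  suff : K <= r by lia.
  rewrite -gK; apply: (orbit_sum_le pi_inj) => x; apply: orbq.
  by have /negbT := none x; rewrite -leqNgt.
exists x; split=> //.
have split_orb (F : V -> nat) : \sum_y F y =
    \sum_(y <- orbit pi x) F y + \sum_y (if y \in orbit pi x then 0 else F y).
  rewrite (big_uniq _ (orbit_uniq pi x)) (bigID [in orbit pi x]) /=; congr (_ + _).
  by rewrite [LHS]big_mkcond; apply: eq_bigr => y _; case: (y \in _).
suff : \sum_y (if y \in orbit pi x then 0 else w (g y)) <=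
       \sum_y (if y \in orbit pi x then 0 else w (f y)).
  by move: gK (erefl r); rewrite {1}/r (split_orb (w \o f)) (split_orb (w \o g)) /=; lia.
apply: (orbit_sum_le pi_inj) => y.
have same z : z \in orbit pi y -> (z \in orbit pi x) = (y \in orbit pi x).
  rewrite -!fconnect_orbit => yz; apply/idP/idP => xz; last exact: connect_trans yz.
  by apply: (connect_trans xz); rewrite fconnect_sym.
have [xy|nxy] := boolP (y \in orbit pi x).
  by rewrite big_seq big1 // => z /same->; rewrite xy.
have off (F : V -> nat) : \sum_(z <- orbit pi y) (if z \in orbit pi x then 0 else F z) =
    \sum_(z <- orbit pi y) F z.
  by apply: eq_big_seq => z /same->; rewrite (negbTE nxy).
rewrite !off; apply: orbq.
suff : \sum_(z <- orbit pi y) w (g z) + \sum_(z <- orbit pi x) w (g z) <= K by lia.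
rewrite -gK -big_cat; apply: sum_uniq_le; rewrite cat_uniq !orbit_uniq /= andbT.
apply/hasPn => z zx; apply/negP => zy.
by move: (same _ zy); rewrite zx (negbTE nxy).
Qed.

Lemma no_stuck_approx : False.
Proof.
have [dist distP] := dist_exists Y.
have dist_le x y ds : walk T Y x ds y -> dist x y <= wsum w ds by case/distP.
have triangle x y z ds1 ds2 : walk T Y x ds1 y -> walk T Y y ds2 z ->
    dist x z <= dist x y + dist y z.
  move=> /distP[_ [ds1' [wk1 _ <-]]] /distP[_ [ds2' [wk2 _ <-]]].
  by rewrite -wsum_cat; apply/dist_le/walk_catP; exists y.
have [x0 [heavy0 gain0]] := heavy_orbit.
pose pe x := w (g x) + dist (pi x) x.
have x0in : x0 \in orbit pi x0 by rewrite in_orbit.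
case: (arg_maxnP pe x0in) => v0 v0in pe_max.
have memE : orbit pi v0 =i orbit pi x0.
  move=> y; rewrite -!fconnect_orbit.
  by rewrite (same_connect (fconnect_sym pi_inj) (y := x0)) // fconnect_sym // fconnect_orbit.
have sumE (F : V -> nat) : \sum_(y <- orbit pi v0) F y = \sum_(y <- orbit pi x0) F y.
  by apply: perm_big; apply: uniq_perm; rewrite ?orbit_uniq.
move: heavy0 gain0; rewrite -!sumE => heavy gain.
pose L := fingraph.order pi v0; pose v i := iter i pi v0.
have vL : v L = v0 by rewrite /v iter_order.
pose P i := \sum_(y <- traject pi v0 i) w (g y).
pose Q i := \sum_(y <- traject pi v0 i) w (f y).
have PS i : P i.+1 = P i + w (g (v i)) by rewrite /P trajectSr -cats1 big_cat big_seq1.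
have PQ (F : V -> nat) i : i <= L -> \sum_(y <- traject pi v0 L) F y =
    \sum_(y <- traject pi v0 i) F y + \sum_(y <- traject pi (v i) (L - i)) F y.
  by move=> le; rewrite -{1}(subnKC le) trajectD big_cat.
have wseg x k : walk T Y x (map g (traject pi x k)) (iter k pi x) by apply: traject_walk.
have wpre i : walk T Y v0 (map g (traject pi v0 i)) (v i) by [].
have wsuf i : i <= L -> walk T Y (v i) (map g (traject pi (v i) (L - i))) v0.
  by move=> le; have := wseg (v i) (L - i); rewrite -iterD subnK // -/(v L) vL.
have conn i j : i <= L -> exists ds, walk T Y (v i) ds (v j).
  move=> /wsuf wk; exists (map g (traject pi (v i) (L - i)) ++ map g (traject pi v0 j)).
  by apply/walk_catP; exists v0; last exact: wpre.
pose a i := dist (v i) v0; pose b i := dist v0 (v i).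
have a0 : a 0 = 0.
  by apply/eqP; have := dist_le v0 v0 [::] (eqxx _); rewrite /wsum big_nil leqn0.
have aL : a L = 0 by rewrite /a vL -a0.
have bL : b L = 0 by rewrite /b vL -a0.
have b0 : b 0 = 0 by [].
(* The return walk can be taken simple, so the [f]-arcs that it replaces weigh at most [r]. This is
   the loss in the bounds [fwd] and [bwd]. *)
have closed x y ds : walk T Y x ds y -> (exists ds, walk T Y y ds x) ->
    wsum w ds + dist y x + r <= K -> wsum w ds + dist y x <= wsum q ds + r.
  move=> wk1 [ds0 /distP[_ [ds' [wk2 u <-]]]] le.
  have wk : walk T Y x (ds ++ ds') x by apply/walk_catP; exists y.
  have := stuck wk; rewrite !wsum_cat => /(_ le).
  by have := wsum_tail_uniq f w u; rewrite -/r -/q; lia.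
have fwd i : i <= L -> P i + a i + r <= K -> P i + a i <= Q i + r.
  move=> le; have := closed _ _ _ (wpre i) (conn i 0 le).
  by rewrite wsum_map (wsum_map_tail f w _ Tg).
have bwd i : i <= L -> P L - P i + b i + r <= K -> P L - P i + b i <= Q L - Q i + r.
  move=> le; have := closed _ _ _ (wsuf i le) (ex_intro (fun ds => walk T Y v0 ds (v i)) _ (wpre i)).
  by rewrite wsum_map (wsum_map_tail f w _ Tg) /P /Q !(PQ _ _ le) !addKn.
have PLK : P L <= K by rewrite -gK; apply/sum_uniq_le/orbit_uniq.
have heavyL : K < P L + r by [].
have PQL : K + Q L <= P L + r by [].
have Pmono i : i <= L -> P i <= P L by move=> le; rewrite /P (PQ _ _ le) leq_addr.
have Qmono i : i <= L -> Q i <= Q L by move=> le; rewrite /Q (PQ _ _ le) leq_addr.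
have inv i : v i \in orbit pi x0.
  by rewrite -memE -fconnect_orbit fconnect_iter.
(* Either [v0] and [v i] lie on a common cycle of cost at most [sum w h], or two
   disjoint cycles pass through the arcs leaving them, so that the one through
   [v i], not the more expensive of the two by the choice of [v0], is cheap. *)
have dichotomy i : i < L -> exists t, 3 * t < K /\
    (b i + w (g (v i)) + a i.+1 <= t \/ 2 * pe (v i) <= t).
  move=> ltL; have [h [h_asg h0 hi small]] := pair_small v0 (v i).
  exists (\sum_x w (h x)); split=> //.
  have Th x : T (h x) = x by case: h_asg.
  pose ph := Y \o h; have ph_inj := target_inj Yspec h_asg : injective ph.
  have nexti : ph (v i) = v i.+1 by rewrite /ph /= hi.
  have next0 : ph v0 = v 1 by rewrite /ph /= h0.
  (* Without its first arc, the [h]-cycle at [x] is a walk from [pi x] back to [x]. *)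
  have cost x : h x = g x -> pe x <= \sum_(y <- orbit ph x) w (h y).
    move=> hx; have := orbit_walk Yspec x h_asg.
    rewrite /orbit -orderSpred /= => /andP[_ wk].
    by rewrite big_cons hx leq_add2l -wsum_map /pi /= -hx; apply: dist_le.
  have [con|ncon] := boolP (v i \in orbit ph v0).
    left; have /trajectP[k ltk kE] := con.
    set o := fingraph.order ph v0 in ltk.
    have io : iter o ph v0 = v0 by rewrite /o iter_order.
    have wkA : walk T Y v0 (map h (traject ph v0 k)) (v i).
      by rewrite kE; apply: traject_walk.
    have vk : iter k.+1 ph v0 = v i.+1 by rewrite -nexti kE.
    have wkB : walk T Y (v i.+1) (map h (traject ph (v i.+1) (o - k.+1))) v0.
      have := traject_walk Y (v i.+1) (o - k.+1) Th.
      by rewrite -[X in iter _ _ X]vk -iterD subnK // io.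
    apply: leq_trans (sum_uniq_le _ (orbit_uniq ph v0)).
    rewrite /orbit -/o -(subnKC ltk) trajectD vk big_cat trajectSr -cats1 big_cat big_seq1 /=.
    rewrite -kE hi -!wsum_map; apply: leq_add; last exact: dist_le.
    by apply: leq_add => //; apply: dist_le.
  right; apply: leq_trans (_ : pe v0 + pe (v i) <= _).
    by rewrite mul2n -addnn leq_add2r; exact: (pe_max _ (inv i)).
  apply: leq_trans (leq_add (cost _ h0) (cost _ hi)) _.
  rewrite -big_cat; apply: sum_uniq_le; rewrite cat_uniq !orbit_uniq /= andbT.
  apply/hasPn => z; rewrite -!fconnect_orbit => zi; apply/negP => z0.
  case/negP: ncon; rewrite -fconnect_orbit; apply: (connect_trans z0).
  by rewrite fconnect_sym.
have peE i : pe (v i) = w (g (v i)) + dist (v i.+1) (v i) by [].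
(* After the arc at [v i] the walk may return to [v i] and close from there, so one more arc raises
   the closed prefix by at most [pe (v i)]; [jumpG] is the mirror image for suffixes. *)
have jumpF i : i < L -> P i.+1 + a i.+1 <= P i + a i + pe (v i).
  move=> lt; have [ds1 w1] := conn i.+1 i lt; have w2 := wsuf i (ltnW lt).
  have : a i.+1 <= dist (v i.+1) (v i) + a i := triangle _ _ _ _ _ w1 w2.
  by rewrite PS peE; lia.
have jumpG i : i < L -> P L - P i + b i <= P L - P i.+1 + b i.+1 + pe (v i).
  move=> lt; have [ds1 w1] := conn i.+1 i lt; have w2 := wpre i.+1.
  have : b i <= b i.+1 + dist (v i.+1) (v i) := triangle _ _ _ _ _ w2 w1.
  by have := Pmono _ lt; rewrite PS peE; lia.
have not_both i : i <= L -> P i + a i + r <= K -> K < P L - P i + b i + r.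
  move=> le /(fwd _ le) h1; rewrite ltnNge; apply/negP => /(bwd _ le).
  by move: (Pmono _ le) (Qmono _ le); lia.
(* [j.+1] becomes the first index whose closed prefix exceeds [K - r], and [m] the last index whose
   closed suffix does; [not_both] gives [j <= m]. *)
have exF : exists i, K < P i + a i + r by exists L; rewrite aL; lia.
case: (ex_minnP exF) => [[|j] Fj minF].
  by move: Fj; rewrite a0 /P /= big_nil; lia.
have ltjL : j < L by rewrite ltnNge; apply/negP => le; have := minF L; rewrite aL; lia.
have Fle : P j + a j + r <= K by rewrite leqNgt; apply/negP => /minF; lia.
have Gj := not_both _ (ltnW ltjL) Fle.
have exG : exists i, (i <= L) && (K < P L - P i + b i + r).
  by exists j; rewrite ltnW.
have boundG i : (i <= L) && (K < P L - P i + b i + r) -> i <= L by case/andP.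
case: (ex_maxnP exG boundG) => m /andP[lemL Gm] maxG.
have jm : j <= m by apply: maxG; rewrite ltnW.
have ltmL : m < L.
  by rewrite ltn_neqAle lemL andbT; apply/eqP => E; move: Gm; rewrite E subnn bL; lia.
have GmS : P L - P m.+1 + b m.+1 + r <= K.
  by rewrite leqNgt; apply/negP => h; have := maxG m.+1; rewrite ltmL h => /(_ isT); lia.
have FmS : K < P m.+1 + a m.+1 + r.
  by rewrite ltnNge; apply/negP => /(not_both _ ltmL); lia.
have := jumpF _ ltjL; have := jumpG _ ltmL; have := fwd _ (ltnW ltjL) Fle.
have := bwd _ ltmL GmS; have := Pmono _ ltmL; have := Qmono _ ltmL.
have := Pmono _ (ltnW ltjL); have := Qmono _ (ltnW ltjL).
have : P j <= P m.+1 by rewrite /P -(subnKC (leqW jm)) trajectD big_cat leq_addr.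
have : P j.+1 = P j + w (g (v j)) := PS j.
have : P m.+1 = P m + w (g (v m)) := PS m.
have : Q j <= Q m.+1 by rewrite /Q -(subnKC (leqW jm)) trajectD big_cat leq_addr.
(* [link1] and [link2] are refuted alike: the prefix up to [i.+1] and the suffix from [i] overlap
   only in the arc at [v i], and this arc with the two closing walks costs no more than [h]. *)
have [t1 [t1K [link1|sep1]]] := dichotomy _ ltjL; first by lia.
have [t2 [t2K [link2|sep2]]] := dichotomy _ ltmL; first by lia.
lia.
Qed.

End Approximation.

(** * An imperative language and its compiler *)

Record store := Store { vr : nat -> nat; ar : nat -> nat -> nat }.

Definition setv (s : store) x v := Store (upd (vr s) x v) (ar s).
Definition seta (s : store) a i v :=
  Store (vr s) (fun b j => if (b == a) && (j == i) then v else ar s b j).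

Inductive expr :=
| EV of nat
| EC of nat
| EAdd of expr & expr
| ESub of expr & expr
| EA of nat & expr.

Fixpoint eval (s : store) (e : expr) : nat :=
  match e with
  | EV x => vr s x
  | EC c => c
  | EAdd e1 e2 => eval s e1 + eval s e2
  | ESub e1 e2 => eval s e1 - eval s e2
  | EA a e1 => ar s a (eval s e1)
  end.

Inductive com :=
| Skip
| Asg of nat & expr
| Ast of nat & expr & expr
| Seq of com & com
| If of expr & com & com
| For of nat & nat & com.

(** A loop leaves its counter at the bound, as the compiled code does, so that store and memory
    agree on every variable. The bound is read once here but at every test in the compiled code;
    [wfc] makes the two agree. *)
Fixpoint exec (c : com) (s : store) : store :=
  match c with
  | Skip => s
  | Asg x e => setv s x (eval s e)
  | Ast a i e => seta s a (eval s i) (eval s e)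
  | Seq c1 c2 => exec c2 (exec c1 s)
  | If e c1 c2 => if eval s e != 0 then exec c1 s else exec c2 s
  | For x b c1 =>
      setv (iteri (vr s b) (fun i t => exec c1 (setv t x i)) s) x (vr s b)
  end.

Fixpoint avars (c : com) : seq nat :=
  match c with
  | Asg x _ => [:: x]
  | Seq c1 c2 | If _ c1 c2 => avars c1 ++ avars c2
  | For x _ c1 => x :: avars c1
  | _ => [::]
  end.

Fixpoint aarrs (c : com) : seq nat :=
  match c with
  | Ast a _ _ => [:: a]
  | Seq c1 c2 | If _ c1 c2 => aarrs c1 ++ aarrs c2
  | For _ _ c1 => aarrs c1
  | _ => [::]
  end.

Lemma exec_vr c s x : x \notin avars c -> vr (exec c s) x = vr s x.
Proof.
elim: c s => [|y e|a i e|c1 IH1 c2 IH2|e c1 IH1 c2 IH2|y b c IH] s //=.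
- by rewrite inE /upd => /negbTE->.
- by rewrite mem_cat negb_or => /andP[n1 n2]; rewrite IH2 // IH1.
- by rewrite mem_cat negb_or => /andP[n1 n2]; case: ifP => _; rewrite ?IH1 ?IH2.
- rewrite inE negb_or /upd => /andP[/negbTE xy nx]; rewrite xy.
  by elim: (vr s b) => [|k IHk] //=; rewrite IH //= /upd xy.
Qed.

Lemma exec_ar c s a : a \notin aarrs c -> ar (exec c s) a = ar s a.
Proof.
elim: c s => [|y e|a' i e|c1 IH1 c2 IH2|e c1 IH1 c2 IH2|y b c IH] s //=.
- by rewrite inE => /negbTE->.
- by rewrite mem_cat negb_or => /andP[n1 n2]; rewrite IH2 // IH1.
- by rewrite mem_cat negb_or => /andP[n1 n2]; case: ifP => _; rewrite ?IH1 ?IH2.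
- by move=> na; elim: (vr s b) => [|k IHk] //=; rewrite IH.
Qed.

(* Memory layout: variables in cells 0 .. 49, the base address in cell 50,
   temporaries in cells 51 .. 99; entry [i] of array [a < 16] lives in cell
   [base + 16 * i + a]. *)
Definition nvars := 50.
Definition tmp k := 51 + k.

(** Four doublings multiply the index by 16, as the machine cannot multiply; [tmp k.+1] is
    scratch. *)
Definition comp_addr (a k : nat) : program :=
  nseq 4 (IAdd (tmp k) (tmp k) (tmp k)) ++
  [:: IAdd (tmp k) (tmp k) nvars; IConst (tmp k.+1) a; IAdd (tmp k) (tmp k) (tmp k.+1)].

Fixpoint comp_e (e : expr) (k : nat) : program :=
  match e with
  | EV x => [:: IConst (tmp k) 0; IAdd (tmp k) (tmp k) x]
  | EC c => [:: IConst (tmp k) c]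
  | EAdd e1 e2 => comp_e e1 k ++ comp_e e2 k.+1 ++ [:: IAdd (tmp k) (tmp k) (tmp k.+1)]
  | ESub e1 e2 => comp_e e1 k ++ comp_e e2 k.+1 ++ [:: ISub (tmp k) (tmp k) (tmp k.+1)]
  | EA a e1 => comp_e e1 k ++ comp_addr a k ++ [:: ILoad (tmp k) (tmp k)]
  end.

(** Jump targets are absolute, hence the position [p]. The machine has neither an unconditional jump
    nor a copy: [IJz] on a zeroed temporary and addition to a zeroed cell replace them. *)
Fixpoint comp (c : com) (p : nat) : program :=
  match c with
  | Skip => [::]
  | Asg x e => comp_e e 0 ++ [:: IConst x 0; IAdd x x (tmp 0)]
  | Ast a i e => comp_e i 0 ++ comp_addr a 0 ++ comp_e e 1 ++ [:: IStore (tmp 0) (tmp 1)]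
  | Seq c1 c2 => let l := comp c1 p in l ++ comp c2 (p + size l)
  | If e c1 c2 =>
      let l0 := comp_e e 0 in
      let l1 := comp c1 (p + size l0 + 1) in
      let p2 := p + size l0 + 1 + size l1 + 2 in
      let l2 := comp c2 p2 in
      l0 ++ [:: IJz (tmp 0) p2] ++ l1
      ++ [:: IConst (tmp 0) 0; IJz (tmp 0) (p2 + size l2)] ++ l2
  | For x b c1 =>
      let l1 := comp c1 (p + 3) in
      [:: IConst x 0; ISub (tmp 0) b x; IJz (tmp 0) (p + 3 + size l1 + 4)] ++ l1
      ++ [:: IConst (tmp 0) 1; IAdd x x (tmp 0); IConst (tmp 0) 0; IJz (tmp 0) p.+1]
  end.

(** Depth below 40 keeps each temporary and the scratch cell above it within cells 51 .. 99. *)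
Fixpoint wfe (e : expr) (k : nat) : bool :=
  match e with
  | EV x => (x < nvars) && (k < 40)
  | EC c => k < 40
  | EAdd e1 e2 | ESub e1 e2 => wfe e1 k && wfe e2 k.+1
  | EA a e1 => [&& a < 16, k < 40 & wfe e1 k]
  end.

(* [bs] collects the loop bounds, which are never assigned. *)
Fixpoint wfc (bs : seq nat) (c : com) : bool :=
  match c with
  | Skip => true
  | Asg x e => [&& x < nvars, x \notin bs & wfe e 0]
  | Ast a i e => [&& a < 16, wfe i 0 & wfe e 1]
  | Seq c1 c2 => wfc bs c1 && wfc bs c2
  | If e c1 c2 => [&& wfe e 0, wfc bs c1 & wfc bs c2]
  | For x b c1 => [&& x < nvars, b < nvars, x \notin bs, b \in bs, x \notin avars c1 & wfc bs c1]
  end.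

(** [N] is to dominate all loop bounds. Each round adds two instructions for the test and four for
    the increment and the jump back; the final 3 are the initialisation and the last test. *)
Fixpoint cost (c : com) (N : nat) : nat :=
  match c with
  | Skip => 0
  | Asg x e => size (comp_e e 0) + 2
  | Ast a i e => size (comp_e i 0) + 7 + size (comp_e e 1) + 1
  | Seq c1 c2 => cost c1 N + cost c2 N
  | If e c1 c2 => size (comp_e e 0) + 3 + cost c1 N + cost c2 N
  | For x b c1 => N * (cost c1 N + 6) + 3
  end.

Lemma wfc_avars bs c x : wfc bs c -> x \in bs -> x \notin avars c.
Proof.
elim: c => [|y e|a i e|c1 IH1 c2 IH2|e c1 IH1 c2 IH2|y b c IH] //=.
- by case/and3P=> _ ny _ xb; rewrite inE; apply: contraNneq ny => <-.
- by case/andP=> w1 w2 xb; rewrite mem_cat negb_or IH1 ?IH2.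
- by case/and3P=> _ w1 w2 xb; rewrite mem_cat negb_or IH1 ?IH2.
case/and5P=> _ _ ny _ /andP[_ wc] xb; rewrite inE negb_or IH // andbT.
by apply: contraNneq ny => <-.
Qed.

Definition code_at (P : program) (p : nat) (l : program) :=
  exists pre post, P = pre ++ l ++ post /\ size pre = p.

Lemma code_at_cat P p l1 l2 : code_at P p (l1 ++ l2) ->
  code_at P p l1 /\ code_at P (p + size l1) l2.
Proof.
case=> pre [post [-> <-]]; split; first by exists pre, (l2 ++ post); rewrite !catA.
by exists (pre ++ l1), post; rewrite size_cat !catA.
Qed.

Lemma code_at_cons P p i l : code_at P p (i :: l) ->
  nth IHalt P p = i /\ code_at P p.+1 l.
Proof.
move=> h; have /code_at_cat[_] := (h : code_at P p ([:: i] ++ l)).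
rewrite addn1; split=> //.
by case: h => pre [post [-> <-]]; rewrite nth_cat ltnn subnn.
Qed.

Definition reach P t (s s' : mstate) := iter t (ram_step P) s = s'.

Lemma reach_trans P t1 t2 s1 s2 s3 :
  reach P t1 s1 s2 -> reach P t2 s2 s3 -> reach P (t1 + t2) s1 s3.
Proof. by move=> <- <-; rewrite /reach addnC iterD. Qed.

Definition istep (i : instr) (p : nat) (m : nat -> nat) : mstate :=
  match i with
  | IConst r c => MState p.+1 (upd m r c)
  | IAdd d a b => MState p.+1 (upd m d (m a + m b))
  | ISub d a b => MState p.+1 (upd m d (m a - m b))
  | ILoad d a => MState p.+1 (upd m d (m (m a)))
  | IStore a v => MState p.+1 (upd m (m a) (m v))
  | IJz r t => MState (if m r == 0 then t else p.+1) m
  | IHalt => MState p m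
  end.

Lemma reachS P t p m i s' : nth IHalt P p = i ->
  reach P t (istep i p m) s' -> reach P t.+1 (MState p m) s'.
Proof.
move=> fi; rewrite /reach iterSr => <-; congr iter.
by rewrite /ram_step /fetch /= fi; case: i {fi}.
Qed.

Lemma reach1 P p m i s' : nth IHalt P p = i -> istep i p m = s' ->
  reach P 1 (MState p m) s'.
Proof. by move=> fi <-; apply: (reachS fi). Qed.

(** * Correctness and running time of the compiled code *)

Section Correctness.
Variable B : nat.
Hypothesis B_ge : 100 <= B.

Definition rep (s : store) (m : nat -> nat) :=
  [/\ forall x, x < nvars -> m x = vr s x, m nvars = B &
      forall a j, a < 16 -> m (B + 16 * j + a) = ar s a j].

Lemma rep_tmp s m k v : k < 49 -> rep s m -> rep s (upd m (tmp k) v).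
Proof.
move=> kb [rv rB ra]; split=> [x lt||a j lt]; rewrite /upd.
- by rewrite ifN ?rv //; move: lt; rewrite /nvars /tmp; lia.
- exact: rB.
- by rewrite ifN ?ra //; rewrite /tmp; lia.
Qed.

Lemma rep_setv s m x v : x < nvars -> rep s m -> rep (setv s x v) (upd m x v).
Proof.
move=> xb [rv rB ra]; split=> [y lt||a j lt] /=; rewrite /upd.
- by case: ifP => // _; rewrite rv.
- by rewrite ifN ?rB //; apply/eqP=> E; rewrite -E ltnn in xb.
- by rewrite ifN ?ra //; move: xb; rewrite /nvars; lia.
Qed.

Lemma rep_seta s m a i v : a < 16 -> rep s m ->
  rep (seta s a i v) (upd m (B + 16 * i + a) v).
Proof.
move=> ab [rv rB ra]; split=> [y lt||b j lt] /=; rewrite /upd.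
- by rewrite ifN ?rv //; move: lt; rewrite /nvars; lia.
- by rewrite ifN //; rewrite /nvars; lia.
have -> : (B + 16 * j + b == B + 16 * i + a) = (b == a) && (j == i).
  by apply/eqP/andP => [E|[/eqP-> /eqP->] //]; split; apply/eqP; lia.
by case: ifP => // _; rewrite ra.
Qed.

Lemma comp_addr_reach P p a k s m : code_at P p (comp_addr a k) -> rep s m ->
  a < 16 -> k < 40 -> exists m', [/\ reach P 7 (MState p m) (MState (p + 7) m'),
    rep s m', m' (tmp k) = B + 16 * m (tmp k) + a &
    forall j, j < k -> m' (tmp j) = m (tmp j)].
Proof.
move=> code rp ab kb.
have kk j c : (tmp j == tmp c) = (j == c) by rewrite /tmp eqn_add2l.
have nk j : (nvars == tmp j) = false by rewrite /tmp /nvars; lia.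
have rB : m nvars = B by case: rp.
do 7![case/code_at_cons: code => ? code].
eexists; split.
- rewrite (_ : p + 7 = p.+4.+3); last by lia.
  by do 7![apply: reachS; first eassumption; rewrite [istep _ _ _]/=].
- by do 7![apply: rep_tmp; first lia].
- by rewrite /upd !kk !eqxx !nk rB ltn_eqF ?gtn_eqF //= ; lia.
- move=> j jk; rewrite /upd !kk !(ltn_eqF jk) ltn_eqF //; lia.
Qed.

(** Temporaries below [k] survive, so the value of a first operand can wait in [tmp k] while the
    second is evaluated. *)
Lemma comp_e_reach P e : forall p k s m, code_at P p (comp_e e k) -> rep s m ->
  wfe e k -> exists m', [/\ reach P (size (comp_e e k)) (MState p m)
      (MState (p + size (comp_e e k)) m'),
    rep s m', m' (tmp k) = eval s e & forall j, j < k -> m' (tmp j) = m (tmp j)].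
Proof.
have kk j c : (tmp j == tmp c) = (j == c) by rewrite /tmp eqn_add2l.
have bin e1 e2 (op : nat -> nat -> nat) (I : nat -> nat -> nat -> instr) :
    (forall d a b p m, istep (I d a b) p m = MState p.+1 (upd m d (op (m a) (m b)))) ->
    (forall p k s m, code_at P p (comp_e e1 k) -> rep s m -> wfe e1 k ->
     exists m', [/\ reach P (size (comp_e e1 k)) (MState p m)
      (MState (p + size (comp_e e1 k)) m'),
      rep s m', m' (tmp k) = eval s e1 & forall j, j < k -> m' (tmp j) = m (tmp j)]) ->
    (forall p k s m, code_at P p (comp_e e2 k) -> rep s m -> wfe e2 k ->
     exists m', [/\ reach P (size (comp_e e2 k)) (MState p m)
      (MState (p + size (comp_e e2 k)) m'),
      rep s m', m' (tmp k) = eval s e2 & forall j, j < k -> m' (tmp j) = m (tmp j)]) ->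
    (forall e k, wfe e k -> k < 40) ->
    forall p k s m, let l := comp_e e1 k ++ comp_e e2 k.+1 ++ [:: I (tmp k) (tmp k) (tmp k.+1)] in
    code_at P p l -> rep s m -> wfe e1 k && wfe e2 k.+1 ->
    exists m', [/\ reach P (size l) (MState p m) (MState (p + size l) m'), rep s m',
      m' (tmp k) = op (eval s e1) (eval s e2) & forall j, j < k -> m' (tmp j) = m (tmp j)].
  move=> HI IH1 IH2 wfk p k s m l /code_at_cat[c1 /code_at_cat[c2 /code_at_cons[c3 _]]] rp /andP[w1 w2].
  have [m1 [r1 rp1 v1 o1]] := IH1 _ _ _ _ c1 rp w1.
  have [m2 [r2 rp2 v2 o2]] := IH2 _ _ _ _ c2 rp1 w2.
  exists (upd m2 (tmp k) (op (m2 (tmp k)) (m2 (tmp k.+1)))); split.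
  - rewrite /l !size_cat; apply: (reach_trans r1); apply: (reach_trans r2).
    by apply: (reachS c3); rewrite HI /reach /= !addnA addn1.
  - by apply: rep_tmp => //; have := wfk _ _ w1; lia.
  - by rewrite /upd eqxx v2 o2 // v1.
  - by move=> j jk; rewrite /upd kk ltn_eqF // o2 ?o1 // ltnW.
have wfk e0 k : wfe e0 k -> k < 40.
  by elim: e0 k => [x|c|e1 IH1 e2 _|e1 IH1 e2 _|a e1 _] k /= => [/andP[]||/andP[/IH1]|/andP[/IH1]|/and3P[]].
elim: e => [x|c|e1 IH1 e2 IH2|e1 IH1 e2 IH2|a e1 IH] p k s m.
- move=> /= /code_at_cons[h1 /code_at_cons[h2 _]] rp /andP[xb kb].
  eexists; split.
  + by apply: (reachS h1); apply: (reachS h2); rewrite /reach /= addn2.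
  + by do 2![apply: rep_tmp; first lia].
  + rewrite /upd !eqxx add0n ifN; first by case: rp => /(_ _ xb).
    by move: xb; rewrite /tmp /nvars; lia.
  + by move=> j jk; rewrite /upd kk ltn_eqF.
- move=> /= /code_at_cons[h1 _] rp kb; eexists; split.
  + by apply: (reachS h1); rewrite /reach /= addn1.
  + by apply: rep_tmp; first lia.
  + by rewrite /upd eqxx.
  + by move=> j jk; rewrite /upd kk ltn_eqF.
- exact: (bin e1 e2 addn IAdd).
- exact: (bin e1 e2 subn ISub).
rewrite -[comp_e _ _]/(comp_e e1 k ++ comp_addr a k ++ [:: ILoad (tmp k) (tmp k)]).
move=> /code_at_cat[c1 /code_at_cat[c2 /code_at_cons[c3 _]]] rp /and3P[ab kb w1].
have [m1 [r1 rp1 v1 o1]] := IH _ _ _ _ c1 rp w1.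
have [m2 [r2 rp2 v2 o2]] := comp_addr_reach c2 rp1 ab kb.
exists (upd m2 (tmp k) (m2 (m2 (tmp k)))); split.
- rewrite !size_cat; apply: (reach_trans r1); apply: (reach_trans r2).
  by apply: (reach1 c3); rewrite /=; congr MState; lia.
- by apply: rep_tmp => //; lia.
- by rewrite /upd eqxx v2 v1; case: rp2 => _ _ ->.
- by move=> j jk; rewrite /upd kk ltn_eqF // o2 ?o1 // ltnW.
Qed.

Lemma comp_reach P bs N c : forall p s m, code_at P p (comp c p) -> rep s m ->
  wfc bs c -> (forall b, b \in bs -> vr s b <= N) ->
  exists t m', [/\ t <= cost c N, reach P t (MState p m) (MState (p + size (comp c p)) m')
    & rep (exec c s) m'].
Proof.
elim: c => [|x e|a i e|c1 IH1 c2 IH2|e c1 IH1 c2 IH2|x b c IH] p s m.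
- by exists 0, m; rewrite addn0.
- move=> /= /code_at_cat[h1 /code_at_cons[h2 /code_at_cons[h3 _]]] rp /and3P[xb _ we] _.
  have [m1 [r1 rp1 v1 _]] := comp_e_reach h1 rp we.
  exists (size (comp_e e 0) + 2), (upd (upd m1 x 0) x (eval s e)); split=> //.
    rewrite size_cat addnA /=; apply: (reach_trans r1); apply: (reachS h2).
    have E : upd m1 x 0 x + upd m1 x 0 (tmp 0) = eval s e.
      by rewrite /upd eqxx add0n ifN ?v1 //; move: xb; rewrite /tmp /nvars; lia.
    by apply: (reach1 h3); rewrite /= E addn2.
  split=> [y yb||b j bb]; rewrite /= /upd.
  + by case: ifP => // ->; case: rp1 => /(_ _ yb).
  + by case: rp1 => _ mB _; rewrite !ifN //; move: xb; rewrite /nvars; lia.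
  + by case: rp1 => _ _ ma; rewrite !ifN ?ma //; move: xb; rewrite /nvars; lia.
- rewrite -[comp _ _]/(comp_e i 0 ++ comp_addr a 0 ++ comp_e e 1 ++ [:: IStore (tmp 0) (tmp 1)]).
  move=> /code_at_cat[h1 /code_at_cat[h2 /code_at_cat[h3 /code_at_cons[h4 _]]]] rp.
  move=> /and3P[ab wi we] _.
  have [m1 [r1 rp1 v1 _]] := comp_e_reach h1 rp wi.
  have [m2 [r2 rp2 v2 _]] := comp_addr_reach h2 rp1 ab isT.
  have [m3 [r3 rp3 v3 o3]] := comp_e_reach h3 rp2 we.
  have rp4 := rep_seta (eval s i) (eval s e) ab rp3.
  rewrite v1 in v2; move: (B + _ + a) v2 rp4 => adr v2 rp4.
  exists (size (comp_e i 0) + 7 + size (comp_e e 1) + 1), (upd m3 adr (eval s e)).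
  split; [exact: leqnn| |exact: rp4].
  rewrite (_ : size (comp_e i 0 ++ _) = size (comp_e i 0) + 7 + size (comp_e e 1) + 1); last first.
    by rewrite !size_cat /=; lia.
  rewrite !addnA; apply: reach_trans (reach1 h4 _).
    by apply: reach_trans r3; apply: reach_trans r1 r2.
  by rewrite /istep o3 // v2 v3 addn1.
- rewrite -[comp _ _]/(comp c1 p ++ comp c2 (p + size (comp c1 p))).
  move=> /code_at_cat[h1 h2] rp /andP[w1 w2] bd.
  have [t1 [m1 [l1 r1 rp1]]] := IH1 _ _ _ h1 rp w1 bd.
  have bd1 b : b \in bs -> vr (exec c1 s) b <= N.
    by move=> bb; rewrite exec_vr ?bd // (wfc_avars w1).
  have [t2 [m2 [l2 r2 rp2]]] := IH2 _ _ _ h2 rp1 w2 bd1.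
  exists (t1 + t2), m2; split=> //; first exact: leq_add.
  by rewrite size_cat addnA; apply: reach_trans r1 r2.
- set l0 := comp_e e 0; set l1 := comp c1 (p + size l0 + 1).
  set p2 := p + size l0 + 1 + size l1 + 2; set l2 := comp c2 p2.
  rewrite -[comp _ _]/(l0 ++ [:: IJz (tmp 0) p2] ++ l1
      ++ [:: IConst (tmp 0) 0; IJz (tmp 0) (p2 + size l2)] ++ l2).
  move=> /code_at_cat[h0 /code_at_cat[/code_at_cons[h1 _] /code_at_cat[h2]]].
  move=> /code_at_cat[/code_at_cons[h3 /code_at_cons[h4 _]] h5].
  move=> rp /and3P[we w1 w2] bd.
  have sz : p + size (l0 ++ [:: IJz (tmp 0) p2] ++ l1
      ++ [:: IConst (tmp 0) 0; IJz (tmp 0) (p2 + size l2)] ++ l2) = p2 + size l2.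
    by rewrite !size_cat /= /p2; lia.
  rewrite sz.
  have [m0 [r0 rp0 v0 _]] := comp_e_reach h0 rp we.
  rewrite [exec _ _]/=; case: ifPn => [nz|/negPn/eqP z].
    have [t1 [m1 [le1 r1 rp1]]] := IH1 _ _ _ h2 rp0 w1 bd.
    exists (size l0 + (1 + (t1 + 2))), (upd m1 (tmp 0) 0); split.
    + by rewrite /= -/l0; lia.
    + apply: (reach_trans r0); apply: reach_trans.
        by apply: (reach1 h1); rewrite /= v0 (negbTE nz) -addn1.
      apply: (reach_trans r1); apply: (reachS h3); exact: (reach1 h4).
    + exact: rep_tmp.
  have h5' : code_at P p2 l2 by move: h5; rewrite /= /p2.
  have [t2 [m2 [le2 r2 rp2]]] := IH2 _ _ _ h5' rp0 w2 bd.
  exists (size l0 + (1 + t2)), m2; split=> //.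
  + by rewrite /= -/l0; lia.
  + apply: (reach_trans r0); apply: reach_trans r2.
    by apply: (reach1 h1); rewrite /= v0 z.
set l1 := comp c (p + 3).
rewrite -[comp _ _]/([:: IConst x 0; ISub (tmp 0) b x; IJz (tmp 0) (p + 3 + size l1 + 4)]
  ++ l1 ++ [:: IConst (tmp 0) 1; IAdd x x (tmp 0); IConst (tmp 0) 0; IJz (tmp 0) p.+1]).
move=> /code_at_cat[/code_at_cons[h1 /code_at_cons[h2 /code_at_cons[h3 _]]]].
move=> /code_at_cat[h4 /code_at_cons[h5 /code_at_cons[h6 /code_at_cons[h7 /code_at_cons[h8 _]]]]].
move=> rp /and5P[xb bb xbs bbs /andP[xc wc]] bd.
rewrite !size_cat [size [:: _; _; _]]/= [size [:: _; _; _; _]]/= !addnA.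
have bx : b != x by apply: contraNneq xbs => <-.
pose n := vr s b; have nN : n <= N by apply: bd.
pose st i := iteri i (fun i t => exec c (setv t x i)) s.
have vst i b' : b' \in bs -> vr (st i) b' = vr s b'.
  move=> b'in; have b'x : b' != x by apply: contraNneq xbs => <-.
  elim: i => [|i IHi] //=; rewrite exec_vr ?(wfc_avars wc) //= /upd (negbTE b'x).
  exact: IHi.
have tx k : (tmp k == x) = false by move: xb; rewrite /tmp /nvars; lia.
(* The invariant sits at the loop test, where the counter already holds [i]: the body leaves the
   counter alone and the closing code increments it. *)
have main i : i <= n -> exists t m', [/\ t <= 1 + i * (cost c N + 6),
    reach P t (MState p m) (MState p.+1 m') & rep (setv (st i) x i) m'].
  elim: i => [|i IHi] le.
    exists 1, (upd m x 0); split=> //; first exact: (reach1 h1).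
    exact: rep_setv.
  have [t [m1 [le1 r1 rp1]]] := IHi (ltnW le).
  pose m2 := upd m1 (tmp 0) (m1 b - m1 x).
  have rp2 : rep (setv (st i) x i) m2 by apply: rep_tmp.
  have bnz : m1 b - m1 x != 0.
    case: rp1 => rv _ _; rewrite !rv // /= /upd eqxx (negbTE bx) vst //.
    by rewrite subn_eq0 -ltnNge.
  have bd2 b' : b' \in bs -> vr (setv (st i) x i) b' <= N.
    move=> b'in; have b'x : b' != x by apply: contraNneq xbs => <-.
    by rewrite /= /upd (negbTE b'x) vst ?bd.
  have [t3 [m3 [le3 r3 rp3]]] := IH _ _ _ h4 rp2 wc bd2.
  pose m4 := upd m3 (tmp 0) 1; pose m5 := upd m4 x (m4 x + m4 (tmp 0)).
  exists (t + (2 + (t3 + 4))), (upd m5 (tmp 0) 0); split.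
  + by rewrite mulSn; lia.
  + apply: (reach_trans r1); apply: reach_trans.
      apply: (reachS h2); apply: (reach1 h3).
      by rewrite [istep _ _ _]/= {1}/upd eqxx (negbTE bnz) -addn3.
    apply: (reach_trans r3); apply: (reachS h5); apply: (reachS h6).
    by apply: (reachS h7); exact: (reach1 h8).
  + apply: rep_tmp => //.
    have m4x : m4 x = i.
      rewrite /m4 /upd eq_sym tx; case: rp3 => rv _ _.
      by rewrite rv // exec_vr //= /upd eqxx.
    rewrite /m5 m4x [m4 (tmp 0)]/= addn1.
    have vx y : setv (st i.+1) x y = setv (exec c (setv (st i) x i)) x y by [].
    by rewrite vx; apply: rep_setv => //; apply: rep_tmp.
have [t [m1 [le1 r1 rp1]]] := main n (leqnn n).
exists (t + 2), (upd m1 (tmp 0) (m1 b - m1 x)); split.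
- apply: leq_trans (_ : 1 + N * (cost c N + 6) + 2 <= _); last by rewrite /=; lia.
  by rewrite leq_add2r (leq_trans le1) // leq_add2l leq_mul2r nN orbT.
- apply: (reach_trans r1); apply: (reachS h2); apply: (reach1 h3).
  case: rp1 => rv _ _; rewrite [istep _ _ _]/= {1}/upd eqxx.
  rewrite !rv // /= /upd eqxx (negbTE bx) vst // subnn eqxx; congr MState; lia.
- by apply: rep_tmp.
Qed.

End Correctness.

(** * Exchanges and the walk table *)

Section NatAssignments.
Variables (n ne : nat) (T H : nat -> nat).

(* [f] selects an arc leaving each node, and [iv] inverts [H \o f]. *)
Definition valid (f iv : nat -> nat) :=
  forall x, x < n -> [/\ f x < ne, T (f x) = x & iv (H (f x)) = x].

Definition nsum (w f : nat -> nat) := \sum_(x < n) w (f x).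

(** The first arc is written last, which is the order in which [Apply] reads a walk off the table,
    from its end. *)
Fixpoint updf (ds : seq nat) (f : nat -> nat) : nat -> nat :=
  if ds is d :: ds' then upd (updf ds' f) (T d) d else f.

Fixpoint updiv (ds : seq nat) (iv : nat -> nat) : nat -> nat :=
  if ds is d :: ds' then upd (updiv ds' iv) (H d) (T d) else iv.

Lemma updf_in ds f d : uniq (map T ds) -> d \in ds -> updf ds f (T d) = d.
Proof.
elim: ds => [|e ds IH] //= /andP[ne_ u]; rewrite inE /upd => /orP[/eqP->|dds].
  by rewrite eqxx.
by rewrite ifN ?IH //; apply: contraNneq ne_ => <-; apply: map_f.
Qed.

Lemma updf_out ds f x : x \notin map T ds -> updf ds f x = f x.
Proof.
elim: ds => [|e ds IH] //=; rewrite inE negb_or /upd => /andP[/negbTE-> /IH].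
by [].
Qed.

Lemma updiv_in ds iv d : uniq (map H ds) -> d \in ds -> updiv ds iv (H d) = T d.
Proof.
elim: ds => [|e ds IH] //= /andP[ne_ u]; rewrite inE /upd => /orP[/eqP->|dds].
  by rewrite eqxx.
by rewrite ifN ?IH //; apply: contraNneq ne_ => <-; apply: map_f.
Qed.

Lemma updiv_out ds iv x : x \notin map H ds -> updiv ds iv x = iv x.
Proof.
elim: ds => [|e ds IH] //=; rewrite inE negb_or /upd => /andP[/negbTE-> /IH].
by [].
Qed.

Lemma nsum_upd w f a d : a < n -> nsum w (upd f a d) + w (f a) = nsum w f + w d.
Proof.
move=> an; rewrite /nsum (bigD1 (Ordinal an)) //= [in RHS](bigD1 (Ordinal an)) //=.
rewrite /upd eqxx addnAC [RHS]addnAC [w d + _]addnC; congr (_ + _).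
by apply: eq_bigr => i /eqP ia; rewrite ifN //; apply/eqP => E; apply: ia; apply/val_inj.
Qed.

(** Along a closed walk the vertices reached are the tails in another order. So the heads brought in
    are exactly the heads given up, and all heads stay distinct. *)
Lemma valid_update f iv x ds : valid f iv -> (forall d, d < ne -> T d < n) ->
  walk T (iv \o H) x ds x -> all (fun d => d < ne) ds -> uniq (map T ds) ->
  valid (updf ds f) (updiv ds iv) /\
  forall w, nsum w (updf ds f) + wsum (fun d => w (f (T d))) ds = nsum w f + wsum w ds.
Proof.
move=> vf Tn wk lt u.
have tgt : perm_eq (map (iv \o H) ds) (map T ds).
  by rewrite -(perm_cons x) -(walk_nodes wk) perm_rcons.
have uH : uniq (map H ds).
  have : uniq (map iv (map H ds)) by rewrite -map_comp (perm_uniq tgt).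
  exact: map_uniq.
split=> [y yn|w].
  have [/mapP[d dds yE]|nin] := boolP (y \in map T ds).
    rewrite yE updf_in // updiv_in //; split=> //.
    by move/allP: lt => /(_ _ dds).
  rewrite updf_out //; have [? ? iy] := vf _ yn; split=> //.
  rewrite updiv_out //; apply: contraNN nin => /mapP[d dds E].
  by rewrite -(perm_mem tgt) -iy E (map_f (iv \o H) dds).
elim: ds {wk tgt uH x} lt u => [|d ds IH] /=; first by rewrite /wsum !big_nil.
move=> /andP[dlt lt] /andP[nin u]; have := IH lt u.
rewrite !wsum_cons; have := nsum_upd w (updf ds f) d (Tn _ dlt).
by rewrite (updf_out f nin); rewrite /=; lia.
Qed.

End NatAssignments.

(** Recovers length and both weights of a walk from its packed cost. *)
Lemma decode P a b c a' b' c' : b < P -> c < P -> b' < P -> c' < P ->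
  a * (P * P) + b * P + c = a' * (P * P) + b' * P + c' -> [/\ a = a', b = b' & c = c'].
Proof.
move=> bP cP bP' cP'.
have fact x y z : x * (P * P) + y * P + z = (x * P + y) * P + z.
  by rewrite mulnDl mulnA.
have P0 : 0 < P by lia.
rewrite !fact => E.
have := congr1 (divn^~ P) E; have := congr1 (modn^~ P) E.
rewrite !modnMDl !divnMDl // !modn_small // !divn_small // !addn0 => -> {}E.
have := congr1 (divn^~ P) E; have := congr1 (modn^~ P) E.
by rewrite !modnMDl !divnMDl // !modn_small // !divn_small // !addn0.
Qed.

Section Table.
(* Entry [c * n + v] of the table [R] tells whether some walk of cost [c] goes
   from [s] to [v], storing the successor of its last arc. *)
Variables (n ne : nat) (T Y K : nat -> nat) (s : nat).

Definition pred_arc (R : nat -> nat) c v d :=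
  [&& d < ne, Y d == v, K d <= c & R ((c - K d) * n + T d) != 0].

(** As arcs have positive cost, only the empty walk has cost 0; a nonzero entry there is a mere mark
    and names no arc. *)
Definition cell_ok (R : nat -> nat) c v :=
  if R (c * n + v) is d.+1 then
    if c == 0 then v == s else pred_arc R c v d
  else if c == 0 then v != s else [forall d : 'I_ne, ~~ pred_arc R c v d].

Variables (R : nat -> nat) (C : nat).
Hypothesis ok : forall c v, c < C -> v < n -> cell_ok R c v.
Hypothesis Tn : forall d, d < ne -> T d < n.
Hypothesis K_gt0 : forall d, d < ne -> 0 < K d.

Lemma table_sound c v : c < C -> v < n -> R (c * n + v) != 0 ->
  exists ds, [/\ walk T Y s ds v, all (fun d => d < ne) ds & wsum K ds = c].
Proof.
elim/ltn_ind: c v => c IH v cC vn nz; have := ok cC vn; rewrite /cell_ok.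
case: (R _) nz => [|d] // _; case: eqP => [-> /eqP->|_ /and4P[dl /eqP Yv Kc nz]].
  by exists [::]; rewrite /= eqxx /wsum big_nil.
have [||ds [wk lt sm]] := IH _ _ (T d) _ (Tn dl) nz; [have := K_gt0 dl; lia|lia|].
exists (rcons ds d); split.
- by rewrite -cats1; apply/walk_catP; exists (T d) => //=; rewrite Yv !eqxx.
- by rewrite all_rcons dl.
- by rewrite -cats1 wsum_cat sm /wsum big_seq1 subnK.
Qed.

Lemma table_complete ds v : walk T Y s ds v -> all (fun d => d < ne) ds -> s < n ->
  v < n -> wsum K ds < C -> R (wsum K ds * n + v) != 0.
Proof.
elim/last_ind: ds v => [|ds d IH] v.
  rewrite /= /wsum big_nil => /eqP<- _ sn _ C0.
  by have := ok C0 sn; rewrite /cell_ok /=; case: (R _) => //; rewrite eqxx.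
rewrite -cats1 => /walk_catP[y wk /= /andP[/eqP Ty /eqP Yv]].
rewrite all_cat /= andbT => /andP[lt dl] sn vn.
rewrite wsum_cat [wsum _ [:: _]]big_seq1 => CC.
have yn : y < n by rewrite -Ty Tn.
have nz := IH _ wk lt sn yn (leq_ltn_trans (leq_addr _ _) CC).
have := ok CC vn; rewrite /cell_ok addn_eq0 (gtn_eqF (K_gt0 dl)) andbF.
case: (R _) => // /forallP /(_ (Ordinal dl)).
by rewrite /pred_arc dl Yv eqxx leq_addl addnK Ty nz.
Qed.

End Table.

(** * The program *)

(** Truth is being nonzero, so addition serves as disjunction; [eNot] returns 0 or 1. *)
Definition eNot e := ESub (EC 1) e.
Definition eLt a b := ESub b a.
Definition eLe a b := eNot (ESub a b).
Definition eEq a b := eNot (EAdd (ESub a b) (ESub b a)).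
Definition eAnd a b := eNot (EAdd (eNot a) (eNot b)).
Definition eOr a b := EAdd a b.
Definition eInc a := EAdd a (EC 1).

Lemma ev_not s e : (eval s (eNot e) != 0) = ~~ (eval s e != 0).
Proof. by rewrite /eNot /=; case: (eval s e). Qed.
Lemma ev_lt s a b : (eval s (eLt a b) != 0) = (eval s a < eval s b).
Proof. by rewrite /eLt /= subn_eq0 -ltnNge. Qed.
Lemma ev_le s a b : (eval s (eLe a b) != 0) = (eval s a <= eval s b).
Proof. by rewrite ev_not /= negbK subn_eq0. Qed.
Lemma ev_eq s a b : (eval s (eEq a b) != 0) = (eval s a == eval s b).
Proof. by rewrite ev_not /= negbK addn_eq0 !subn_eq0 -eqn_leq. Qed.
Lemma ev_and s a b :
  (eval s (eAnd a b) != 0) = (eval s a != 0) && (eval s b != 0).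
Proof. by rewrite /eAnd ev_not /=; case: (eval s a); case: (eval s b). Qed.
Lemma ev_or s a b :
  (eval s (eOr a b) != 0) = (eval s a != 0) || (eval s b != 0).
Proof. by rewrite /=; case: (eval s a); case: (eval s b). Qed.
Definition evE := (ev_not, ev_lt, ev_le, ev_eq, ev_and, ev_or).

Arguments eNot : simpl never.
Arguments eLt : simpl never.
Arguments eLe : simpl never.
Arguments eEq : simpl never.
Arguments eAnd : simpl never.
Arguments eOr : simpl never.

Fixpoint block (l : seq com) : com :=
  match l with
  | [::] => Skip
  | [:: c] => c
  | c :: l' => Seq c (block l')
  end.

Notation "x ::= e" := (Asg x e) (at level 70).
Notation When e c := (If e c Skip).

(** Repeated addition with counter cell 26. The factor [b] is a loop bound and so must be one of the
    variables that are never assigned. *)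
Definition Mul dst y b :=
  Seq (dst ::= EC 0) (For 26 b (dst ::= EAdd (EV dst) (EV y))).

(* With [m] edges and [n] vertices, arc [e < m] is edge [e], arc [m + e] its reverse and
   arc [2 * m + x] a loop at [x]; [aT], [aH], [aRD], [aW] hold tails, heads, redness
   and weights. [aME] is the current assignment and [aIV] the inverse of its heads.
   [iBEST] is one more than the red count of the best candidate [aBME], or zero if
   there is none. *)
Notation iN := 0 (only parsing).
Notation iM := 1 (only parsing).
Notation iM2 := 2 (only parsing).
Notation iNE := 3 (only parsing).
Notation iP := 4 (only parsing).
Notation iPP := 5 (only parsing).
Notation iCM := 6 (only parsing).
Notation iBAD := 7 (only parsing).
Notation iKK := 8 (only parsing).
Notation iCAP := 9 (only parsing).
Notation iBEST := 10 (only parsing).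
Notation iFND := 23 (only parsing).
Notation iOM := 24 (only parsing).
Notation iRES := 37 (only parsing).
Notation aIN := 0 (only parsing).
Notation aT := 1 (only parsing).
Notation aH := 2 (only parsing).
Notation aRD := 3 (only parsing).
Notation aW := 4 (only parsing).
Notation aME := 5 (only parsing).
Notation aIV := 6 (only parsing).
Notation aK := 7 (only parsing).
Notation aY := 8 (only parsing).
Notation aR := 9 (only parsing).
Notation aBME := 10 (only parsing).
Notation aOUT := 11 (only parsing).
Notation aCP := 12 (only parsing).
Notation aCL := 13 (only parsing).

Notation xL := 17 (only parsing).
Notation xS := 18 (only parsing).

(* [aR] is the table of walks starting at [xS], for the costs [aK] set by [Prepare]. *)
Definition FillArc :=
  When (eAnd (eEq (EA aY (EV 14)) (EV 20)) (eLe (EA aK (EV 14)) (EV 19)))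
    (block [:: 29 ::= ESub (EV 19) (EA aK (EV 14)); Mul 30 29 iN;
      When (EA aR (EAdd (EV 30) (EA aT (EV 14)))) (Ast aR (EV 28) (eInc (EV 14)))]).

Definition FillArcs := For 14 iNE FillArc.

Definition FillCell :=
  block [:: Mul 25 19 iN; 28 ::= EAdd (EV 25) (EV 20);
    If (eAnd (eEq (EV 19) (EC 0)) (eEq (EV 20) (EV xS)))
       (Ast aR (EV 28) (EC 1)) (Ast aR (EV 28) (EC 0));
    FillArcs].

Definition Fill := For 19 iCM (For 20 iN FillCell).

(** The remaining cost in cell 29 is the guard, so that rounds after the end of the walk do
    nothing. *)
Definition ApplyStep :=
  When (EV 29)
    (block [:: Mul 25 29 iN; 31 ::= ESub (EA aR (EAdd (EV 25) (EV 28))) (EC 1);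
      Ast aME (EA aT (EV 31)) (EV 31); Ast aIV (EA aH (EV 31)) (EA aT (EV 31));
      29 ::= ESub (EV 29) (EA aK (EV 31)); 28 ::= EA aT (EV 31)]).

Definition Apply :=
  block [:: 28 ::= EV xS; 29 ::= EV 27; For 30 iN ApplyStep].

(* Tries a closed walk of [xL + 1] arcs, of weight cell 21, replacing arcs of weight
   cell 22. *)
Definition TryCell :=
  When (eAnd (eNot (EV iFND)) (eAnd (eLt (EV 22) (EV 21)) (eLe (EAdd (EV 21) (EV iOM)) (EV iCAP))))
    (block [:: 36 ::= eInc (EV xL); Mul 27 36 iPP; Mul 25 21 iP;
      27 ::= EAdd (EV 27) (EAdd (EV 25) (EV 22)); Mul 25 27 iN;
      When (EA aR (EAdd (EV 25) (EV xS))) (Seq (iFND ::= EC 1) Apply)]).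

Definition TryNode :=
  When (eNot (EV iFND)) (Seq Fill (For 21 iP (For 22 iP TryCell))).

(* The cost of an arc packs its length 1, its weight and the weight of the arc that it
   replaces into the digits of a number in base [P]. *)
Definition Prepare :=
  block [:: iOM ::= EC 0;
    For 15 iN (iOM ::= EAdd (EV iOM) (EA aW (EA aME (EV 15))));
    For 14 iNE (block [:: 36 ::= EA aW (EV 14); Mul 25 36 iP;
      Ast aK (EV 14) (EAdd (EV iPP) (EAdd (EV 25) (EA aW (EA aME (EA aT (EV 14))))));
      Ast aY (EV 14) (EA aIV (EA aH (EV 14)))])].

(* Trying lengths in increasing order makes the walk found simple. *)
Definition Improve :=
  block [:: Prepare; iFND ::= EC 0; For xL iN (For xS iN TryNode)].

(** Each improvement raises an integer weight that cannot exceed [n * n.+1 < P], so [P] rounds end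
    at a stuck assignment. *)
Definition Search := For 16 iP Improve.

(* Maximal weight first maximises the number of arcs that are no loops and compatible
   with the arcs in cells 12 and 13, then minimises the number of red ones. *)
Definition SetWeights :=
  For 14 iNE (If (eAnd (eLt (EV 14) (EV iM2))
      (eAnd (eOr (eEq (EV 14) (EV 12)) (eNot (eEq (EA aT (EV 14)) (EA aT (EV 12)))))
            (eOr (eEq (EV 14) (EV 13)) (eNot (eEq (EA aT (EV 14)) (EA aT (EV 13)))))))
    (Ast aW (EV 14) (ESub (eInc (EV iN)) (EA aRD (EV 14))))
    (Ast aW (EV 14) (EC 0))).

Definition SetLoops :=
  For 15 iN (Seq (Ast aME (EV 15) (EAdd (EV iM2) (EV 15))) (Ast aIV (EV 15) (EV 15))).

Definition Evaluate :=
  block [:: 32 ::= EC 1; 33 ::= EC 0;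
    For 15 iN (Seq (When (eNot (EA aW (EA aME (EV 15)))) (32 ::= EC 0))
                   (33 ::= EAdd (EV 33) (EA aRD (EA aME (EV 15)))))].

(** As [iBEST] is shifted by one, the last test asks for a strictly redder candidate and passes when
    there is none yet. *)
Definition Record :=
  When (eAnd (EV 32) (eAnd (eLe (EV 33) (EV iKK)) (eLe (EV iBEST) (EV 33))))
    (Seq (iBEST ::= eInc (EV 33)) (For 15 iN (Ast aBME (EV 15) (EA aME (EV 15))))).

(* The cap exceeds all weights, so that [Search] reaches an optimum. *)
Definition Candidate :=
  block [:: SetWeights; SetLoops; iCAP ::= EAdd (EV iP) (EV iP); Search; Evaluate; Record].

Definition Candidates :=
  Seq (iBEST ::= EC 0) (For 12 iM2 (For 13 iM2 Candidate)).

(** A loop weighs [n + 1], more than the cap [iKK], which [Check] cuts to at most [n]; hence no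
    improvement can bring in a loop. *)
Definition SetRedWeights :=
  For 14 iNE (If (eLt (EV 14) (EV iM2)) (Ast aW (EV 14) (EA aRD (EV 14)))
    (Ast aW (EV 14) (eInc (EV iN)))).

Definition Restore :=
  For 15 iN (Seq (Ast aME (EV 15) (EA aBME (EV 15))) (Ast aIV (EA aH (EA aBME (EV 15))) (EV 15))).

Definition Output :=
  Seq (For 11 iM (Ast aOUT (EV 11) (EC 0)))
    (For 15 iN (When (eNot (EA aCL (EV 15)))
      (Seq (14 ::= EA aME (EV 15))
         (If (eLt (EV 14) (EV iM)) (Ast aOUT (EV 14) (EC 1))
            (Ast aOUT (ESub (EV 14) (EV iM)) (EC 1)))))).

Definition Final :=
  If (eAnd (EV iBEST) (eNot (EV iBAD)))
    (block [:: SetRedWeights; Restore; iCAP ::= EV iKK; Search; Output; iRES ::= EC 1])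
    (iRES ::= EC 0).

Definition ParseEdge :=
  block [:: 25 ::= EAdd (EV 11) (EAdd (EV 11) (EV 11));
    Ast aT (EV 11) (EA aIN (EV 25)); Ast aH (EV 11) (EA aIN (eInc (EV 25)));
    Ast aT (EAdd (EV iM) (EV 11)) (EA aIN (eInc (EV 25)));
    Ast aH (EAdd (EV iM) (EV 11)) (EA aIN (EV 25))].

Definition ParseLoop :=
  block [:: Ast aT (EAdd (EV iM2) (EV 15)) (EV 15); Ast aH (EAdd (EV iM2) (EV 15)) (EV 15);
    Ast aCP (EV 15) (EV 15); Ast aCL (EV 15) (EC 0)].

Definition Recolor :=
  When (eEq (EA aCP (EV 15)) (EV 34))
    (Seq (Ast aCP (EV 15) (EV 36))
       (When (EV 35) (Ast aCL (EV 15) (eNot (EA aCL (EV 15)))))).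

(* [aCP] names the component of a vertex among the edges read so far, and [aCL] its
   side; joining two components flips one of them when the sides clash. *)
Definition Merge :=
  block [:: 34 ::= EA aCP (EA aT (EV 11)); 36 ::= EA aCP (EA aH (EV 11));
    35 ::= eEq (EA aCL (EA aT (EV 11))) (EA aCL (EA aH (EV 11)));
    When (eNot (eEq (EV 34) (EV 36))) (For 15 iN Recolor)].

Definition RedEdge :=
  block [:: 25 ::= EAdd (EV 11) (EAdd (EV 11) (EAdd (EV 11) (EC 2)));
    If (eNot (EA aCL (EA aT (EV 11)))) (Ast aRD (EV 11) (EA aIN (EV 25))) (Ast aRD (EV 11) (EC 0));
    If (eNot (EA aCL (EA aH (EV 11)))) (Ast aRD (EAdd (EV iM) (EV 11)) (EA aIN (EV 25)))
       (Ast aRD (EAdd (EV iM) (EV 11)) (EC 0))].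

Definition Parse :=
  block [:: For 11 iM ParseEdge; For 15 iN ParseLoop; For 11 iM Merge; For 11 iM RedEdge].

(* A graph with more than twice as many vertices as edges has no perfect matching;
   it is rejected at once, as its number of vertices may be exponential in the
   input size. *)
Definition Check :=
  block [:: iM2 ::= EAdd (EV iM) (EV iM); iBAD ::= EA aIN (EAdd (EV iM) (EV iM2));
    iKK ::= EA aIN (EAdd (EV iM) (eInc (EV iM2)));
    When (eLt (EV iM2) (EV iN)) (Seq (iBAD ::= EC 1) (iN ::= EC 0));
    When (eLt (EV iN) (EV iKK)) (iKK ::= EV iN);
    iNE ::= EAdd (EV iM2) (EV iN)].

Definition SetP := Seq (Mul iP iN iN) (iP ::= EAdd (EV iP) (eInc (EV iN))).
Definition SetPP := Mul iPP iP iP.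
Definition SetCM := Seq (36 ::= eInc (EV iN)) (Mul iCM 36 iPP).
Definition Main := block [:: Parse; Candidates; Final].

(** Code must not assign its own loop bounds, yet [iPP] and [iCM] are computed by loops over bounds
    computed earlier. So each stage is checked against just the bounds that it uses. *)
Lemma wf_Check : wfc [::] Check. Proof. by []. Qed.
Lemma wf_SetP : wfc [:: iN] SetP. Proof. by []. Qed.
Lemma wf_SetPP : wfc [:: iP] SetPP. Proof. by []. Qed.
Lemma wf_SetCM : wfc [:: iPP] SetCM. Proof. by []. Qed.
Lemma wf_Main : wfc [:: iN; iM; iM2; iNE; iP; iPP; iCM] Main.
Proof. by vm_compute. Qed.

(** * Correctness of the local search *)

(** [I] must survive overwriting the counter, which is set before each body and once more at the
    end. The step may assume that whatever the loop does not assign keeps its initial value, so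
    invariants mention only what changes. *)
Lemma exec_for x b c s (I : nat -> store -> Prop) :
  I 0 s -> (forall i t v, I i t -> I i (setv t x v)) ->
  (forall i t, i < vr s b -> (forall y, y \notin x :: avars c -> vr t y = vr s y) ->
    (forall a, a \notin aarrs c -> ar t a = ar s a) -> I i t -> I i.+1 (exec c (setv t x i))) ->
  I (vr s b) (exec (For x b c) s).
Proof.
move=> I0 Iv IS; rewrite /=; apply: Iv.
pose t i := iteri i (fun i t => exec c (setv t x i)) s.
suff : forall i, i <= vr s b -> [/\ I i (t i),
    forall y, y \notin x :: avars c -> vr (t i) y = vr s y &
    forall a, a \notin aarrs c -> ar (t i) a = ar s a] by move=> /(_ _ (leqnn _))[].
elim=> [|i IH] // lt; have [h1 h2 h3] := IH (ltnW lt); split=> [|y|a na].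
- exact: IS.
- rewrite inE negb_or => /andP[yx ny] /=.
  by rewrite exec_vr // /= /upd (negbTE yx) h2 // inE negb_or yx.
- by rewrite /= exec_ar ?h3.
Qed.

Lemma exec_ar0 c s : aarrs c = [::] -> ar (exec c s) = ar s.
Proof.
elim: c s => [|y e|a' i e|c1 IH1 c2 IH2|e c1 IH1 c2 IH2|y b c IH] s //=.
- by case E: (aarrs c1) => // /IH2 E2; rewrite E2 IH1.
- by case E: (aarrs c1) => // E2; case: ifP => _; rewrite ?IH1 ?IH2.
- by move/IH => E; elim: (vr s b) => [|k IHk] //=; rewrite E.
Qed.

Lemma exec_seq c1 c2 s : exec (Seq c1 c2) s = exec c2 (exec c1 s).
Proof. by []. Qed.

Lemma exec_Mul dst y b s : dst != 26 -> y != dst -> y != 26 -> b != dst ->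
  vr (exec (Mul dst y b) s) dst = vr s y * vr s b.
Proof.
move=> d26 yd y26 bd; rewrite /Mul exec_seq.
set s0 := exec _ s.
have s0b z : z != dst -> vr s0 z = vr s z by move=> zd; rewrite /= /upd (negbTE zd).
have s0d : vr s0 dst = 0 by rewrite /= /upd eqxx.
rewrite -(s0b b) //.
have := @exec_for 26 b (dst ::= EAdd (EV dst) (EV y)) s0
  (fun i t => vr t dst = vr s y * i /\ vr t y = vr s y).
case=> //.
- by rewrite muln0 s0d s0b.
- by move=> i t v /= [h1 h2]; rewrite /upd (negbTE d26) (negbTE y26).
- move=> i t _ _ _ [h1 h2]; rewrite /= /upd (negbTE d26) (negbTE y26) eqxx (negbTE yd).
  by rewrite h1 h2 mulnS addnC.
Qed.

Lemma Mul_ar dst y b s : ar (exec (Mul dst y b) s) = ar s.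
Proof. exact: exec_ar0. Qed.

Arguments Mul : simpl never.

Arguments exec : simpl never.
Arguments eval : simpl never.

(* Symbolic execution: unfolds commands and expressions syntactically, and reads
   variables and arrays through commands that do not assign them. *)
Ltac unfold_step :=
  match goal with
  | |- context [vr (exec ?c ?s) ?x] => rewrite (@exec_vr c s x isT)
  | |- context [ar (exec ?c ?s) ?a] => rewrite (@exec_ar c s a isT)
  | |- context [block ?l] => progress cbn [block]
  | |- context [exec (Seq ?c1 ?c2) ?s] =>
      change (exec (Seq c1 c2) s) with (exec c2 (exec c1 s))
  | |- context [exec (Asg ?x ?e) ?s] =>
      change (exec (Asg x e) s) with (setv s x (eval s e))
  | |- context [exec (Ast ?a ?i ?e) ?s] =>
      change (exec (Ast a i e) s) with (seta s a (eval s i) (eval s e))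
  | |- context [exec (If ?e ?c1 ?c2) ?s] =>
      change (exec (If e c1 c2) s) with (if eval s e != 0 then exec c1 s else exec c2 s)
  | |- context [exec Skip ?s] => change (exec Skip s) with s
  | |- context [eval ?s (EV ?x)] => change (eval s (EV x)) with (vr s x)
  | |- context [eval ?s (EC ?x)] => change (eval s (EC x)) with x
  | |- context [eval ?s (EAdd ?e1 ?e2)] =>
      change (eval s (EAdd e1 e2)) with (eval s e1 + eval s e2)
  | |- context [eval ?s (ESub ?e1 ?e2)] =>
      change (eval s (ESub e1 e2)) with (eval s e1 - eval s e2)
  | |- context [eval ?s (EA ?a ?e1)] =>
      change (eval s (EA a e1)) with (ar s a (eval s e1))
  | |- context [eval ?s (eInc ?e1)] =>
      change (eval s (eInc e1)) with (eval s e1 + 1)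
  | |- context [ar (setv ?s ?x ?v)] => change (ar (setv s x v)) with (ar s)
  | |- context [vr (seta ?s ?a ?i ?v)] => change (vr (seta s a i v)) with (vr s)
  | |- context [vr (setv ?s ?x ?v) ?y] =>
      let b := eval compute in (y == x) in
      match b with
      | true => change (vr (setv s x v) y) with v
      | false => change (vr (setv s x v) y) with (vr s y)
      end
  | |- context [ar (seta ?s ?a ?i ?v) ?b] =>
      let c := eval compute in (b == a) in
      match c with
      | true => change (ar (seta s a i v) b) with (upd (ar s a) i v)
      | false => change (ar (seta s a i v) b) with (ar s b)
      end
  | |- context [ar (exec (Mul ?d ?y ?b) ?s)] => rewrite (Mul_ar d y b s)
  | |- context [vr (exec (Mul ?d ?y ?b) ?s) ?d] =>
      rewrite (@exec_Mul d y b s isT isT isT isT)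
  end.
Ltac unf := repeat unfold_step.

Lemma mulD_inj n c v c' v' : v < n -> v' < n -> c * n + v = c' * n + v' -> c = c' /\ v = v'.
Proof.
move=> vn vn' E; have n0 : 0 < n by lia.
have := congr1 (divn^~ n) E; have := congr1 (modn^~ n) E.
by rewrite !modnMDl !divnMDl // !modn_small // !divn_small // !addn0.
Qed.

Section Verification.
Variables (n ne P : nat) (T H : nat -> nat).
Hypothesis TH : forall d, d < ne -> T d < n /\ H d < n.
Hypothesis P_gt : n * n.+1 < P.

Definition env (s : store) :=
  [/\ [/\ vr s iN = n, vr s iNE = ne & vr s iP = P],
      vr s iPP = P * P, vr s iCM = n.+1 * (P * P), ar s aT = T & ar s aH = H].

Definition env_safe c :=
  all (fun x => x \notin avars c) [:: iN; iNE; iP; iPP; iCM]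
  && all (fun a => a \notin aarrs c) [:: aT; aH].

Lemma env_exec c s : env_safe c -> env s -> env (exec c s).
Proof.
case/andP=> /and5P[? ? ? ? /andP[? _]] /and3P[? ? _] [[? ? ?] ? ? ? ?].
by split; [split| | | |]; rewrite ?exec_vr ?exec_ar.
Qed.

Lemma env_setv x v s : x \notin [:: iN; iNE; iP; iPP; iCM] -> env s -> env (setv s x v).
Proof. by move=> nx; apply: (@env_exec (x ::= EC v)); rewrite /env_safe /= !inE; move: nx; rewrite !inE; lia. Qed.

Section FillSpec.
Variables (Y K : nat -> nat) (S : nat).
Hypothesis K_gt0 : forall d, d < ne -> 0 < K d.

Definition fenv s := [/\ env s, ar s aY = Y, ar s aK = K & vr s xS = S].

Lemma fenv_exec c s : env_safe c -> aY \notin aarrs c -> aK \notin aarrs c ->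
  xS \notin avars c -> fenv s -> fenv (exec c s).
Proof. by move=> ? ? ? ? [? ? ? ?]; split; rewrite ?exec_vr ?exec_ar //; apply: env_exec. Qed.

Lemma FillArc_spec s : fenv s -> ar (exec FillArc s) aR =
  let d := vr s 14 in let c := vr s 19 in
  if [&& Y d == vr s 20, K d <= c & ar s aR ((c - K d) * n + T d) != 0]
  then upd (ar s aR) (vr s 28) (d + 1) else ar s aR.
Proof.
move=> [[[eN eNE eP] ePP eCM eT eH] eY eK eS].
rewrite /FillArc; unf; rewrite !evE; unf; rewrite eY eK.
case: ifP => [/andP[-> ->]|/negbT]; unf.
  by rewrite eT eN /=; case: ifP => // _; unf.
by rewrite negb_and => /orP[]/negbTE-> //; rewrite andbF.
Qed.

(** Arcs have positive cost, so the test for row [c] reads strictly lower rows and is blind to the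
    cell being filled. *)
Lemma pred_arc_eq R R' c v d : v < n -> (forall j, j != c * n + v -> R j = R' j) ->
  pred_arc n ne T Y K R c v d = pred_arc n ne T Y K R' c v d.
Proof.
move=> vn eqR; rewrite /pred_arc; case dl: (d < ne) => //=; case: (Y d == v) => //=.
case Kc: (K d <= c) => //=; rewrite eqR //; apply/eqP => E.
have [E1 _] := mulD_inj (TH dl).1 vn E.
by have := K_gt0 dl; lia.
Qed.

Lemma FillArcs_spec s : fenv s -> vr s 20 < n -> vr s 28 = vr s 19 * n + vr s 20 ->
  ar s aR (vr s 28) = (vr s 19 == 0) && (vr s 20 == S) ->
  let R' := ar (exec FillArcs s) aR in
  (forall j, j != vr s 28 -> R' j = ar s aR j) /\
  cell_ok n ne T Y K S R' (vr s 19) (vr s 20).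
Proof.
move=> fs vn idx R0; set c := vr s 19 in idx R0 *; set v := vr s 20 in vn idx R0 *.
have eNE : vr s iNE = ne by case: fs => [[[]]].
(* Any qualifying arc will do, so later ones may overwrite earlier ones; an entry 0 means that no
   arc below [i] qualifies. *)
pose I i t := (forall j, j != vr s 28 -> ar t aR j = ar s aR j) /\
  if c == 0 then ar t aR (vr s 28) = (v == S)
  else if ar t aR (vr s 28) is d.+1 then pred_arc n ne T Y K (ar t aR) c v d
  else forall d, d < i -> ~~ pred_arc n ne T Y K (ar t aR) c v d.
have [] : I (vr s iNE) (exec FillArcs s).
  apply: (@exec_for 14 iNE FillArc s I) => //.
    by split=> //; case: eqP R0 => //= _ ->.
  move=> i t; rewrite eNE => lti vt at_ [h1 h2].
  have ft : fenv t.
    by case: fs => [[[? ? ?] ? ? ? ?] ? ? ?]; split; rewrite ?vt ?at_ //; split; rewrite ?vt ?at_.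
  have fti : fenv (setv t 14 i) by case: ft => e ? ? ?; split=> //; apply: env_setv.
  rewrite /I FillArc_spec //; cbv zeta; unf; rewrite !vt // -/c -/v.
  case Eb: [&& _, _ & _]; [have /and3P[Yi Ki nz] := Eb|have np := Eb].
    have c0 : c != 0 by have := K_gt0 lti; lia.
    split=> [j jx|]; first by rewrite /upd (negbTE jx) h1.
    rewrite (negbTE c0) {1}/upd eqxx addn1.
    rewrite (@pred_arc_eq _ (ar t aR)) // -?idx; last by move=> j jx; rewrite /upd (negbTE jx).
    by rewrite /pred_arc lti Yi Ki.
  split=> //; move: h2; case: ifP => // c0; case: (ar t aR (vr s 28)) => // h2 d.
  rewrite ltnS leq_eqVlt => /orP[/eqP->|/h2 //].
  by rewrite /pred_arc lti /= np.
move=> h1 h2; split=> //; rewrite /cell_ok -idx.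
move: h2; case: ifP => [_ ->|c0]; first by case: (v == S).
case: (ar _ _ _) => // h2; rewrite eNE in h2.
by apply/forallP => d; apply: h2.
Qed.

Lemma FillCell_spec s : fenv s -> vr s 20 < n ->
  let R' := ar (exec FillCell s) aR in
  (forall j, j != vr s 19 * n + vr s 20 -> R' j = ar s aR j) /\
  cell_ok n ne T Y K S R' (vr s 19) (vr s 20).
Proof.
move=> fs vn.
pose s1 := exec (Mul 25 19 iN) s.
pose s2 := exec (28 ::= EAdd (EV 25) (EV 20)) s1.
pose s3 := exec (If (eAnd (eEq (EV 19) (EC 0)) (eEq (EV 20) (EV xS)))
       (Ast aR (EV 28) (EC 1)) (Ast aR (EV 28) (EC 0))) s2.
have -> : exec FillCell s = exec FillArcs s3 by [].
have fs3 : fenv s3 by rewrite /s3 /s2 /s1; do 3![apply: fenv_exec => //].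
have [[[eN _ _] _ _ _ _] _ _ eS] := fs.
have v19 : vr s3 19 = vr s 19 by rewrite /s3 /s2 /s1; unf.
have v20 : vr s3 20 = vr s 20 by rewrite /s3 /s2 /s1; unf.
have v28 : vr s3 28 = vr s 19 * n + vr s 20.
  by rewrite /s3 /s2 /s1; unf; rewrite eN.
have R3 : ar s3 aR = upd (ar s aR) (vr s 19 * n + vr s 20) ((vr s 19 == 0) && (vr s 20 == S)).
  rewrite /s3 /s2 /s1; unf; rewrite !evE; unf; rewrite eN eS.
  by case: ifP => _; unf; rewrite ?eN.
have [|||h1 h2] := FillArcs_spec fs3.
- by rewrite v20.
- by rewrite v28 v19 v20.
- by rewrite R3 v28 v19 v20 /upd eqxx.
move: h1 h2; rewrite v19 v20 v28 => h1 h2; split=> // j jx.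
by rewrite h1 // R3 /upd (negbTE jx).
Qed.

Lemma cell_ok_eq R R' c v C : v < n -> (forall c' v', c' < C -> v' < n -> R (c' * n + v') = R' (c' * n + v')) ->
  c < C -> cell_ok n ne T Y K S R c v -> cell_ok n ne T Y K S R' c v.
Proof.
move=> vn eqR cC; rewrite /cell_ok -eqR //.
have pa d : pred_arc n ne T Y K R c v d = pred_arc n ne T Y K R' c v d.
  rewrite /pred_arc; case dl: (d < ne) => //=; case: (Y d == v) => //=.
  by case Kc: (K d <= c) => //=; rewrite eqR //; [lia|case: (TH dl)].
case: (R _) => [|d]; case: ifP => // _; last by rewrite pa.
by move/forallP => h; apply/forallP => d; rewrite -pa.
Qed.

Lemma Fill_spec s : fenv s -> forall c v, c < n.+1 * (P * P) -> v < n ->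
  cell_ok n ne T Y K S (ar (exec Fill s) aR) c v.
Proof.
move=> fs; have eCM : vr s iCM = n.+1 * (P * P) by case: fs => [[]].
pose I i t := forall c v, c < i -> v < n -> cell_ok n ne T Y K S (ar t aR) c v.
suff : I (vr s iCM) (exec Fill s) by rewrite eCM.
apply: (@exec_for 19 iCM _ s I) => // i t _ vt at_ It.
have [[[eN _ _] _ _ _ _] _ _ eS] := fs.
have ft : fenv (setv t 19 i).
  case: fs => [[[? ? ?] ? ? ? ?] ? ? ?]; split; unf; rewrite ?vt ?at_ //; apply: env_setv => //.
  by split; rewrite ?vt ?at_.
pose J j t' := (forall c v, c < i -> v < n -> cell_ok n ne T Y K S (ar t' aR) c v) /\
  (forall v, v < j -> v < n -> cell_ok n ne T Y K S (ar t' aR) i v).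
have : J n (exec (For 20 iN FillCell) (setv t 19 i)).
  have <- : vr (setv t 19 i) iN = n by unf; rewrite vt.
  apply: (@exec_for 20 iN _ _ J) => //.
  move=> j t'; unf; rewrite vt // eN => jn vt' at' [J1 J2].
  have ft' : fenv (setv t' 20 j).
    case: ft => [[[? ? ?] ? ? ? ?] ? ? ?]; split; unf; rewrite ?vt' ?at' //; apply: env_setv => //.
    by split; rewrite ?vt' ?at'.
  have [|h1 h2] := FillCell_spec ft'; first by unf.
  have e19 : vr (setv t' 20 j) 19 = i by unf; rewrite vt'; unf.
  move: h1 h2; rewrite e19; unf => h1 h2; split.
    move=> c v ci vn; apply: (cell_ok_eq vn _ ci (J1 _ _ ci vn)) => c' v' ci' vn'.
    by rewrite h1 //; apply/eqP => /(mulD_inj vn' jn)[]; lia.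
  move=> v; rewrite ltnS leq_eqVlt => /orP[/eqP->|vj vn] //.
  have := J2 v vj vn; rewrite /cell_ok; rewrite h1; last by apply/eqP => /(mulD_inj vn jn)[_]; lia.
  have pa d : pred_arc n ne T Y K (ar t' aR) i v d =
      pred_arc n ne T Y K (ar (exec FillCell (setv t' 20 j)) aR) i v d.
    rewrite /pred_arc; case dl: (d < ne) => //=; case: (Y d == v) => //=.
    case Kc: (K d <= i) => //=; rewrite h1 //; apply/eqP => /(mulD_inj (TH dl).1 jn)[].
    by have := K_gt0 dl; lia.
  case: (ar t' aR _) => [|d]; case: ifP => // _; last by rewrite pa.
  by move/forallP => h; apply/forallP => d; rewrite -pa.
case=> J1 J2 c v; rewrite ltnS leq_eqVlt => /orP[/eqP->|ci] vn; first exact: J2.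
exact: J1.
Qed.

Lemma fenv_loop s t x c i : (forall y, y \notin x :: avars c -> vr t y = vr s y) ->
  (forall a, a \notin aarrs c -> ar t a = ar s a) ->
  all (fun y => y \notin x :: avars c) [:: iN; iNE; iP; iPP; iCM; xS] ->
  all (fun a => a \notin aarrs c) [:: aT; aH; aY; aK] ->
  fenv s -> fenv (setv t x i).
Proof.
move=> vt at_ /and5P[h1 h2 h3 h4 /and3P[h5 h6 _]] /and5P[h7 h8 h9 h10 _].
have vt' y : y \notin x :: avars c -> vr (setv t x i) y = vr s y.
  move=> ny; rewrite -vt //; move: ny; rewrite inE negb_or => /andP[/negbTE yx _].
  by rewrite /= /upd yx.
by move=> [[[? ? ?] ? ? ? ?] ? ? ?]; split; rewrite ?vt' ?at_ //; split; rewrite ?vt' ?at_.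
Qed.

Hypothesis K_ge : forall d, d < ne -> P * P <= K d.

Lemma Apply_spec s : fenv s ->
  (forall c v, c < n.+1 * (P * P) -> v < n -> cell_ok n ne T Y K S (ar s aR) c v) ->
  S < n -> vr s 27 < n.+1 * (P * P) -> ar s aR (vr s 27 * n + S) != 0 ->
  exists ds, [/\ walk T Y S ds S, all (fun d => d < ne) ds, wsum K ds = vr s 27,
    ar (exec Apply s) aME = updf T ds (ar s aME) &
    ar (exec Apply s) aIV = updiv T H ds (ar s aIV)].
Proof.
move=> fs tab Sn; set cc := vr s 27 => ccb nz.
pose s2 := setv (setv s 28 S) 29 cc.
have -> : exec Apply s = exec (For 30 iN ApplyStep) s2.
  by rewrite /s2; case: fs => _ _ _ <-.
pose I i t := exists ds, [/\ walk T Y (vr t 28) ds S, all (fun d => d < ne) ds,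
    wsum K ds + vr t 29 = cc, vr t 28 < n & ar s aR (vr t 29 * n + vr t 28) != 0] /\
  [/\ vr t 29 = 0 \/ size ds = i, ar t aME = updf T ds (ar s aME) &
    ar t aIV = updiv T H ds (ar s aIV)].
have eN : vr s2 iN = n by rewrite /s2; unf; case: fs => [[[]]].
have {}fs : fenv s2 by case: fs => *; split=> //; do 2!apply: env_setv.
have : I n (exec (For 30 iN ApplyStep) s2).
  rewrite -eN; apply: (@exec_for 30 iN _ _ I) => //.
    by exists [::]; rewrite /wsum big_nil /s2; unf; rewrite /= eqxx; split; split=> //; right.
  move=> i t; rewrite eN => lti vt at_ [ds [[wk lt sm xn nzt] [fin eME eIV]]].
  have ft : fenv (setv t 30 i) by apply: fenv_loop vt at_ _ _ fs.
  have Rt : ar t aR = ar s aR by rewrite at_.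
  move: ft => [[_ _ _ eT eH] eY eK eS].
  rewrite /ApplyStep; unf; case: ifPn => [nz0|/negPn/eqP z]; unf; last first.
    by exists ds; unf; split; split=> //; left.
  rewrite eT eH eK (vt iN) // Rt eN.
  have c29 : vr t 29 < n.+1 * (P * P) by lia.
  have := tab _ _ c29 xn; rewrite /cell_ok; case: (ar s aR _) nzt => [|d] // _.
  rewrite (negbTE nz0) => /and4P[dl /eqP Yd Kd nzd].
  rewrite subn1 /=; exists (d :: ds); unf; split; split=> //.
  - by rewrite /= eqxx Yd.
  - by rewrite /= dl.
  - by rewrite wsum_cons; lia.
  - by case: (TH dl).
  - by case: fin => [z|<-]; [rewrite z in nz0|right].
  - by rewrite /= -eME.
  - by rewrite /= -eIV.
case=> ds [[wk lt sm xn nzt] [fin eME eIV]].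
set t := exec _ _ in wk sm xn nzt fin eME eIV *.
(* Every arc costs at least [P * P]. If cost remained after [n] arcs, at least one more arc would be
   due, and the total would reach [n.+1 * (P * P)]. *)
have z : vr t 29 = 0.
  case: fin => // szn; have c29 : vr t 29 < n.+1 * (P * P) by lia.
  have [ds' [_ lt' sm']] := table_sound tab (fun d dl => (TH dl).1) K_gt0 c29 xn nzt.
  have size_le l : all (fun d => d < ne) l -> size l * (P * P) <= wsum K l.
    elim: l => [|d l IH] //= /andP[dl /IH]; have := K_ge dl.
    by rewrite wsum_cons mulSn; lia.
  have := size_le _ lt; have := size_le _ lt'; rewrite szn.
  case: (ds') sm' => [|d l] sm'; first by move: sm'; rewrite /wsum big_nil.
  by rewrite /= sm' !mulSn; move: ccb; rewrite mulSn; lia.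
have c0 : 0 < n.+1 * (P * P) by lia.
have xS : vr t 28 = S.
  move: nzt; rewrite z; have := tab _ _ c0 xn; rewrite /cell_ok.
  by case: (ar s aR _) => [|d] // /eqP.
by rewrite xS in wk; exists ds; split=> //; rewrite -sm z addn0.
Qed.

End FillSpec.
End Verification.

Lemma walk_eq (V D : eqType) (T Y Y' : D -> V) x ds z : {in ds, Y =1 Y'} ->
  walk T Y x ds z = walk T Y' x ds z.
Proof.
elim: ds x => [|d ds IH] x //= eqY.
rewrite eqY ?mem_head // IH // => e eds.
by apply: eqY; rewrite inE eds orbT.
Qed.

Lemma wsum_le (w : nat -> nat) b ds (p : pred nat) : (forall d, p d -> w d <= b) -> all p ds ->
  wsum w ds <= size ds * b.
Proof.
move=> wb; elim: ds => [|d ds IH] /=; first by rewrite /wsum big_nil.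
by case/andP => /wb ? /IH; rewrite wsum_cons mulSn; lia.
Qed.

Section Verification.
Variables (n ne P : nat) (T H : nat -> nat).
Hypothesis TH : forall d, d < ne -> T d < n /\ H d < n.
Hypothesis P_gt : n * n.+1 < P.
Let env := env n ne P T H.

(** * One round of the local search *)

Section ImproveSpec.
Variables (W f iv : nat -> nat) (cap : nat).
Hypothesis W_le : forall d, d < ne -> W d <= n.+1.
Hypothesis f_valid : valid n ne T H f iv.

Let q d := W (f (T d)).
Let om := nsum n W f.

Definition good x ds := [/\ walk T (iv \o H) x ds x, all (fun d => d < ne) ds,
  wsum q ds < wsum W ds & wsum W ds + om <= cap].

Definition stuck := forall x ds, ~ good x ds.

Definition improved f' iv' := exists x ds, [/\ good x ds,
  forall x' ds', good x' ds' -> size ds <= size ds', f' = updf T ds f & iv' = updiv T H ds iv].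

Lemma q_le d : d < ne -> q d <= n.+1.
Proof. by move=> dl; apply: W_le; case: (f_valid (TH dl).1). Qed.

Lemma good_node x ds : good x ds -> x < n.
Proof.
case; case: ds => [|d ds]; first by rewrite /wsum !big_nil.
by move=> /walk_head <- /= /andP[dl _] _ _; case: (TH dl).
Qed.

(** By [gaining_simple] a shortest gaining walk is simple, so substituting it gives an assignment
    and changes the weight by exactly its gain. *)
Lemma improvedP f' iv' : improved f' iv' ->
  [/\ valid n ne T H f' iv', om < nsum n W f', nsum n W f' <= cap & ~ stuck].
Proof.
case=> x [ds [gd mn -> ->]]; have [wk lt gain le] := gd.
have [y [ds' [wk' u gain' le' [sz sub]]]] := gaining_simple wk gain.
have gd' : good y ds'.
  split=> //; last by lia.
  by apply/allP => d /sub dds; move/allP: lt => /(_ _ dds).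
have uds : uniq (map T ds) by have := mn _ _ gd'; case: (uniq _) sz => //=; lia.
have [vf sm] := valid_update f_valid (fun d dl => (TH dl).1) wk lt uds.
have := sm W; rewrite -/om -/q => smW; split=> //; [lia|lia|].
by move=> st; apply: st gd.
Qed.

Section Env.
Variables (Y K : nat -> nat).
Hypothesis Yspec : forall d, d < ne -> Y d = iv (H d).
Hypothesis Kspec : forall d, d < ne -> K d = P * P + W d * P + q d.

Definition ienv t := [/\ env t, ar t aY = Y, ar t aK = K, vr t iOM = om & vr t iCAP = cap].

Lemma wsum_K ds : all (fun d => d < ne) ds ->
  wsum K ds = size ds * (P * P) + wsum W ds * P + wsum q ds.
Proof.
elim: ds => [|d ds IH] /=; first by rewrite /wsum !big_nil.
by case/andP=> dl /IH; rewrite !wsum_cons Kspec // mulSn mulnDl; lia.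
Qed.

Lemma P_gt0 : 0 < P. Proof. by lia. Qed.

Lemma K_ge d : d < ne -> P * P <= K d.
Proof. by move=> dl; rewrite Kspec //; lia. Qed.

Lemma K_gt0 d : d < ne -> 0 < K d.
Proof. by move=> dl; apply: leq_trans (K_ge dl); rewrite muln_gt0 P_gt0. Qed.

(** With at most [n] arcs of weight at most [n + 1], the two lower digits of a packed cost never
    carry. *)
Lemma weights_lt ds : all (fun d => d < ne) ds -> size ds <= n ->
  wsum W ds < P /\ wsum q ds < P.
Proof.
move=> lt sz; have h : size ds * n.+1 <= n * n.+1 by rewrite leq_mul2r sz orbT.
have := wsum_le W_le lt; have := wsum_le q_le lt; lia.
Qed.

Lemma walkY x ds z : all (fun d => d < ne) ds ->
  walk T Y x ds z = walk T (iv \o H) x ds z.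
Proof. by move=> /allP lt; apply: walk_eq => d /lt; apply: Yspec. Qed.

Section Node.
Variables (S L : nat).
Hypotheses (Sn : S < n) (Ln : L < n).

Definition found_here t := exists ds, [/\ good S ds, size ds = L.+1,
  ar t aME = updf T ds f & ar t aIV = updiv T H ds iv].

Definition hit (R : nat -> nat) b c :=
  [&& c < b, b + om <= cap & R ((L.+1 * (P * P) + b * P + c) * n + S) != 0].

Definition tenv t := [/\ ienv t, vr t xS = S & vr t xL = L].

Definition table t := forall c v, c < n.+1 * (P * P) -> v < n ->
  cell_ok n ne T Y K S (ar t aR) c v.

Lemma TryCell_spec t : tenv t -> table t -> vr t 21 < P -> vr t 22 < P ->
  vr t iFND = 0 -> ar t aME = f -> ar t aIV = iv ->
  let t' := exec TryCell t in
  if hit (ar t aR) (vr t 21) (vr t 22) then vr t' iFND = 1 /\ found_here t'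
  else [/\ vr t' iFND = 0, ar t' aME = f & ar t' aIV = iv].
Proof.
move=> [[e eY eK eOM eCAP] eS eL] tab bP cP fnd eME eIV.
have [[eN eNE eP] ePP eCM eT eH] := e.
rewrite /TryCell /hit; cbv zeta; unf; rewrite !evE; unf; rewrite fnd eqxx eOM eCAP.
case cb: (vr t 22 < vr t 21) => //=; case bo: (_ <= cap) => //=.
set t1 := exec (Mul 25 27 iN) _.
have v27 : vr t1 27 = L.+1 * (P * P) + vr t 21 * P + vr t 22.
  by rewrite /t1; unf; rewrite eL ePP eP addn1 addnA.
have R1 : ar t1 aR = ar t aR by rewrite /t1; unf.
rewrite eL ePP eP eN eS addn1 addnA; set cnd := _ != 0; case nz: cnd; last by split; rewrite /t1; unf.
rewrite /cnd in nz => {cnd}.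
split; first by unf.
have fe : fenv n ne P T H Y K S (setv t1 iFND 1).
  apply: (@fenv_exec n ne P T H Y K S (iFND ::= EC 1)) => //; rewrite /t1.
  by do 5![apply: fenv_exec => //].
have ccb : vr (setv t1 iFND 1) 27 < n.+1 * (P * P).
  unf; rewrite v27; have h1 : L.+1 * (P * P) <= n * (P * P) by rewrite leq_mul2r Ln orbT.
  have h2 : (vr t 21).+1 * P <= P * P by rewrite leq_mul2r bP orbT.
  by move: h2; rewrite !mulSn; lia.
have [||ds [wk lt sm eME' eIV']] := Apply_spec TH P_gt K_gt0 K_ge fe _ Sn ccb.
- by unf; rewrite R1.
- by unf; rewrite R1 v27.
rewrite wsum_K // in sm.
have sz : size ds <= n.
  have P2 : 0 < P * P by rewrite muln_gt0 P_gt0.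
  by rewrite -ltnS -(ltn_pmul2r P2) (leq_ltn_trans _ ccb) // -sm -addnA leq_addr.
have [pP qP] := weights_lt lt sz.
(* The walk read off the table is only known by its cost; uniqueness of the digits gives it the
   length and weights that were tried. *)
move: sm; unf; rewrite v27 => /(decode pP qP bP cP)[szE pE qE].
rewrite /found_here; exists ds; split=> //.
- by split; rewrite -?walkY ?pE ?qE.
- by rewrite eME'; unf; rewrite /t1; unf; rewrite eME.
- by rewrite eIV'; unf; rewrite /t1; unf; rewrite eIV.
Qed.
Lemma tenv_loop s t x c i : (forall y, y \notin x :: avars c -> vr t y = vr s y) ->
  (forall a, a \notin aarrs c -> ar t a = ar s a) ->
  all (fun y => y \notin x :: avars c) [:: iN; iNE; iP; iPP; iCM; iOM; iCAP; xS; xL] ->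
  all (fun a => a \notin aarrs c) [:: aT; aH; aY; aK] ->
  tenv s -> tenv (setv t x i).
Proof.
move=> vt at_ /and5P[h1 h2 h3 h4 /and5P[h5 h6 h7 h8 /andP[h9 _]]] /and5P[k1 k2 k3 k4 _].
have vt' y : y \notin x :: avars c -> vr (setv t x i) y = vr s y.
  move=> ny; rewrite -vt //; move: ny; rewrite inE negb_or => /andP[/negbTE yx _].
  by rewrite /= /upd yx.
move=> [[[[? ? ?] ? ? ? ?] ? ? ? ?] ? ?]; split; rewrite ?vt' ?at_ //; split; rewrite ?vt' ?at_ //.
by split; rewrite ?vt' ?at_ //; split; rewrite ?vt' ?at_.
Qed.

Lemma tenv_exec c s : env_safe c -> all (fun y => y \notin avars c) [:: iOM; iCAP; xS; xL] ->
  all (fun a => a \notin aarrs c) [:: aY; aK] -> tenv s -> tenv (exec c s).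
Proof.
move=> es /and5P[? ? ? ? _] /and3P[? ? _] [[e ? ? ? ?] ? ?].
by split; [split|..]; rewrite ?exec_vr ?exec_ar //; apply: env_exec.
Qed.

Definition tried b t :=
  [/\ vr t iFND = 0, ar t aME = f, ar t aIV = iv & b] \/ vr t iFND = 1 /\ found_here t.

Lemma TryCell_skip t : vr t iFND = 1 -> exec TryCell t = t.
Proof. by move=> fnd; rewrite /TryCell; unf; rewrite !evE; unf; rewrite fnd. Qed.

Lemma TryNode_spec t : tenv t -> vr t iFND = 0 -> ar t aME = f -> ar t aIV = iv ->
  tried (forall ds, good S ds -> size ds <> L.+1) (exec TryNode t).
Proof.
move=> te fnd eME eIV; pose t1 := exec Fill t.
have -> : exec TryNode t = exec (For 21 iP (For 22 iP TryCell)) t1.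
  by rewrite /TryNode; unf; rewrite ev_not; unf; rewrite fnd.
have fe : fenv n ne P T H Y K S t by case: te => [[]].
have te1 : tenv t1 by apply: tenv_exec te.
have tab1 : table t1 by move=> c v; apply: (Fill_spec TH P_gt K_gt0 fe).
have eP : vr t1 iP = P by case: te1 => [[[[]]]].
pose J b t' := tried (forall b' c, b' < b -> c < P -> ~~ hit (ar t1 aR) b' c) t'.
have : J P (exec (For 21 iP (For 22 iP TryCell)) t1).
  rewrite -{1}eP; apply: (@exec_for 21 iP _ _ J) => //.
    by left; split=> //; rewrite /t1; unf.
  move=> b t2; rewrite eP => bP vt at_ J2.
  have te2 : tenv (setv t2 21 b) by apply: tenv_loop vt at_ _ _ te1.
  pose J' c t' := tried ((forall b' c, b' < b -> c < P -> ~~ hit (ar t1 aR) b' c) /\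
    forall c', c' < c -> ~~ hit (ar t1 aR) b c') t'.
  have eP2 : vr (setv t2 21 b) iP = P by case: te2 => [[[[]]]].
  have : J' P (exec (For 22 iP TryCell) (setv t2 21 b)).
    rewrite -{1}eP2; apply: (@exec_for 22 iP _ _ J') => //.
      by case: J2 => [[? ? ? ?]|?]; [left|right].
    move=> c t3; rewrite eP2 => cP vt' at' [[fnd3 eME3 eIV3 [h1 h2]]|[fnd3 fh]]; last first.
      by right; rewrite TryCell_skip.
    have te3 : tenv (setv t3 22 c) by apply: tenv_loop vt' at' _ _ te2.
    have R3 : ar t3 aR = ar t1 aR by rewrite at' // -at_.
    have e21 : vr (setv t3 22 c) 21 = b by unf; rewrite vt'; unf.
    have R4 : ar (setv t3 22 c) aR = ar t1 aR := R3.
    have tab4 : table (setv t3 22 c) by rewrite /table R4.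
    have e22 : vr (setv t3 22 c) 22 = c by [].
    have := TryCell_spec te3 tab4; rewrite e21 e22 R4.
    move=> /(_ bP cP fnd3 eME3 eIV3); cbv zeta.
    case: ifPn => [_ [? ?]|nh [? ? ?]]; first by right.
    left; split=> //; split=> // c'; rewrite ltnS leq_eqVlt => /orP[/eqP->//|]; exact: h2.
  case=> [[? ? ? [h1 h2]]|?]; last by right.
  left; split=> // b' c; rewrite ltnS leq_eqVlt => /orP[/eqP->|]; [exact: h2|exact: h1].
case=> [[? ? ? nh]|?]; [left; split=> // ds gd sz|by right].
have [wk lt gain le] := gd.
have [pP qP] : wsum W ds < P /\ wsum q ds < P by apply: weights_lt; rewrite ?sz.
case/negP: (nh _ _ pP qP); rewrite /hit gain le /=.
rewrite -sz -wsum_K //; apply: (table_complete tab1) => //.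
- by move=> d /TH[].
- exact: K_gt0.
- by rewrite walkY.
rewrite wsum_K // sz; have h1 : L.+1 * (P * P) <= n * (P * P) by rewrite leq_mul2r Ln orbT.
have h2 : (wsum W ds).+1 * P <= P * P by rewrite leq_mul2r pP orbT.
by move: h2; rewrite !mulSn; move: h1; rewrite mulSn; lia.
Qed.

End Node.
Lemma ienv_loop s t x c i : (forall y, y \notin x :: avars c -> vr t y = vr s y) ->
  (forall a, a \notin aarrs c -> ar t a = ar s a) ->
  all (fun y => y \notin x :: avars c) [:: iN; iNE; iP; iPP; iCM; iOM; iCAP] ->
  all (fun a => a \notin aarrs c) [:: aT; aH; aY; aK] ->
  ienv s -> ienv (setv t x i).
Proof.
move=> vt at_ /and5P[h1 h2 h3 h4 /and4P[h5 h6 h7 _]] /and5P[k1 k2 k3 k4 _].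
have vt' y : y \notin x :: avars c -> vr (setv t x i) y = vr s y.
  move=> ny; rewrite -vt //; move: ny; rewrite inE negb_or => /andP[/negbTE yx _].
  by rewrite /= /upd yx.
move=> [[[? ? ?] ? ? ? ?] ? ? ? ?]; split; rewrite ?vt' ?at_ //; split; rewrite ?vt' ?at_ //.
Qed.

Definition scanned b t :=
  [/\ vr t iFND = 0, ar t aME = f, ar t aIV = iv & b] \/
  vr t iFND = 1 /\ improved (ar t aME) (ar t aIV).

Lemma TryNode_skip t : vr t iFND = 1 -> exec TryNode t = t.
Proof. by move=> fnd; rewrite /TryNode; unf; rewrite !evE; unf; rewrite fnd. Qed.

(** Lengths up to [n] suffice, since a gaining closed walk contains a simple one; trying every start
    for one length before the next makes the first hit a shortest one. *)
Lemma Scan_spec s : ienv s -> vr s iFND = 0 -> ar s aME = f -> ar s aIV = iv ->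
  scanned stuck (exec (For xL iN (For xS iN TryNode)) s).
Proof.
move=> se fnd eME eIV; have eN : vr s iN = n by case: se => [[[]]].
pose I l t := scanned (forall l' x ds, l' < l -> good x ds -> size ds <> l'.+1) t.
have : I n (exec (For xL iN (For xS iN TryNode)) s).
  rewrite -{1}eN; apply: (@exec_for xL iN _ _ I) => //; first by left.
  move=> l t; rewrite eN => ln vt at_ It.
  have te : ienv (setv t xL l) by apply: ienv_loop vt at_ _ _ se.
  pose J i t' := scanned ((forall l' x ds, l' < l -> good x ds -> size ds <> l'.+1) /\
    forall x ds, x < i -> good x ds -> size ds <> l.+1) t'.
  have eN2 : vr (setv t xL l) iN = n by case: te => [[[]]].
  have : J n (exec (For xS iN TryNode) (setv t xL l)).
    rewrite -{1}eN2; apply: (@exec_for xS iN _ _ J) => //.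
      by case: It => [[? ? ? ?]|?]; [left|right].
    move=> i t2; rewrite eN2 => lti vt' at' [[fnd2 eME2 eIV2 [h1 h2]]|[fnd2 imp]]; last first.
      by right; rewrite TryNode_skip.
    have te2 : tenv i l (setv t2 xS i).
      by split=> //; [apply: ienv_loop vt' at' _ _ te|unf; rewrite vt'; unf].
    case: (TryNode_spec lti ln te2 fnd2 eME2 eIV2) => [[? ? ? h3]|[? [ds [gd sz ? ?]]]].
      left; split=> //; split=> // x ds; rewrite ltnS leq_eqVlt => /orP[/eqP->|]; [exact: h3|exact: h2].
    right; split=> //; exists i, ds; split=> // x' ds' gd'; rewrite leqNgt; apply/negP => lt.
    case: ds' gd' lt => [|d ds'] gd' /=; first by case: gd'; rewrite /wsum !big_nil.
    by rewrite sz ltnS => lt; apply: (h1 _ _ _ lt gd').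
  case=> [[? ? ? [h1 h2]]|?]; last by right.
  left; split=> // l' x ds; rewrite ltnS leq_eqVlt => /orP[/eqP-> gd|l'l gd].
    exact: (h2 _ _ (good_node gd) gd).
  exact: (h1 _ _ _ l'l gd).
case=> [[? ? ? none]|?]; [left; split=> // x ds gd|by right].
have [wk lt gain le] := gd.
have [y [ds' [wk' u' gain' le' [sz sub]]]] := gaining_simple wk gain.
have lt' : all (fun d => d < ne) ds'.
  by apply/allP => d /sub dds; move/allP: lt => /(_ _ dds).
have gd' : good y ds' by split=> //; lia.
have szn : size ds' <= n.
  rewrite -(size_map T) -(size_iota 0 n); apply: uniq_leq_size => // _ /mapP[d dds ->].
  by rewrite mem_iota; move/allP: lt' => /(_ _ dds) /TH[].
case E: ds' gd' szn => [|d l] gd' szn; first by case: gd'; rewrite /wsum !big_nil.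
by apply: (none (size l) _ _ _ gd').
Qed.

End Env.
Lemma Prepare_spec s : env s -> ar s aW = W -> ar s aME = f -> ar s aIV = iv ->
  vr (exec Prepare s) iOM = om /\ forall d, d < ne ->
    ar (exec Prepare s) aK d = P * P + W d * P + q d /\ ar (exec Prepare s) aY d = iv (H d).
Proof.
move=> [[eN eNE eP] ePP eCM eT eH] eW ef eiv.
pose c1 := For 15 iN (iOM ::= EAdd (EV iOM) (EA aW (EA aME (EV 15)))).
pose c2 := block [:: 36 ::= EA aW (EV 14); Mul 25 36 iP;
      Ast aK (EV 14) (EAdd (EV iPP) (EAdd (EV 25) (EA aW (EA aME (EA aT (EV 14))))));
      Ast aY (EV 14) (EA aIV (EA aH (EV 14)))].
pose s1 := exec c1 (setv s iOM 0).
have -> : exec Prepare s = exec (For 14 iNE c2) s1 by [].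
have om1 : vr s1 iOM = om.
  pose I i t := vr t iOM = \sum_(x < i) W (f x).
  have : I n s1; last by [].
  have eN' : vr (setv s iOM 0) iN = n by unf.
  rewrite -eN'; apply: (@exec_for 15 iN _ _ I) => //; first by rewrite /I big_ord0.
  move=> i t lti vt at_; rewrite /I => It; unf.
  by rewrite It !at_ //; unf; rewrite eW ef big_ord_recr.
split; first by unf.
pose I i t := forall d, d < i -> ar t aK d = P * P + W d * P + q d /\ ar t aY d = iv (H d).
have : I ne (exec (For 14 iNE c2) s1); last by [].
have <- : vr s1 iNE = ne by rewrite /s1; unf.
apply: (@exec_for 14 iNE _ _ I) => // i t lti vt at_ It d; rewrite /c2; unf.
rewrite (vt iP) // (vt iPP) // (at_ aW) // (at_ aME) // (at_ aT) // (at_ aIV) // (at_ aH) //.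
rewrite /s1; unf; rewrite eP ePP eW eT eH ef eiv ltnS leq_eqVlt /upd.
by case: eqP => [-> _|_ /= /It //]; rewrite /q addnA.
Qed.

Lemma Improve_spec s : env s -> ar s aW = W -> ar s aME = f -> ar s aIV = iv -> vr s iCAP = cap ->
  [/\ ar (exec Improve s) aME = f, ar (exec Improve s) aIV = iv & stuck] \/
  improved (ar (exec Improve s) aME) (ar (exec Improve s) aIV).
Proof.
move=> se eW ef eiv ecap; have [om1 KY] := Prepare_spec se eW ef eiv.
pose s2 := setv (exec Prepare s) iFND 0.
have -> : exec Improve s = exec (For xL iN (For xS iN TryNode)) s2 by [].
have Ksp d : d < ne -> ar s2 aK d = P * P + W d * P + q d by move=> /KY[].
have Ysp d : d < ne -> ar s2 aY d = iv (H d) by move=> /KY[].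
have e2 : ienv (ar s2 aY) (ar s2 aK) s2.
  split=> //; rewrite /s2; unf => //; apply: env_setv => //.
  by apply: env_exec.
have [||[? ? ? ?]|[]] := Scan_spec Ysp Ksp e2 (erefl _); rewrite /s2; unf => //.
  by left. by right.
Qed.

End ImproveSpec.
Lemma Search_spec W cap s : env s -> ar s aW = W -> (forall d, d < ne -> W d <= n.+1) ->
  valid n ne T H (ar s aME) (ar s aIV) -> vr s iCAP = cap -> nsum n W (ar s aME) <= cap ->
  let f := ar (exec Search s) aME in let iv := ar (exec Search s) aIV in
  [/\ valid n ne T H f iv, nsum n W (ar s aME) <= nsum n W f, nsum n W f <= cap &
    stuck W f iv cap].
Proof.
move=> se eW Wle vl ecap omc; cbv zeta.
have eP : vr s iP = P by case: se => [[]].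
pose I i t := [/\ valid n ne T H (ar t aME) (ar t aIV),
  nsum n W (ar s aME) <= nsum n W (ar t aME), nsum n W (ar t aME) <= cap &
  i <= nsum n W (ar t aME) \/ stuck W (ar t aME) (ar t aIV) cap].
have : I P (exec Search s).
  rewrite -{1}eP; apply: (@exec_for 16 iP _ _ I) => //; first by split=> //; left.
  move=> i t _ vt at_ [vt1 le1 le2 dich].
  have te : env (setv t 16 i).
    case: se => [[? ? ?] ? ? ? ?]; apply: env_setv => //.
    by split; rewrite ?vt ?at_ //; split; rewrite ?vt.
  have tW : ar (setv t 16 i) aW = W by unf; rewrite at_.
  have tc : vr (setv t 16 i) iCAP = cap by unf; rewrite vt.
  case: (Improve_spec Wle vt1 te tW (erefl _) (erefl _) tc) => [[eME eIV st]|imp].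
    by rewrite /I eME eIV; split=> //; right.
  have [v' lt' le' nst] := improvedP vt1 imp.
  by split=> //; [lia|left; case: dich => // ?; lia].
case=> vP le1 le2 [|//]; suff : nsum n W (ar (exec Search s) aME) <= n * n.+1 by lia.
rewrite /nsum -[n in n * _]card_ord -sum_nat_const.
by apply: leq_sum => i _; apply: Wle; case: (vP i (ltn_ord i)).
Qed.

End Verification.

(** * Optimality of stuck assignments *)

(** The head map is an injection of a finite set into itself, hence onto, so [iv] is a two-sided
    inverse. *)
Lemma valid_surj n ne T H f iv : (forall d, d < ne -> T d < n /\ H d < n) ->
  valid n ne T H f iv -> forall y, y < n -> iv y < n /\ H (f (iv y)) = y.
Proof.
move=> TH vf y yn; case: n => [|n] // in TH vf yn *.
pose h (x : 'I_n.+1) : 'I_n.+1 := inord (H (f x)).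
have hE x : nat_of_ord (h x) = H (f x).
  by rewrite /h /= inordK //; have [/TH[]] := vf x (ltn_ord x).
have h_inj : injective h.
  move=> x x' /(congr1 (@nat_of_ord _)); rewrite !hE => /(congr1 iv).
  have [_ _ ->] := vf x (ltn_ord x); have [_ _ ->] := vf x' (ltn_ord x').
  exact: ord_inj.
have [g _ gK] := injF_bij h_inj.
have : nat_of_ord (h (g (Ordinal yn))) = y by rewrite gK.
by rewrite hE => <-; have [_ _ ->] := vf _ (ltn_ord (g (Ordinal yn))).
Qed.

(** * From arrays indexed by numbers to finite types *)

Section Transfer.
Variables (n ne : nat) (T H : nat -> nat).
Let N := n.+1.
Let NE := ne.+1.
Hypothesis TH : forall d, d < NE -> T d < N /\ H d < N.

Let T' (d : 'I_NE) : 'I_N := inord (T d).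
Let H' (d : 'I_NE) : 'I_N := inord (H d).
Let lift (f : nat -> nat) (x : 'I_N) : 'I_NE := inord (f x).

Let T'E d : T' d = T d :> nat.
Proof. by rewrite /T' inordK //; have [] := TH (ltn_ord d). Qed.
Let H'E d : H' d = H d :> nat.
Proof. by rewrite /H' inordK //; have [] := TH (ltn_ord d). Qed.

Section Valid.
Variables (f iv : nat -> nat).
Hypothesis vf : valid N NE T H f iv.
Let Y' (d : 'I_NE) : 'I_N := inord (iv (H d)).

Let liftE x : lift f x = f x :> nat.
Proof. by rewrite /lift inordK //; have [] := vf (ltn_ord x). Qed.

Lemma lift_assignment : assignment T' H' (lift f).
Proof.
split=> [x|x y /(congr1 (@nat_of_ord _))] /=.
  by apply: ord_inj; rewrite T'E liftE; have [_ ->] := vf (ltn_ord x).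
rewrite !H'E !liftE => /(congr1 iv).
have [_ _ ->] := vf (ltn_ord x); have [_ _ ->] := vf (ltn_ord y).
exact: ord_inj.
Qed.

Lemma lift_sum w : \sum_x w (nat_of_ord (lift f x)) = nsum N w f.
Proof. by apply: eq_bigr => x _; rewrite liftE. Qed.

Let Y'E d : Y' d = iv (H d) :> nat.
Proof.
rewrite /Y' inordK //; have [_ Hd] := TH (ltn_ord d).
by have [] := valid_surj TH vf Hd.
Qed.

Lemma lift_target d : H' (lift f (Y' d)) = H' d.
Proof.
apply: ord_inj; rewrite !H'E liftE Y'E; have [_ Hd] := TH (ltn_ord d).
by have [] := valid_surj TH vf Hd.
Qed.

Lemma unlift_walk x ds z : walk T' Y' x ds z ->
  walk T (iv \o H) (nat_of_ord x) (map (@nat_of_ord _) ds) (nat_of_ord z).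
Proof.
elim: ds x => [|d ds IH] x /=; first by move/eqP->.
by case/andP=> /eqP<- /IH; rewrite T'E eqxx Y'E.
Qed.

Lemma unlift_wsum w (ds : seq 'I_NE) : wsum (w \o @nat_of_ord _) ds = wsum w (map (@nat_of_ord _) ds).
Proof. by rewrite /wsum big_map. Qed.

Lemma unlift_wsum_tail w (ds : seq 'I_NE) :
  wsum (fun d => w (nat_of_ord (lift f (T' d)))) ds = wsum (fun d => w (f (T d))) (map (@nat_of_ord _) ds).
Proof. by rewrite /wsum big_map; apply: eq_bigr => d _; rewrite liftE T'E. Qed.

Lemma unlift_lt (ds : seq 'I_NE) : all (fun d => d < NE) (map (@nat_of_ord _) ds).
Proof. by apply/allP => _ /mapP[d _ ->]. Qed.

(** A simple walk has at most [N] arcs of weight at most [N.+1]; the cap leaves room for all of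
    them, so being stuck means being optimal. *)
Lemma unlift_optimal W cap g giv : (forall d, d < NE -> W d <= N.+1) ->
  N * N.+1 + nsum N W f <= cap -> stuck N NE T H W f iv cap ->
  valid N NE T H g giv -> nsum N W g <= nsum N W f.
Proof.
move=> Wle capb st vg.
have gE x : nat_of_ord (lift g x) = g x by rewrite /lift /= inordK //; have [] := vg _ (ltn_ord x).
rewrite -lift_sum; have -> : nsum N W g = \sum_(x < N) W (lift g x).
  by apply: eq_bigr => x _; rewrite gE.
apply: (@stuck_optimal _ _ T' H' (lift f) Y' lift_target (W \o @nat_of_ord _) (lift g)).
  split=> [x|x y /(congr1 (@nat_of_ord _))] /=.
    by apply: ord_inj; rewrite T'E gE; have [_ ->] := vg _ (ltn_ord x).
  rewrite !H'E !gE => /(congr1 giv).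
  have [_ _ ->] := vg _ (ltn_ord x); have [_ _ ->] := vg _ (ltn_ord y).
  exact: ord_inj.
move=> x ds wk u; rewrite unlift_wsum unlift_wsum_tail leqNgt; apply/negP => gain.
apply: (st (nat_of_ord x) (map (@nat_of_ord _) ds)); split=> //; [exact: unlift_walk|exact: unlift_lt|].
apply: leq_trans capb; rewrite leq_add2r.
apply: leq_trans (wsum_le Wle (unlift_lt ds)) _; rewrite leq_mul2r size_map; apply/orP; right.
by rewrite -(size_map T') -(card_uniqP u) -[leqRHS]card_ord max_card.
Qed.
End Valid.

Lemma unlift_approx w f iv cap g giv K : valid N NE T H f iv -> stuck N NE T H w f iv cap ->
  valid N NE T H g giv -> nsum N w g = K -> K <= cap -> 3 * nsum N w f < K ->
  (forall x1 x2, x1 < N -> x2 < N -> exists h hiv, [/\ valid N NE T H h hiv,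
     h x1 = g x1, h x2 = g x2 & 3 * nsum N w h < K]) -> False.
Proof.
move=> vf st vg gK Kcap small pairs.
apply: (@no_stuck_approx _ _ T' H' (w \o @nat_of_ord _) (lift f) (lift g)
  (fun d => inord (iv (H d))) K (lift_assignment vg) (lift_target vf)).
- move=> x ds wk; rewrite /= (lift_sum vf) => le; rewrite leqNgt; apply/negP => gain.
  apply: (st (nat_of_ord x) (map (@nat_of_ord _) ds)); split; [exact: (unlift_walk vf wk)|exact: unlift_lt| |].
    by rewrite -(unlift_wsum_tail vf w ds) -unlift_wsum.
  by rewrite -unlift_wsum (leq_trans le).
- by rewrite (lift_sum vg).
- by rewrite (lift_sum vf).
move=> x1 x2; have [h [hiv [vh h1 h2 hs]]] := pairs _ _ (ltn_ord x1) (ltn_ord x2).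
exists (lift h); split; [exact: lift_assignment vh| | |].
- by rewrite /lift h1.
- by rewrite /lift h2.
by rewrite (lift_sum vh).
Qed.

End Transfer.

(** [inord] needs inhabited types, so the cases of no vertex and of no arc are split off first. *)
Lemma stuck_optimum n ne T H W f iv cap g giv :
  (forall d, d < ne -> T d < n /\ H d < n) -> (forall d, d < ne -> W d <= n.+1) ->
  valid n ne T H f iv -> n * n.+1 + nsum n W f <= cap -> stuck n ne T H W f iv cap ->
  valid n ne T H g giv -> nsum n W g <= nsum n W f.
Proof.
case: n => [|n]; first by rewrite /nsum !big_ord0.
case: ne => [|ne] TH Wle vf; first by have [] := vf 0 isT.
by move=> capb st; apply: (unlift_optimal TH vf Wle capb st).
Qed.

Lemma stuck_approx n ne T H w f iv cap g giv K :
  (forall d, d < ne -> T d < n /\ H d < n) ->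
  valid n ne T H f iv -> stuck n ne T H w f iv cap ->
  valid n ne T H g giv -> nsum n w g = K -> K <= cap ->
  (forall x1 x2, x1 < n -> x2 < n -> exists h hiv, [/\ valid n ne T H h hiv,
     h x1 = g x1, h x2 = g x2 & 3 * nsum n w h < K]) -> K <= 3 * nsum n w f.
Proof.
case: n => [|n]; first by move=> _ _ _ _ <-; rewrite /nsum big_ord0.
case: ne => [|ne] TH vf; first by have [] := vf 0 isT.
move=> st vg gK Kcap pairs; rewrite leqNgt; apply/negP => small.
exact: (unlift_approx TH vf st vg gK Kcap small pairs).
Qed.

(** * Correctness of the two phases *)

Arguments setv : simpl never.
Arguments seta : simpl never.

Lemma sum_ord_le n b (F : nat -> nat) : (forall x, x < n -> F x <= b) ->
  \sum_(x < n) F x <= n * b.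
Proof.
move=> h; have : \sum_(x < n) F x <= \sum_(x < n) b by apply: leq_sum => x _; apply: h.
by rewrite sum_nat_const card_ord.
Qed.

Lemma sum_ord_const n b (F : nat -> nat) : (forall x, x < n -> F x = b) ->
  \sum_(x < n) F x = n * b.
Proof.
move=> h; rewrite -[n in RHS]card_ord -sum_nat_const.
by apply: eq_bigr => x _; apply: h.
Qed.

Section Verification.
Variables (n m m2 ne P kk : nat) (T H RD CL : nat -> nat).
Hypothesis TH : forall d, d < ne -> T d < n /\ H d < n.
Hypothesis P_gt : n * n.+1 < P.
Hypothesis neE : ne = m2 + n.
Hypothesis m2E : m2 = m + m.
Hypothesis loopE : forall x, x < n -> T (m2 + x) = x /\ H (m2 + x) = x.
Hypothesis RD_le : forall d, d < m2 -> RD d <= 1.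
Hypothesis kk_le : kk <= n.

Definition menv s := [/\ env n ne P T H s, vr s iM = m, vr s iM2 = m2, vr s iKK = kk &
  ar s aRD = RD /\ ar s aCL = CL].

Definition menv_safe c := [&& env_safe c, all (fun y => y \notin avars c) [:: iM; iM2; iKK] &
  all (fun a => a \notin aarrs c) [:: aRD; aCL]].

Lemma menv_exec c s : menv_safe c -> menv s -> menv (exec c s).
Proof.
case/and3P=> es /and4P[? ? ? _] /and3P[? ? _] [e ? ? ? [? ?]].
by split; rewrite ?exec_vr ?exec_ar //; apply: env_exec.
Qed.

Lemma menv_loop s t x c i : (forall y, y \notin x :: avars c -> vr t y = vr s y) ->
  (forall a, a \notin aarrs c -> ar t a = ar s a) ->
  all (fun y => y \notin x :: avars c) [:: iN; iNE; iP; iPP; iCM; iM; iM2; iKK] ->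
  all (fun a => a \notin aarrs c) [:: aT; aH; aRD; aCL] ->
  menv s -> menv (setv t x i).
Proof.
move=> vt at_ /and5P[h1 h2 h3 h4 /and5P[h5 h6 h7 h8 _]] /and5P[k1 k2 k3 k4 _].
have vt' y : y \notin x :: avars c -> vr (setv t x i) y = vr s y.
  move=> ny; rewrite -vt //; move: ny; rewrite inE negb_or => /andP[/negbTE yx _].
  by rewrite /setv /= /upd yx.
move=> [[[? ? ?] ? ? ? ?] ? ? ? [? ?]]; split; rewrite ?vt' ?at_ //; split; rewrite ?vt' ?at_ //.
Qed.

Definition matching g := (exists giv, valid n ne T H g giv) /\ forall x, x < n -> g x < m2.

Lemma nsum_RD_le g : matching g -> nsum n RD g <= n.
Proof.
move=> [_ lt]; rewrite -[leqRHS]muln1.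
by apply: (@sum_ord_le n 1 (RD \o g)) => x xn; apply/RD_le/lt.
Qed.

(** Exactly the rivals of [d0], the other arcs leaving its tail, are excluded; an assignment by
    allowed arcs therefore uses [d0]. *)
Definition allowed d0 d := (d == d0) || (T d != T d0).

Lemma SetWeights_spec s : menv s -> forall d, d < ne -> ar (exec SetWeights s) aW d =
  if [&& d < m2, allowed (vr s 12) d & allowed (vr s 13) d] then n.+1 - RD d else 0.
Proof.
move=> me; have [[[eN eNE _] _ _ eT eH] _ eM2 _ [eRD _]] := me.
pose I i t := forall d, d < i -> ar t aW d =
  if [&& d < m2, allowed (vr s 12) d & allowed (vr s 13) d] then n.+1 - RD d else 0.
suff : I (vr s iNE) (exec SetWeights s) by rewrite eNE.
apply: (@exec_for 14 iNE _ _ I) => // i t lti vt at_ It d; rewrite ltnS leq_eqVlt => di.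
unf; rewrite !evE; unf.
rewrite !(vt iM2) // !(vt 12) // !(vt 13) // !(at_ aT) // eT eM2.
rewrite -!/(allowed _ _); case: ifP => c; unf; rewrite /upd.
  case: eqP => [->|ne']; last by apply: It; move: di; case: eqP.
  by rewrite c at_ // eRD vt // eN addn1.
case: eqP => [->|ne']; last by apply: It; move: di; case: eqP.
by rewrite c.
Qed.

Lemma SetLoops_spec s : menv s ->
  valid n ne T H (ar (exec SetLoops s) aME) (ar (exec SetLoops s) aIV) /\
  forall x, x < n -> ar (exec SetLoops s) aME x = m2 + x.
Proof.
move=> me; have [[[eN eNE _] _ _ eT eH] _ eM2 _ [eRD _]] := me.
pose I i t := forall x, x < i -> ar t aME x = m2 + x /\ ar t aIV x = x.
have : I (vr s iN) (exec SetLoops s).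
  apply: (@exec_for 15 iN _ _ I) => // i t lti vt at_ It x; rewrite ltnS leq_eqVlt => di.
  unf; rewrite (vt iM2) // eM2 /upd; case: eqP => [->|ne'] //.
  by apply: It; move: di; case: eqP.
rewrite eN => h; split=> x xn; have [h1 h2] := h _ xn => //.
have [l1 l2] := loopE xn; rewrite h1 l1 l2 h2 neE; split=> //.
by rewrite ltn_add2l.
Qed.

Lemma Evaluate_spec s : menv s ->
  vr (exec Evaluate s) 32 = [forall x : 'I_n, ar s aW (ar s aME x) != 0] /\
  vr (exec Evaluate s) 33 = nsum n RD (ar s aME).
Proof.
move=> me; have [[[eN eNE _] _ _ eT eH] _ eM2 _ [eRD _]] := me.
pose c1 := Seq (When (eNot (EA aW (EA aME (EV 15)))) (32 ::= EC 0))
                   (33 ::= EAdd (EV 33) (EA aRD (EA aME (EV 15)))).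
pose s1 := setv (setv s 32 1) 33 0.
have -> : exec Evaluate s = exec (For 15 iN c1) s1 by [].
pose I i t := vr t 32 = all (fun x => ar s aW (ar s aME x) != 0) (iota 0 i) /\
  vr t 33 = \sum_(x < i) RD (ar s aME x).
have [] : I (vr s1 iN) (exec (For 15 iN c1) s1).
  apply: (@exec_for 15 iN _ _ I) => //; first by rewrite /I big_ord0.
  move=> i t lti vt at_ [I1 I2].
  have aW_ : ar t aW = ar s aW by rewrite at_.
  have aM_ : ar t aME = ar s aME by rewrite at_.
  have aR_ : ar t aRD = RD by rewrite at_.
  rewrite /I -[i.+1]addn1 iotaD all_cat [all _ (iota _ 1)]/= andbT addn1 add0n /c1; unf.
  rewrite ev_not; unf; rewrite aW_ aM_ negbK; case: eqP => z; unf.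
    by rewrite aM_ aR_ I2 big_ord_recr andbF.
  by rewrite aM_ aR_ I1 I2 big_ord_recr andbT.
have -> : vr s1 iN = n by [].
move=> -> ->; split=> //; congr nat_of_bool.
apply/allP/forallP => [h x|h x]; first by apply: h; rewrite mem_iota ltn_ord.
by rewrite mem_iota => xn; have := h (Ordinal xn).
Qed.

Definition best_ok t := vr t iBEST = 0 \/
  [/\ matching (ar t aBME), nsum n RD (ar t aBME) <= kk & vr t iBEST = (nsum n RD (ar t aBME)).+1].

(** For [b] the value of [iBEST], the last inequality says that [h] is no redder than the recorded
    candidate. This supplies the hypothesis on pairs of arcs in the approximation bound. *)
Definition covered b d1 d2 := forall g, matching g -> g (T d1) = d1 -> g (T d2) = d2 ->
  nsum n RD g <= kk -> exists h, [/\ matching h, h (T d1) = d1, h (T d2) = d2,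
  nsum n RD h <= nsum n RD g & nsum n RD h < b].

Lemma Record_spec s : menv s -> let s' := exec Record s in
  if [&& vr s 32 != 0, vr s 33 <= kk & vr s iBEST <= vr s 33]
  then vr s' iBEST = (vr s 33).+1 /\ forall x, x < n -> ar s' aBME x = ar s aME x
  else s' = s.
Proof.
move=> [[[eN eNE _] _ _ eT eH] _ eM2 eKK [eRD _]]; cbv zeta.
rewrite /Record; unf; rewrite !evE; unf; rewrite eKK; case E: [&& _, _ & _] => //.
split; first by unf; rewrite addn1.
pose I i t := forall x, x < i -> ar t aBME x = ar s aME x.
set s1 := setv s _ _; have <- : vr s1 iN = n by rewrite /s1; unf.
apply: (@exec_for 15 iN _ _ I) => // i t lti vt at_ It x; rewrite ltnS leq_eqVlt => di.
unf; rewrite (at_ aME) // /upd; case: eqP => [->//|ne'].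
by apply: It; move: di; case: eqP.
Qed.

Lemma nsum_eq w f g : (forall x, x < n -> f x = g x) -> nsum n w f = nsum n w g.
Proof. by move=> fg; apply: eq_bigr => x _; rewrite fg. Qed.

Lemma matching_eq f g : (forall x, x < n -> f x = g x) -> matching f -> matching g.
Proof.
move=> fg [[iv vf] lt]; split; last by move=> x xn; rewrite -fg ?lt.
by exists iv => x xn; rewrite -fg //; apply: vf.
Qed.

Lemma Candidate_spec s : menv s -> vr s 12 < m2 -> vr s 13 < m2 -> best_ok s ->
  let s' := exec Candidate s in
  [/\ best_ok s', vr s iBEST <= vr s' iBEST & covered (vr s' iBEST) (vr s 12) (vr s 13)].
Proof.
move=> me d1m d2m bs; cbv zeta.
pose s1 := exec SetWeights s; pose s2 := exec SetLoops s1.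
pose s3 := setv s2 iCAP (vr s2 iP + vr s2 iP); pose s4 := exec Search s3.
pose s5 := exec Evaluate s4.
have -> : exec Candidate s = exec Record s5 by [].
have me1 : menv s1 by apply: menv_exec.
have me2 : menv s2 by apply: menv_exec.
have me3 : menv s3 by apply: (@menv_exec (iCAP ::= EAdd (EV iP) (EV iP))).
have me4 : menv s4 by apply: menv_exec.
have me5 : menv s5 by apply: menv_exec.
have [[[_ _ eP2] _ _ _ _] _ _ _ _] := me2.
have Wsp := SetWeights_spec me; rewrite -/s1 in Wsp.
pose W := ar s1 aW; rewrite -/W in Wsp.
have W3 : ar s3 aW = W by rewrite /s3 /s2; unf.
have Wle d : d < ne -> W d <= n.+1 by move=> dl; rewrite Wsp //; case: ifP => // _; lia.
have [v2 l2] := SetLoops_spec me1; rewrite -/s2 in v2 l2.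
have e3 : env n ne P T H s3 by case: me3.
have cap3 : vr s3 iCAP = P + P by rewrite /s3; unf; rewrite eP2.
have sum0 : nsum n W (ar s3 aME) <= P + P.
  rewrite /s3; unf; rewrite /nsum big1 // => x _.
  by rewrite l2 // Wsp ?neE ?ltn_add2l // ltnNge leq_addr.
have [vf _ _ st] := Search_spec TH P_gt e3 W3 Wle v2 cap3 sum0.
rewrite -/s4 in vf st; set f := ar s4 aME in vf st; set iv := ar s4 aIV in vf st.
have nsW : nsum n W f <= n * n.+1.
  by apply: (@sum_ord_le n n.+1 (W \o f)) => x xn; apply: Wle; case: (vf x xn).
have capb : n * n.+1 + nsum n W f <= P + P by lia.
have opt g giv := stuck_optimum (g := g) (giv := giv) TH Wle vf capb st.
have [ok5 r5] := Evaluate_spec me4; rewrite -/s5 -/f in ok5 r5.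
have W4 : ar s4 aW = W by rewrite /s4; unf.
rewrite W4 in ok5.
have B5 : vr s5 iBEST = vr s iBEST by rewrite /s5 /s4 /s3 /s2 /s1; unf.
have BM5 : ar s5 aBME = ar s aBME by rewrite /s5 /s4 /s3 /s2 /s1; unf.
have ME5 : ar s5 aME = f by rewrite /s5; unf.
have okm : vr s5 32 != 0 -> [/\ matching f, f (T (vr s 12)) = vr s 12, f (T (vr s 13)) = vr s 13 &
    nsum n W f + nsum n RD f = n * n.+1].
  rewrite ok5 eqb0 negbK => /forallP nz.
  have fa x : x < n -> [&& f x < m2, allowed (vr s 12) (f x) & allowed (vr s 13) (f x)].
    move=> xn; have := nz (Ordinal xn); rewrite /= Wsp; last by case: (vf x xn).
    by case: ifP.
  have Tn d : d < m2 -> T d < n by move=> dm; case: (@TH d) => //; rewrite neE ltn_addr.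
  have fix_ d : d < m2 -> allowed d (f (T d)) -> f (T d) = d.
    move=> dm; rewrite /allowed; have [_ -> _] := vf _ (Tn _ dm).
    by rewrite eqxx orbF => /eqP.
  split.
  - by split; [exists iv|move=> x /fa/andP[]].
  - by apply: fix_ => //; have /and3P[] := fa _ (Tn _ d1m).
  - by apply: fix_ => //; have /and3P[] := fa _ (Tn _ d2m).
  rewrite /nsum -big_split; apply: (@sum_ord_const n n.+1 (fun x => W (f x) + RD (f x))) => x xn.
  rewrite Wsp ?fa //; last by case: (vf x xn).
  by rewrite subnK // (leq_trans (RD_le _)) //; case/and3P: (fa _ xn).
have okg g : matching g -> g (T (vr s 12)) = vr s 12 -> g (T (vr s 13)) = vr s 13 ->
    vr s5 32 != 0 /\ nsum n RD f <= nsum n RD g.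
  move=> [[giv vg] gl] g1 g2.
  have sumg : nsum n W g + nsum n RD g = n * n.+1.
    rewrite /nsum -big_split; apply: (@sum_ord_const n n.+1 (fun x => W (g x) + RD (g x))) => x xn.
    have [_ Tx _] := vg x xn.
    have al d : d < m2 -> g (T d) = d -> allowed d (g x).
      move=> dm gd; rewrite /allowed Tx; case: eqP => //= nd; apply/eqP => E.
      by apply: nd; rewrite -gd -E.
    rewrite Wsp ?gl ?al //=; last by rewrite neE ltn_addr ?gl.
    by rewrite subnK // (leq_trans (RD_le _)) // gl.
  have le := opt _ _ vg.
  have mg : matching g by split=> //; exists giv.
  have RDg := nsum_RD_le mg.
  have nz : vr s5 32 != 0.
    rewrite ok5 eqb0 negbK; apply/forallP => x0; apply/negP => /eqP z.
    (* One arc of weight 0 leaves at most [(n - 1) * (n + 1)], that is [n * n - 1], whereas [g] has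
       weight at least [n * (n + 1) - n], that is [n * n]. *)
    have : nsum n W f <= n.-1 * n.+1.
      rewrite /nsum (bigD1 x0) //= z add0n.
      have -> : n.-1 = #|[pred x : 'I_n | x != x0]| by rewrite (cardC1 x0) card_ord.
      rewrite -sum_nat_const; apply: leq_sum => x _.
      by apply: Wle; case: (vf x (ltn_ord x)).
    have : 0 < n := leq_ltn_trans (leq0n _) (ltn_ord x0).
    case: (n) le sumg RDg => // k; rewrite /= => le sumg RDg _ le2.
    by move: sumg; rewrite mulSn; lia.
  by split=> //; have [_ _ _] := okm nz; lia.
have := Record_spec me5; rewrite r5 B5 ME5 => /=; case: ifP => [/and3P[ok rk br] [Bn Bx]|no E].
  have [mf f1 f2 _] := okm ok; rewrite Bn; split; [right| |].
  - rewrite (nsum_eq _ Bx) Bn; split=> //.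
    by apply: matching_eq mf => x xn; rewrite Bx.
  - exact: leqW.
  - by move=> g mg g1 g2 gk; exists f; split=> //; have [] := okg g mg g1 g2.
rewrite E; split.
- by case: bs => [z|[h1 h2 h3]]; [left; rewrite B5|right; rewrite BM5 B5].
- by rewrite B5.
move=> g mg g1 g2 gk; have [nz le] := okg g mg g1 g2.
have [mf f1 f2 _] := okm nz.
exists f; split=> //; rewrite B5; move: no; rewrite nz /= (leq_trans le gk) /=.
by rewrite ltnNge => ->.
Qed.

Lemma covered_le b b' d1 d2 : b <= b' -> covered b d1 d2 -> covered b' d1 d2.
Proof.
move=> le cov g mg g1 g2 gk; have [h [? ? ? ? hb]] := cov g mg g1 g2 gk.
by exists h; split=> //; apply: leq_trans le.
Qed.

Lemma Candidates_spec s : menv s -> let s' := exec Candidates s in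
  best_ok s' /\ forall d1 d2, d1 < m2 -> d2 < m2 -> covered (vr s' iBEST) d1 d2.
Proof.
move=> me; cbv zeta; pose s1 := setv s iBEST 0.
have -> : exec Candidates s = exec (For 12 iM2 (For 13 iM2 Candidate)) s1 by [].
have me1 : menv s1 by apply: (@menv_exec (iBEST ::= EC 0)).
have eM2 : vr s1 iM2 = m2 by case: me1.
pose I i t := best_ok t /\ forall d1 d2, d1 < i -> d2 < m2 -> covered (vr t iBEST) d1 d2.
rewrite -{2}eM2; suff : I (vr s1 iM2) (exec (For 12 iM2 (For 13 iM2 Candidate)) s1) by rewrite eM2.
apply: (@exec_for 12 iM2 _ _ I) => //; first by split=> //; left.
move=> i t; rewrite eM2 => im vt at_ [b1 b2].
have me2 : menv (setv t 12 i) by apply: menv_loop vt at_ _ _ me1.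
have eM2' : vr (setv t 12 i) iM2 = m2 by case: me2.
pose J j t' := [/\ best_ok t', forall d1 d2, d1 < i -> d2 < m2 -> covered (vr t' iBEST) d1 d2 &
  forall d2, d2 < j -> covered (vr t' iBEST) i d2].
have [] : J m2 (exec (For 13 iM2 Candidate) (setv t 12 i)).
  rewrite -{1}eM2'; apply: (@exec_for 13 iM2 _ _ J) => //.
  move=> j t'; rewrite eM2' => jm vt' at' [j1 j2 j3].
  have me3 : menv (setv t' 13 j) by apply: menv_loop vt' at' _ _ me2.
  have e12 : vr (setv t' 13 j) 12 = i by unf; rewrite vt'; unf.
  have [|//|//|k1 k2 k3] := Candidate_spec me3; first by rewrite e12.
  split=> //.
  - by move=> d1 d2 l1 l2; apply: covered_le k2 (j2 _ _ l1 l2).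
  - move=> d2; rewrite ltnS leq_eqVlt => /orP[/eqP->|l2].
      by move: k3; rewrite e12.
    by apply: covered_le k2 (j3 _ l2).
move=> h1 h2 h3; split=> // d1 d2; rewrite ltnS leq_eqVlt => /orP[/eqP->|l1] l2; last exact: h2.
exact: h3.
Qed.

Definition chosen (f : nat -> nat) (e : nat) := [exists x : 'I_n, (CL x == 0) &&
  (if f x < m then f x == e else f x - m == e)].

Lemma Output_spec s : menv s -> forall e, e < m ->
  (ar (exec Output s) aOUT e != 0) = chosen (ar s aME) e.
Proof.
move=> me; pose s1 := exec (For 11 iM (Ast aOUT (EV 11) (EC 0))) s.
pose c2 := When (eNot (EA aCL (EV 15)))
      (Seq (14 ::= EA aME (EV 15))
         (If (eLt (EV 14) (EV iM)) (Ast aOUT (EV 14) (EC 1))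
            (Ast aOUT (ESub (EV 14) (EV iM)) (EC 1)))).
have -> : exec Output s = exec (For 15 iN c2) s1 by [].
have me1 : menv s1 by apply: menv_exec.
have [[[eN _ _] _ _ _ _] eM _ _ [_ eCL]] := me1.
have z1 e : e < m -> ar s1 aOUT e = 0.
  pose I i t := forall e, e < i -> ar t aOUT e = 0.
  have eM0 : vr s iM = m by case: me.
  suff : I (vr s iM) s1 by rewrite eM0 => /(_ e).
  apply: (@exec_for 11 iM _ _ I) => // i t lti vt at_ It x; rewrite ltnS leq_eqVlt => di.
  unf; rewrite /upd; case: eqP => [//|ne'].
  by apply: It; move: di; case: eqP.
have ME1 : ar s1 aME = ar s aME by rewrite /s1; unf.
set f := ar s aME in ME1 *.
pose sel x e := (CL x == 0) && (if f x < m then f x == e else f x - m == e).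
pose I i t := forall e, e < m -> (ar t aOUT e != 0) = has (sel ^~ e) (iota 0 i).
move=> e em; have : I n (exec (For 15 iN c2) s1).
  rewrite -eN; apply: (@exec_for 15 iN _ _ I) => //; first by move=> e' em'; rewrite z1.
  move=> i t lti vt at_ It e' em'.
  rewrite -[i.+1]addn1 iotaD has_cat [has _ (iota _ 1)]/= orbF add0n -It // /c2; unf; rewrite ev_not; unf.
  rewrite /sel at_ // eCL negbK; case: (CL i == 0); unf; last by rewrite orbF.
  rewrite ev_lt; unf; rewrite !(at_ aME) // ME1 !(vt iM) // eM.
  case: ifP => _; unf; rewrite ?(at_ aME) // ?ME1 ?vt // ?eM /upd [_ == e']eq_sym.
    by case: (e' == _); rewrite ?orbT ?orbF.
  by case: (e' == _); rewrite ?orbT ?orbF.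
move=> /(_ e em)->; rewrite /chosen.
apply/hasP/existsP => [[x]|[x sx]]; last by exists (nat_of_ord x) => //; rewrite mem_iota add0n ltn_ord.
by rewrite mem_iota => xn sx; exists (Ordinal xn).
Qed.

Lemma SetRedWeights_spec s : menv s -> forall d, d < ne ->
  ar (exec SetRedWeights s) aW d = if d < m2 then RD d else n.+1.
Proof.
move=> me; have [[[eN eNE _] _ _ eT eH] _ eM2 _ [eRD _]] := me.
pose I i t := forall d, d < i -> ar t aW d = if d < m2 then RD d else n.+1.
suff : I (vr s iNE) (exec SetRedWeights s) by rewrite eNE.
apply: (@exec_for 14 iNE _ _ I) => // i t lti vt at_ It d; rewrite ltnS leq_eqVlt => di.
unf; rewrite ev_lt; unf; rewrite (vt iM2) // eM2.
case: ifP => c; unf; rewrite /upd; (case: eqP => [->|ne']; last by apply: It; move: di; case: eqP).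
  by rewrite c at_ // eRD.
by rewrite c vt // eN addn1.
Qed.

Lemma Restore_spec s : menv s -> matching (ar s aBME) ->
  valid n ne T H (ar (exec Restore s) aME) (ar (exec Restore s) aIV) /\
  forall x, x < n -> ar (exec Restore s) aME x = ar s aBME x.
Proof.
move=> me [[giv vg] gl]; have [[[eN eNE _] _ _ eT eH] _ eM2 _ [eRD _]] := me.
pose I i t := forall x, x < i -> x < n ->
  ar t aME x = ar s aBME x /\ ar t aIV (H (ar s aBME x)) = x.
have : I (vr s iN) (exec Restore s).
  apply: (@exec_for 15 iN _ _ I) => // i t; rewrite eN => lti vt at_ It x.
  rewrite ltnS leq_eqVlt => di xn.
  unf; rewrite !(at_ aBME) // !(at_ aH) // eH /upd.
  case: (x =P i) di => [-> _|ne' /= di]; first by rewrite !eqxx.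
  have [h1 h2] := It _ di xn; rewrite ifN //.
  apply/eqP => E; apply: ne'.
  by have [_ _ <-] := vg x xn; have [_ _ <-] := vg i lti; rewrite E.
rewrite eN => h; split=> x xn; have [h1 h2] := h _ xn xn => //.
by have [? ? ?] := vg x xn; rewrite h1.
Qed.

Lemma Final_spec s : menv s -> 0 < n -> best_ok s -> vr s iBAD = 0 ->
  (forall d1 d2, d1 < m2 -> d2 < m2 -> covered (vr s iBEST) d1 d2) ->
  let s' := exec Final s in
  ((exists2 g, matching g & nsum n RD g <= kk) -> vr s' iRES = 1 /\
    exists f, [/\ matching f, nsum n RD f <= kk,
      forall g, matching g -> nsum n RD g <= kk -> nsum n RD g <= 3 * nsum n RD f &
      forall e, e < m -> (ar s' aOUT e != 0) = chosen f e]) /\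
  (~ (exists2 g, matching g & nsum n RD g <= kk) -> vr s' iRES = 0).
Proof.
move=> me n0 bs bad cov; cbv zeta.
have [z|nz] := eqVneq (vr s iBEST) 0.
  have -> : exec Final s = setv s iRES 0.
    by rewrite /Final; unf; rewrite ev_and; unf; rewrite z.
  split=> // -[g mg gk]; exfalso.
  have [[giv vg] gl] := mg; have [_ Tg0 _] := vg 0 n0.
  (* The arc of [g] at vertex 0, taken as both prescribed arcs, would be covered with [iBEST] zero,
     which is absurd. *)
  have d0 : g 0 < m2 by apply: gl.
  have g0 : g (T (g 0)) = g 0 by rewrite Tg0.
  by have [h [_ _ _ _]] := cov _ _ d0 d0 g mg g0 g0 gk; rewrite z.
case: bs => [z|[mb bk bE]]; first by rewrite z in nz.
split; last by case; exists (ar s aBME).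
move=> _; pose s1 := exec SetRedWeights s; pose s2 := exec Restore s1.
pose s3 := setv s2 iCAP (vr s2 iKK); pose s4 := exec Search s3.
have -> : exec Final s = setv (exec Output s4) iRES 1.
  by rewrite /Final; unf; rewrite ev_and ev_not; unf; rewrite bad nz /s4 /s3 /s2 /s1; unf.
have me1 : menv s1 by apply: menv_exec.
have me2 : menv s2 by apply: menv_exec.
have me3 : menv s3 by apply: (@menv_exec (iCAP ::= EV iKK)).
have me4 : menv s4 by apply: menv_exec.
have Wsp := SetRedWeights_spec me; rewrite -/s1 in Wsp.
pose W := ar s1 aW; rewrite -/W in Wsp.
have W3 : ar s3 aW = W by rewrite /s3 /s2; unf.
have Wle d : d < ne -> W d <= n.+1.
  by move=> dl; rewrite Wsp //; case: ifP => // dm; rewrite (leq_trans (RD_le dm)).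
have mb1 : matching (ar s1 aBME) by rewrite /s1; unf.
have [v2 B2] := Restore_spec me1 mb1; rewrite -/s2 in v2 B2.
have B1 : ar s1 aBME = ar s aBME by rewrite /s1; unf.
have e3 : env n ne P T H s3 by case: me3.
have cap3 : vr s3 iCAP = kk by rewrite /s3; unf; case: me2.
have WRD g : matching g -> nsum n W g = nsum n RD g.
  move=> [_ gl]; apply: eq_bigr => x _; have gx := gl _ (ltn_ord x).
  by rewrite Wsp ?gx // neE ltn_addr.
have sum3 : nsum n W (ar s3 aME) = nsum n RD (ar s aBME).
  by rewrite -WRD // /s3; unf; rewrite (nsum_eq _ B2) B1.
have [|vf le1 le2 st] := Search_spec TH P_gt e3 W3 Wle v2 cap3; first by rewrite sum3.
rewrite -/s4 in vf le1 le2 st; set f := ar s4 aME in vf le1 le2 st.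
(* A single loop would weigh [n + 1], more than the cap [kk <= n]. *)
have mf : matching f.
  split; first by eexists; exact: vf.
  move=> x xn; rewrite ltnNge; apply/negP => ge.
  have : W (f x) <= nsum n W f by rewrite /nsum (bigD1 (Ordinal xn)) //= leq_addr.
  have [fx _ _] := vf x xn; have -> : W (f x) = n.+1 by rewrite Wsp // ltnNge ge.
  lia.
rewrite sum3 WRD // in le1; rewrite WRD // in le2.
split=> //; exists f; split=> //.
  move=> g mg gk; rewrite leqNgt; apply/negP => small.
  have [[giv vg] gl] := mg.
  suff : nsum n RD g <= 3 * nsum n W f by rewrite (WRD f) // leqNgt small.
  apply: (stuck_approx TH vf st vg (WRD g mg) gk) => x1 x2 x1n x2n; have [_ T1 _] := vg x1 x1n; have [_ T2 _] := vg x2 x2n.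
  (* [hb] bounds [h] by the recorded candidate, and [le1] bounds that candidate by [f], so the
     assumption on [f] passes to [h]. *)
  have := cov _ _ (gl _ x1n) (gl _ x2n) g mg; rewrite T1 T2 => /(_ (erefl _) (erefl _) gk).
  case=> h [mh h1 h2 _ hb]; have [[hiv vh] _] := mh.
  by exists h, hiv; split=> //; rewrite WRD //; lia.
by move=> e em; unf; apply: Output_spec.
Qed.

End Verification.

(** * Perfect matchings and the input graph *)

Section Graph.
Variables (n : nat) (E : seq edge).
Let m := size E.
Let en e := nth e0 E e.

Definition parsed (T H RD CL : nat -> nat) :=
  [/\ forall e, e < m -> [/\ T e = eu (en e), H e = ev (en e), T (m + e) = ev (en e) &
        H (m + e) = eu (en e)],
      forall x, x < n -> T (m + m + x) = x /\ H (m + m + x) = x,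
      forall e, e < m -> (CL (eu (en e)) == 0) != (CL (ev (en e)) == 0) &
      forall e, e < m -> RD e = (CL (eu (en e)) == 0) && ered (en e) /\
        RD (m + e) = (CL (ev (en e)) == 0) && ered (en e)].

Variables T H RD CL : nat -> nat.
Hypothesis E_lt : all (fun e => (eu e < n) && (ev e < n)) E.
Hypothesis E_arrays : parsed T H RD CL.

Let ne := m + m + n.

Lemma edge_lt e : e < m -> eu (en e) < n /\ ev (en e) < n.
Proof. by move=> em; have /andP[] := all_nthP e0 E_lt e em. Qed.

Lemma parsed_lt d : d < ne -> T d < n /\ H d < n.
Proof.
have [TH lp _ _] := E_arrays; move=> dl.
have [dm|md] := ltnP d m; first by have [-> -> _ _] := TH d dm; apply: edge_lt.
have [dm2|md2] := ltnP d (m + m).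
  have dE : d = m + (d - m) by lia.
  have dm : d - m < m by lia.
  by rewrite dE; have [_ _ -> ->] := TH _ dm; have [] := edge_lt dm.
have dE : d = m + m + (d - (m + m)) by lia.
have dn : d - (m + m) < n by move: dl; rewrite /ne; lia.
by rewrite dE; have [-> ->] := lp _ dn.
Qed.

Lemma parsed_RD_le d : d < m + m -> RD d <= 1.
Proof.
have [_ _ _ hRD] := E_arrays; move=> dl.
have [dm|md] := ltnP d m; first by have [-> _] := hRD d dm; case: (_ && _).
have dE : d = m + (d - m) by lia.
have dm : d - m < m by lia.
by rewrite dE; have [_ ->] := hRD _ dm; case: (_ && _).
Qed.

Definition arc_edge d := if d < m then d else d - m.

Lemma arc_edgeP d : d < m + m -> [/\ arc_edge d < m,
  forall y, incident (en (arc_edge d)) y = (T d == y) || (H d == y),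
  (CL (T d) == 0) != (CL (H d) == 0) &
  RD d = (CL (T d) == 0) && ered (en (arc_edge d))].
Proof.
have [hT _ hC hR] := E_arrays; rewrite /arc_edge => dl.
have [dm|md] := ltnP d m.
  by have [-> -> _ _] := hT d dm; have [-> _] := hR d dm; split=> //; apply: hC.
have dE : d = m + (d - m) by lia.
have dm : d - m < m by lia.
move: (d - m) dE dm => e -> em.
have [_ _ -> ->] := hT _ em; have [_ ->] := hR _ em; split=> //.
  by move=> y; rewrite /incident orbC.
by rewrite eq_sym; apply: hC.
Qed.

Section Perfect.
Variable M : {set 'I_(size E)}.
Hypothesis M_pm : perfect_matching n E M.

Lemma pm_unique x : x < n -> exists i : 'I_(size E), [/\ i \in M, incident (en i) x &
  forall j, j \in M -> incident (en j) x -> j = i].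
Proof.
move=> xn; have /forallP/(_ (Ordinal xn)) /cards1P[i iE] := M_pm; exists i.
have : i \in [set i in M | incident (nth e0 E i) (Ordinal xn)] by rewrite iE inE.
rewrite inE => /andP[iM ix]; split=> // j jM jx.
by apply/set1P; rewrite -iE inE jM.
Qed.

(** Every edge has exactly one end in the first class, so counting at these ends counts it once. *)
Lemma nred_double : nred E M =
  \sum_(x < n | CL x == 0) \sum_(i in M | incident (en i) x) ered (en i).
Proof.
have [_ _ hC _] := E_arrays.
rewrite /nred -sum1_card (exchange_big_dep (mem M)) /=; last by move=> x i _ /andP[].
rewrite (eq_bigl (fun i => (i \in M) && ered (en i))); last by move=> i; rewrite inE.
rewrite big_mkcondr; apply: eq_bigr => i iM.
have [un vn] := edge_lt (ltn_ord i); have col := hC i (ltn_ord i).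
have [u0|u1] := boolP (CL (eu (en i)) == 0).
  rewrite (big_pred1 (Ordinal un)); first by case: (ered _).
  move=> x; rewrite /= iM /incident -(inj_eq val_inj) /=.
  case: (eqVneq (eu (en i)) x) => [<-|ux] /=; first by rewrite ?eqxx ?u0.
  case: (ev (en i) =P x) => [<-|_]; last by rewrite andbF.
  by move: col; rewrite u0; case: (_ == 0).
rewrite (big_pred1 (Ordinal vn)); first by case: (ered _).
move=> x; rewrite /= iM /incident -(inj_eq val_inj) /=.
case: (eqVneq (ev (en i)) x) => [<-|vx] /=.
  by rewrite ?orbT ?andbT; move: col; rewrite (negbTE u1); case: (_ == 0).
rewrite orbF; case: (eu (en i) =P x) => [<-|_]; last by rewrite andbF.
by rewrite (negbTE u1).
Qed.

Lemma nred_arcs f : (forall x, x < n -> CL x == 0 -> [/\ f x < m + m, T (f x) = x &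
    exists2 i : 'I_(size E), i \in M & arc_edge (f x) = i]) ->
  (forall x, x < n -> CL x != 0 -> f x < m + m /\ T (f x) = x) ->
  nred E M = nsum n RD f.
Proof.
move=> f0 f1; rewrite nred_double /nsum [RHS](bigID (fun x : 'I_n => CL x == 0)) /=.
rewrite [X in _ = _ + X]big1 ?addn0 => [|x nx]; last first.
  have [fl Tf] := f1 x (ltn_ord x) nx; have [_ _ _ ->] := arc_edgeP fl.
  by rewrite Tf (negbTE nx).
apply: eq_bigr => x x0; have [fl Tf [i iM fi]] := f0 x (ltn_ord x) x0.
have [_ inc _ ->] := arc_edgeP fl; rewrite Tf x0 /= fi.
have ix : incident (en i) x by rewrite -fi inc Tf eqxx.
rewrite (big_pred1 i) // => j /=; apply/andP/eqP => [[jM jx]|-> //].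
have [i0 [_ _ u]] := pm_unique (ltn_ord x).
by rewrite (u _ jM jx) (u _ iM ix).
Qed.

(** Each vertex takes the arc to its partner. As partnership is symmetric, following the arc out of
    the head leads back, which gives the inverse. *)
Lemma pm_matching : exists g, matching n (m + m) ne T H g /\ nsum n RD g = nred E M.
Proof.
have [hT _ hC hR] := E_arrays.
have /fin_all_exists[g gP] (x : 'I_n) := pm_unique (ltn_ord x).
pose f y : nat := if insub y is Some x then
  (if eu (en (g x)) == y then g x : nat else m + g x) else 0.
have fE x (xn : x < n) : f x = if eu (en (g (Ordinal xn))) == x then g (Ordinal xn) : nat
    else m + g (Ordinal xn).
  by rewrite /f insubT.
have fP x (xn : x < n) : [/\ f x < m + m, T (f x) = x & arc_edge (f x) = g (Ordinal xn)].
  rewrite fE; have [_ gx _] := gP (Ordinal xn); have gm := ltn_ord (g (Ordinal xn)).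
  have [t1 _ t2 _] := hT _ gm; move: gx; rewrite /incident /= /arc_edge.
  case: eqP => [ux _|_ /= /eqP vx]; rewrite ?t1 ?t2 ?ltnNge ?leq_addr /= ?addKn ?gm; split=> //.
  - by move: gm; rewrite -/m; lia.
  - by rewrite -ltnNge gm.
  - by move: gm; rewrite -/m; lia.
have other x (xn : x < n) : H (f (H (f x))) = x.
  have [fl Tf ge] := fP x xn; have [em inc col _] := arc_edgeP fl.
  set y := H (f x); have [yn] : y < n.
    by have [] := @parsed_lt (f x) _; rewrite /ne; lia.
  have [fly Tfy gy] := fP y yn; have [_ incy _ _] := arc_edgeP fly.
  have same : g (Ordinal yn) = g (Ordinal xn).
    have [_ _ u] := gP (Ordinal yn); have [gM _ _] := gP (Ordinal xn).
    by symmetry; apply: u => //=; rewrite -ge inc /y eqxx orbT.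
  have := incy x; rewrite gy same -ge inc Tf eqxx /= => /esym/orP[|/eqP //].
  by rewrite Tfy => /eqP yx; move: col; rewrite Tf -/y yx eqxx.
exists f; split.
  split; last by move=> x xn; have [] := fP x xn.
  exists (fun y => H (f y)) => x xn; have [fl Tf _] := fP x xn.
  by split=> //; [rewrite /ne; lia|apply: other].
symmetry; apply: nred_arcs => x xn _; have [fl Tf ge] := fP x xn; split=> //.
by exists (g (Ordinal xn)) => //; have [] := gP (Ordinal xn).
Qed.
End Perfect.

(** A vertex of the second class is the head of exactly one arc, whose tail is in the first class.
    So the arcs leaving the first class alone cover every vertex once, and they are the only ones
    counted as red. *)
Lemma matching_pm f (M : {set 'I_(size E)}) : matching n (m + m) ne T H f ->
  (forall i : 'I_(size E), (i \in M) = chosen n m CL f i) ->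
  perfect_matching n E M /\ nred E M = nsum n RD f.
Proof.
case=> [[iv vf] fl] ME.
have inM (i : 'I_(size E)) : i \in M -> exists x, [/\ x < n, CL x == 0 & arc_edge (f x) = i].
  rewrite ME => /existsP[x /andP[x0 xi]]; exists x; split=> //; rewrite /arc_edge.
  by move: xi; case: ifP => _ /eqP.
have memM x : x < n -> CL x == 0 -> exists2 i : 'I_(size E), i \in M & arc_edge (f x) = i.
  move=> xn x0; have [em _ _ _] := arc_edgeP (fl x xn).
  exists (Ordinal em) => //; rewrite ME; apply/existsP; exists (Ordinal xn); rewrite x0 /=.
  by rewrite /= /arc_edge; case: (f x < m).
have pm : perfect_matching n E M.
  apply/forallP => y; have yn := ltn_ord y.
  have [x [xn x0 xy]] : exists x, [/\ x < n, CL x == 0 & (x == y) || (H (f x) == y)].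
    have [y0|y1] := boolP (CL y == 0); first by exists y; rewrite eqxx.
    have [ivn ivy] := valid_surj parsed_lt vf yn; exists (iv y); rewrite ivy eqxx orbT.
    split=> //; have [_ _ col _] := arc_edgeP (fl _ ivn).
    have [_ Tf _] := vf _ ivn; move: col; rewrite Tf ivy (negbTE y1).
    by case: (_ == 0).
  have [i iM fi] := memM x xn x0.
  apply/cards1P; exists i; apply/setP => j; rewrite !inE; apply/andP/eqP => [[jM jy]|->]; last first.
    split=> //; have [_ inc _ _] := arc_edgeP (fl x xn); have [_ Tf _] := vf x xn.
    by rewrite -[nth _ _ _]/(en i) -fi inc Tf.
  have [x' [x'n x'0 fj]] := inM j jM; apply: ord_inj; rewrite -fi -fj; congr (arc_edge (f _)).
  have [_ Tf ivx] := vf x xn; have [_ Tf' ivx'] := vf x' x'n.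
  have [_ _ col _] := arc_edgeP (fl x xn); have [_ inc' col' _] := arc_edgeP (fl x' x'n).
  move: jy; rewrite -[nth _ _ _]/(en j) -fj inc' Tf'.
  rewrite Tf x0 in col; rewrite Tf' x'0 in col'.
  case/orP: xy => /eqP xy /orP[] /eqP x'y.
  - by rewrite x'y xy.
  - by move: col'; rewrite x'y -xy x0.
  - by move: col; rewrite xy -x'y x'0.
  - by rewrite -ivx -ivx' xy x'y.
split=> //; apply: nred_arcs => // x xn xc; last first.
  by have [_ Tf _] := vf x xn; split=> //; apply: fl.
by have [_ Tf _] := vf x xn; split=> //; [apply: fl|apply: memM].
Qed.

End Graph.

(** * Reading the graph and computing a two-colouring *)

Section ParseSpec.
Variables (n : nat) (E : seq edge) (side : nat -> bool).
Let m := size E.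
Let en e := nth e0 E e.
Hypothesis E_lt : all (fun e => (eu e < n) && (ev e < n)) E.
Hypothesis E_bip : all (fun e => side (eu e) != side (ev e)) E.

Definition input_ok (IN : nat -> nat) := forall e, e < m ->
  [/\ IN (e + (e + e)) = eu (en e), IN (e + (e + e) + 1) = ev (en e) &
      IN (e + (e + (e + 2))) = ered (en e)].

Definition penv s := [/\ vr s iN = n, vr s iM = m, vr s iM2 = m + m & input_ok (ar s aIN)].

Lemma penv_exec c s : all (fun y => y \notin avars c) [:: iN; iM; iM2] ->
  aIN \notin aarrs c -> penv s -> penv (exec c s).
Proof.
by case/and4P=> ? ? ? _ ? [? ? ? ?]; split; rewrite ?exec_vr ?exec_ar.
Qed.

Lemma ParseEdge_loop s : penv s -> let t := exec (For 11 iM ParseEdge) s in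
  forall e, e < m -> [/\ ar t aT e = eu (en e), ar t aH e = ev (en e),
    ar t aT (m + e) = ev (en e) & ar t aH (m + e) = eu (en e)].
Proof.
move=> [eN eM eM2 inp]; cbv zeta.
pose I i t := forall e, e < i -> e < m -> [/\ ar t aT e = eu (en e), ar t aH e = ev (en e),
    ar t aT (m + e) = ev (en e) & ar t aH (m + e) = eu (en e)].
suff : I (vr s iM) (exec (For 11 iM ParseEdge) s) by rewrite eM => h e em; apply: h.
apply: (@exec_for 11 iM _ _ I) => // i t; rewrite eM => lti vt at_ It e.
rewrite ltnS leq_eqVlt => ei em; rewrite /ParseEdge; unf.
rewrite !(at_ aIN) // (vt iM) // eM; have [i1 i2 _] := inp i lti.
rewrite i1 i2 /upd eqn_add2l (ltn_eqF (ltn_addr i em)) (gtn_eqF (ltn_addr e lti)).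
case: (e =P i) ei => [->|ne /= ei]; last exact: It.
by rewrite ?eqxx.
Qed.

Lemma ParseLoop_loop s : penv s -> let t := exec (For 15 iN ParseLoop) s in
  [/\ forall x, x < n -> [/\ ar t aT (m + m + x) = x, ar t aH (m + m + x) = x,
        ar t aCP x = x & ar t aCL x = 0],
      forall d, d < m + m -> ar t aT d = ar s aT d & forall d, d < m + m -> ar t aH d = ar s aH d].
Proof.
move=> [eN eM eM2 inp]; cbv zeta.
pose I i t := [/\ forall x, x < i -> [/\ ar t aT (m + m + x) = x, ar t aH (m + m + x) = x,
        ar t aCP x = x & ar t aCL x = 0],
      forall d, d < m + m -> ar t aT d = ar s aT d & forall d, d < m + m -> ar t aH d = ar s aH d].
suff : I (vr s iN) (exec (For 15 iN ParseLoop) s) by rewrite eN.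
apply: (@exec_for 15 iN _ _ I) => // i t; rewrite eN => lti vt at_ [I1 I2 I3].
rewrite /I /ParseLoop; unf; rewrite !(vt iM2) // eM2; split=> [x|d dl|d dl].
- rewrite ltnS leq_eqVlt /upd eqn_add2l => xi.
  case: (x =P i) xi => [->|ne /= xi] //; exact: I1.
- by rewrite /upd (ltn_eqF (ltn_addr i dl)) I2.
- by rewrite /upd (ltn_eqF (ltn_addr i dl)) I3.
Qed.

(** [side] is only known to exist, and a component determines it up to exchanging the classes. So
    the computed sides are compared with it through relative parity inside a component. *)
Definition colored (CP CL : nat -> nat) := [/\ forall x, x < n -> CL x <= 1 &
  forall x y, x < n -> y < n -> CP x = CP y ->
    (CL x == 0) (+) (CL y == 0) = side x (+) side y].

Lemma Recolor_loop s cu cv fl : vr s iN = n -> vr s 34 = cu -> vr s 36 = cv -> vr s 35 = fl ->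
  let t := exec (For 15 iN Recolor) s in forall x, x < n ->
  ar t aCP x = (if ar s aCP x == cu then cv else ar s aCP x) /\
  ar t aCL x = (if (ar s aCP x == cu) && (fl != 0) then 1 - ar s aCL x else ar s aCL x).
Proof.
move=> eN e34 e36 e35; cbv zeta.
pose I i t := forall x, ar t aCP x = (if (x < i) && (ar s aCP x == cu) then cv else ar s aCP x) /\
  ar t aCL x = (if (x < i) && ((ar s aCP x == cu) && (fl != 0)) then 1 - ar s aCL x else ar s aCL x).
suff h : I n (exec (For 15 iN Recolor) s).
  by move=> x xn; have := h x; rewrite xn.
rewrite -eN; apply: (@exec_for 15 iN _ _ I) => // i t; rewrite eN => lti vt at_ It x.
have [h1 h2] := It i; rewrite ltnn /= in h1 h2; have [k1 k2] := It x.
rewrite /Recolor; unf; rewrite ev_eq; unf; rewrite h1 (vt 34) // e34.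
have lt1 : (x < i.+1) = (x == i) || (x < i) by rewrite ltnS leq_eqVlt.
rewrite lt1; case: (x =P i) => [->|/eqP ne] /=.
  case: (ar s aCP i =P cu) => [cE|ne]; unf; last by rewrite h1 h2.
  rewrite (vt 35) // e35; case: (fl != 0); unf; rewrite ?(vt 36) // e36 /upd eqxx ?h2 //.
  by rewrite /eNot; unf; rewrite h2.
case: (ar s aCP i =P cu) => [cE|_]; unf; last by rewrite k1 k2.
by rewrite (vt 35) // e35; move: k2; case: (fl != 0) => k2; unf; rewrite /upd (negbTE ne) k1 k2.
Qed.

Lemma Merge_loop s : penv s -> (forall e, e < m -> ar s aT e = eu (en e) /\ ar s aH e = ev (en e)) ->
  (forall x, x < n -> ar s aCP x = x /\ ar s aCL x = 0) ->
  let t := exec (For 11 iM Merge) s in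
  forall e, e < m -> (ar t aCL (eu (en e)) == 0) != (ar t aCL (ev (en e)) == 0).
Proof.
move=> [eN eM eM2 inp] sT s0; cbv zeta.
have lt e : e < m -> [/\ eu (en e) < n, ev (en e) < n & side (eu (en e)) != side (ev (en e))].
  by move=> em; have /andP[? ?] := all_nthP e0 E_lt e em; split=> //; apply: (all_nthP e0 E_bip).
pose I i t := colored (ar t aCP) (ar t aCL) /\
  forall e, e < i -> e < m -> ar t aCP (eu (en e)) = ar t aCP (ev (en e)).
suff : I (vr s iM) (exec (For 11 iM Merge) s).
  rewrite eM => -[[_ col] same] e em; have [un vn sd] := lt e em.
  have := col _ _ un vn (same e em em); move: sd.
  by case: (_ == 0); case: (_ == 0); case: (side _); case: (side _).
apply: (@exec_for 11 iM _ _ I) => //.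
  split=> //; split=> [x /s0[_ ->] //|x y xn yn].
  by have [-> ->] := s0 x xn; have [-> ->] := s0 y yn => ->; rewrite !addbb.
move=> i t; rewrite eM => lti vt at_ [[I1 I2] I3].
have [sTi sHi] := sT i lti; have [un vn sd] := lt i lti.
set u := eu (en i) in un sd sTi; set v := ev (en i) in vn sd sHi.
pose cu := ar t aCP u; pose cv := ar t aCP v; pose fl := ar t aCL u == ar t aCL v.
pose s1 := exec (block [:: 34 ::= EA aCP (EA aT (EV 11)); 36 ::= EA aCP (EA aH (EV 11));
    35 ::= eEq (EA aCL (EA aT (EV 11))) (EA aCL (EA aH (EV 11)))]) (setv t 11 i).
have e34 : vr s1 34 = cu by rewrite /s1; unf; rewrite (at_ aT) // sTi.
have e36 : vr s1 36 = cv by rewrite /s1; unf; rewrite (at_ aH) // sHi.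
have e35 : (vr s1 35 != 0) = fl.
  by rewrite /s1; unf; rewrite ev_eq; unf; rewrite (at_ aT) // (at_ aH) // sTi sHi.
have eN1 : vr s1 iN = n by rewrite /s1; unf; rewrite vt.
have CP1 : ar s1 aCP = ar t aCP by rewrite /s1; unf.
have CL1 : ar s1 aCL = ar t aCL by rewrite /s1; unf.
have -> : exec Merge (setv t 11 i) = if cu == cv then s1 else exec (For 15 iN Recolor) s1.
  have -> : exec Merge (setv t 11 i) = exec (When (eNot (eEq (EV 34) (EV 36))) (For 15 iN Recolor)) s1 by [].
  by unf; rewrite ev_not ev_eq; unf; rewrite e34 e36; case: (cu == cv).
case: (cu =P cv) => [cE|ne].
  rewrite /I CP1 CL1; split=> // e; rewrite ltnS leq_eqVlt => /orP[/eqP-> _|]; [exact: cE|exact: I3].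
have R := Recolor_loop eN1 e34 e36 (erefl (vr s1 35)); rewrite CP1 CL1 e35 /= in R.
set t' := exec (For 15 iN Recolor) s1 in R *.
have fl2 : fl = ~~ ((ar t aCL u == 0) (+) (ar t aCL v == 0)).
  by rewrite /fl; have := I1 _ un; have := I1 _ vn; case: (ar t aCL u) => [|[]] //; case: (ar t aCL v) => [|[]].
have flip x : x < n -> (1 - ar t aCL x == 0) = ~~ (ar t aCL x == 0).
  by move=> xn; have := I1 x xn; case: (ar t aCL x) => [|[]].
split; last first.
  move=> e; rewrite ltnS leq_eqVlt => ei em; have [un' vn' _] := lt e em.
  have [-> _] := R _ un'; have [-> _] := R _ vn'.
  case: (e =P i) ei => [->|ne' /= ei]; last by rewrite I3.
  by rewrite -/u -/v -/cu -/cv eqxx; case: ifP.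
split=> [x xn|x y xn yn].
  have [_ ->] := R x xn; have := I1 x xn; case: ifP => //; lia.
have [-> ->] := R x xn; have [-> ->] := R y yn.
have uv : side u (+) side v by move: sd; case: (side u); case: (side v).
(* Parities are transported through the joining edge, whose ends have different sides; [fl] is the
   flip that makes the two components fit. *)
have key a b : a < n -> b < n -> ar t aCP a = cu -> ar t aCP b = cv ->
    (ar t aCL a == 0) (+) fl (+) (ar t aCL b == 0) = side a (+) side b.
  move=> an bn au bv; have := I2 a u an un au; have := I2 b v bn vn bv.
  move: uv; rewrite fl2; case: (side a); case: (side b); case: (side u); case: (side v) => //=;
  by case: (_ == 0); case: (_ == 0); case: (_ == 0); case: (_ == 0).
case: (ar t aCP x =P cu) => [xu|nxu]; case: (ar t aCP y =P cu) => [yu|nyu] /= exy.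
- have := I2 x y xn yn; rewrite xu yu => /(_ (erefl _)) <-.
  by case: (fl) => //; rewrite !flip //; case: (_ == 0); case: (_ == 0).
- rewrite -(key x y xn yn xu (esym exy)).
  by case: (fl) => //; rewrite ?flip //; case: (_ == 0); case: (_ == 0).
- have := key y x yn xn yu exy; rewrite addbC [side y (+) _]addbC => <-.
  by case: (fl) => //; rewrite ?flip //; case: (_ == 0); case: (_ == 0).
- exact: I2.
Qed.

Lemma RedEdge_loop s : penv s -> (forall e, e < m -> ar s aT e = eu (en e) /\ ar s aH e = ev (en e)) ->
  let t := exec (For 11 iM RedEdge) s in forall e, e < m ->
  ar t aRD e = (ar s aCL (eu (en e)) == 0) && ered (en e) /\
  ar t aRD (m + e) = (ar s aCL (ev (en e)) == 0) && ered (en e).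
Proof.
move=> [eN eM eM2 inp] sT; cbv zeta.
pose I i t := forall e, e < i -> e < m ->
  ar t aRD e = (ar s aCL (eu (en e)) == 0) && ered (en e) /\
  ar t aRD (m + e) = (ar s aCL (ev (en e)) == 0) && ered (en e).
suff : I (vr s iM) (exec (For 11 iM RedEdge) s) by rewrite eM => h e em; apply: h.
apply: (@exec_for 11 iM _ _ I) => // i t; rewrite eM => lti vt at_ It e.
rewrite ltnS leq_eqVlt => ei em.
have [i1 i2 i3] := inp i lti; have [sTi sHi] := sT i lti.
pose s1 := setv (setv t 11 i) 25 (i + (i + (i + 2))).
pose s2 := seta s1 aRD i ((ar s aCL (eu (en i)) == 0) && ered (en i)).
have -> : exec RedEdge (setv t 11 i) =
    seta s2 aRD (m + i) ((ar s aCL (ev (en i)) == 0) && ered (en i)).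
  rewrite /s2 /s1 /RedEdge; unf; rewrite !ev_not; unf.
  rewrite (at_ aT) // sTi (at_ aCL) // !negbK.
  case: (ar s aCL (eu (en i)) == 0); cbv iota; unf; rewrite (at_ aH) // sHi ?(at_ aCL) //;
  by case: (ar s aCL (ev (en i)) == 0); cbv iota; unf; rewrite ?(at_ aIN) // ?i3 (vt iM) // eM.
rewrite /s2 /s1; unf; rewrite /upd eqn_add2l (ltn_eqF (ltn_addr i em)) (gtn_eqF (ltn_addr e lti)).
case: (e =P i) ei => [->|ne /= ei]; last exact: It.
by rewrite ?eqxx.
Qed.

Lemma Parse_spec s : penv s ->
  parsed n E (ar (exec Parse s) aT) (ar (exec Parse s) aH) (ar (exec Parse s) aRD)
    (ar (exec Parse s) aCL).
Proof.
move=> ps.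
pose s1 := exec (For 11 iM ParseEdge) s; pose s2 := exec (For 15 iN ParseLoop) s1.
pose s3 := exec (For 11 iM Merge) s2; pose s4 := exec (For 11 iM RedEdge) s3.
have -> : exec Parse s = s4 by [].
have ps1 : penv s1 by apply: penv_exec.
have ps2 : penv s2 by apply: penv_exec.
have ps3 : penv s3 by apply: penv_exec.
have h1 := ParseEdge_loop ps; have [h2 T2 H2] := ParseLoop_loop ps1.
rewrite -/s1 in h1 T2 H2; rewrite -/s2 in h2 T2 H2.
have sT2 e : e < m -> ar s2 aT e = eu (en e) /\ ar s2 aH e = ev (en e).
  by move=> em; have [? ? _ _] := h1 e em; rewrite T2 ?H2 ?ltn_addr.
have col := Merge_loop ps2 sT2 (fun x xn => let: And4 _ _ a b := h2 x xn in conj a b).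
rewrite -/s3 in col.
have T3 : ar s3 aT = ar s2 aT by rewrite /s3; unf.
have H3 : ar s3 aH = ar s2 aH by rewrite /s3; unf.
have sT3 e : e < m -> ar s3 aT e = eu (en e) /\ ar s3 aH e = ev (en e) by rewrite T3 H3; apply: sT2.
have red := RedEdge_loop ps3 sT3; rewrite -/s4 in red.
have T4 : ar s4 aT = ar s2 aT by rewrite /s4; unf.
have H4 : ar s4 aH = ar s2 aH by rewrite /s4; unf.
have C4 : ar s4 aCL = ar s3 aCL by rewrite /s4; unf.
rewrite T4 H4 C4; split=> //.
  move=> e em; have [? ? ? ?] := h1 e em; have [? ?] := sT2 e em.
  by split=> //; rewrite ?T2 ?H2 // ltn_add2l.
by move=> x xn; have [? ? _ _] := h2 x xn.
Qed.

End ParseSpec.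

(** After the edge triples the input holds the sign and the absolute value of [k]. Cutting the
    latter to [n] loses nothing, as no assignment along edges has more than [n] red arcs. *)
Lemma Check_spec s n m : vr s iN = n -> vr s iM = m -> let t := exec Check s in
  [/\ vr t iM2 = m + m, ar t = ar s, vr t iM = m & vr t iNE = m + m + vr t iN] /\
  if m + m < n then vr t iBAD = 1 /\ vr t iN = 0
  else [/\ vr t iBAD = ar s aIN (m + (m + m)), vr t iN = n,
    vr t iKK = minn (ar s aIN (m + (m + m + 1))) n & vr t iNE = m + m + n].
Proof.
move=> eN eM; cbv zeta.
pose s1 := setv (setv (setv s iM2 (m + m)) iBAD (ar s aIN (m + (m + m)))) iKK (ar s aIN (m + (m + m + 1))).
pose s2 := if m + m < n then setv (setv s1 iBAD 1) iN 0 else s1.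
pose s3 := if vr s2 iN < vr s2 iKK then setv s2 iKK (vr s2 iN) else s2.
pose c1 := block [:: iM2 ::= EAdd (EV iM) (EV iM); iBAD ::= EA aIN (EAdd (EV iM) (EV iM2));
    iKK ::= EA aIN (EAdd (EV iM) (eInc (EV iM2)))].
pose c2 := When (eLt (EV iM2) (EV iN)) (Seq (iBAD ::= EC 1) (iN ::= EC 0)).
pose c3 := When (eLt (EV iN) (EV iKK)) (iKK ::= EV iN).
have E1 : exec c1 s = s1 by rewrite /c1 /s1; unf; rewrite eM.
have E2 : exec c2 s1 = s2 by rewrite /c2 /s2; unf; rewrite ev_lt /s1; unf; rewrite eN.
have E3 : exec c3 s2 = s3 by rewrite /c3 /s3; unf; rewrite ev_lt; unf.
have -> : exec Check s = setv s3 iNE (vr s3 iM2 + vr s3 iN) by rewrite -E3 -E2 -E1.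
rewrite /s3 /s2; case c: (m + m < n); rewrite /s1; unf.
  by case: ifP => _; unf; rewrite eM.
by rewrite eN minnC /minn; case: ifP => _; unf; rewrite eM eN.
Qed.

Lemma SetP_spec s n : vr s iN = n -> vr (exec SetP s) iP = n * n + (n + 1).
Proof. by move=> eN; rewrite /SetP; unf; rewrite eN. Qed.

Lemma SetPP_spec s P : vr s iP = P -> vr (exec SetPP s) iPP = P * P.
Proof. by move=> eP; rewrite /SetPP; unf; rewrite eP. Qed.

Lemma SetCM_spec s n PP : vr s iN = n -> vr s iPP = PP -> vr (exec SetCM s) iCM = n.+1 * PP.
Proof. by move=> eN eP; rewrite /SetCM; unf; rewrite eN eP addn1. Qed.

(** * Moving the input and the output *)

Section Raw.
Variable P : program.

(** Before any input is saved no cell is free, not even for a constant. So the base is formed in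
    cell 0 by adding the edge count in cell 1 to the vertex count 128 times; [sub_loop_reach] undoes
    this at the end. *)
Lemma add_loop_reach k : forall p mu, code_at P p (nseq k (IAdd 0 0 1)) ->
  exists mu', [/\ reach P k (MState p mu) (MState (p + k) mu'), mu' 0 = mu 0 + k * mu 1 &
    forall x, x != 0 -> mu' x = mu x].
Proof.
elim: k => [|k IH] p mu; first by exists mu; rewrite addn0 mul0n addn0.
case/code_at_cons => h1 h2; have [mu' [r e0 ex]] := IH _ (upd mu 0 (mu 0 + mu 1)) h2.
exists mu'; split.
- by apply: (reachS h1); rewrite addnS -addSn.
- by rewrite e0 /upd /= mulSn addnA.
by move=> x x0; rewrite ex // /upd (negbTE x0).
Qed.

Lemma sub_loop_reach k : forall p mu, code_at P p (nseq k (ISub 0 0 1)) ->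
  exists mu', [/\ reach P k (MState p mu) (MState (p + k) mu'), mu' 0 = mu 0 - k * mu 1 &
    forall x, x != 0 -> mu' x = mu x].
Proof.
elim: k => [|k IH] p mu; first by exists mu; rewrite addn0 mul0n subn0.
case/code_at_cons => h1 h2; have [mu' [r e0 ex]] := IH _ (upd mu 0 (mu 0 - mu 1)) h2.
exists mu'; split.
- by apply: (reachS h1); rewrite addnS -addSn.
- by rewrite e0 /upd /= mulSn subnDA.
by move=> x x0; rewrite ex // /upd (negbTE x0).
Qed.

Definition save_code j k := flatten [seq [:: IAdd 0 0 2; IStore 0 i] | i <- iota j k].

Lemma save_reach k : forall j p mu, code_at P p (save_code j k) -> 2 < j -> mu 2 = 16 ->
  j + k < mu 0 -> exists mu', [/\ reach P (2 * k) (MState p mu) (MState (p + 2 * k) mu'),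
    mu' 0 = mu 0 + 16 * k, forall i, i < k -> mu' (mu 0 + 16 * i.+1) = mu (j + i) &
    forall x, x != 0 -> (forall i, i < k -> x != mu 0 + 16 * i.+1) -> mu' x = mu x].
Proof.
elim: k => [|k IH] j p mu; first by exists mu; rewrite !addn0.
move=> code j2 m2 big; have : code_at P p ([:: IAdd 0 0 2; IStore 0 j] ++ save_code j.+1 k) := code.
case/code_at_cat => /code_at_cons[h1 /code_at_cons[h2 _]] h3.
pose mu1 := upd mu 0 (mu 0 + mu 2); pose mu2 := upd mu1 (mu1 0) (mu1 j).
have e10 : mu1 0 = mu 0 + 16 by rewrite /mu1 /upd m2.
have e1 x : x != 0 -> mu1 x = mu x by move=> x0; rewrite /mu1 /upd (negbTE x0).
have e2 x : x != mu 0 + 16 -> mu2 x = mu1 x by move=> nx; rewrite /mu2 /upd e10 (negbTE nx).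
have e20 : mu2 0 = mu 0 + 16 by rewrite e2 //; lia.
have [||||mu' [r f0 fi fx]] := IH j.+1 (p + 2) mu2; rewrite ?e20 //; first lia.
- by rewrite e2 ?e1 //; lia.
- lia.
rewrite e20 in f0 fi fx.
exists mu'; split.
- rewrite mulnS; apply: reach_trans; first by apply: (reachS h1); apply: (reach1 h2).
  by rewrite addnA; move: r; rewrite /mu2 /mu1 addn2.
- by rewrite f0; lia.
- case=> [|i] ik.
    rewrite muln1 addn0 fx; [|by lia|by move=> i _; lia].
    by rewrite /mu2 /upd e10 eqxx -/(upd _ _ _ _) e1 //; lia.
  have := fi i ik; rewrite -[mu 0 + 16 + _]addnA -mulnS => ->.
  by rewrite e2 ?e1; [congr mu; lia|lia|lia].
move=> x x0 nx; rewrite fx //.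
  by rewrite e2 ?e1 //; have := nx 0 isT; rewrite muln1.
by move=> i ik; have := nx i.+1 ik; rewrite -addnA -mulnS.
Qed.

Definition restore_code j k := flatten [seq [:: ILoad i 0; IAdd 0 0 99] | i <- iota j k].

Lemma restore_reach k : forall j p mu, code_at P p (restore_code j k) -> 0 < j -> mu 99 = 16 ->
  j + k <= 99 -> 100 <= mu 0 -> exists mu', [/\ reach P (2 * k) (MState p mu) (MState (p + 2 * k) mu'),
    mu' 0 = mu 0 + 16 * k, forall i, i < k -> mu' (j + i) = mu (mu 0 + 16 * i) &
    forall x, x != 0 -> ~~ (j <= x < j + k) -> mu' x = mu x].
Proof.
elim: k => [|k IH] j p mu; first by exists mu; rewrite !addn0.
move=> code j0 m2 big m0; have : code_at P p ([:: ILoad j 0; IAdd 0 0 99] ++ restore_code j.+1 k) := code.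
case/code_at_cat => /code_at_cons[h1 /code_at_cons[h2 _]] h3.
pose mu1 := upd mu j (mu (mu 0)); pose mu2 := upd mu1 0 (mu1 0 + mu1 99).
have e1 x : x != j -> mu1 x = mu x by move=> nx; rewrite /mu1 /upd (negbTE nx).
have e2 x : x != 0 -> mu2 x = mu1 x by move=> nx; rewrite /mu2 /upd (negbTE nx).
have e20 : mu2 0 = mu 0 + 16 by rewrite /mu2 /upd eqxx !e1 ?m2 //; lia.
have [|||||mu' [r f0 fi fx]] := IH j.+1 (p + 2) mu2; rewrite ?e20 //; try lia.
  by rewrite e2 ?e1 //; lia.
rewrite e20 in f0 fi.
exists mu'; split.
- rewrite mulnS; apply: reach_trans; first by apply: (reachS h1); apply: (reach1 h2).
  by rewrite addnA; move: r; rewrite /mu2 /mu1 addn2.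
- by rewrite f0; lia.
- case=> [|i] ik.
    by rewrite muln0 !addn0 fx ?e2 ?/mu1 /upd ?eqxx //; lia.
  have := fi i ik; rewrite -addnA -mulnS addSnnS => ->.
  by rewrite e2 ?e1 //; lia.
by move=> x x0 nx; rewrite fx // ?e2 ?e1 //; lia.
Qed.

(* Moves [cell 4] words from address [cell a] on to address [cell b] on, where
   cell 0 advances by 16 and cell 3 by 1. *)
Definition move_loop p a b := [:: IJz 4 (p + 7); ILoad 7 a; IStore b 7; IAdd 0 0 2;
  IAdd 3 3 5; ISub 4 4 5; IJz 6 p].

Definition stride a := if a == 0 then 16 else 1.

(** Cell 0 runs along an array and cell 3 along consecutive cells; the input needs one direction and
    the output the other. Disjointness of source and target keeps each word intact until it is
    read. *)
Lemma move_reach c : forall p a b mu, code_at P p (move_loop p a b) ->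
  (a == 0) && (b == 3) || (a == 3) && (b == 0) ->
  mu 2 = 16 -> mu 5 = 1 -> mu 6 = 0 -> mu 4 = c -> 8 <= mu a -> 8 <= mu b ->
  (forall i j, i < c -> j < c -> mu a + i * stride a != mu b + j * stride b) ->
  exists t mu', [/\ t <= 7 * c + 1, reach P t (MState p mu) (MState (p + 7) mu'),
    forall i, i < c -> mu' (mu b + i * stride b) = mu (mu a + i * stride a) &
    forall x, x \notin [:: 0; 3; 4; 7] -> (forall i, i < c -> x != mu b + i * stride b) ->
      mu' x = mu x].
Proof.
elim: c => [|c IH] p a b mu code ab m2 m5 m6 m4 ma mb dis.
  case/code_at_cons: code => h1 _; exists 1, mu; split=> //.
  by apply: (reach1 h1); rewrite /= m4.
have := code; case/code_at_cons => h1 /code_at_cons[h2 /code_at_cons[h3 /code_at_cons[h4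
  /code_at_cons[h5 /code_at_cons[h6 /code_at_cons[h7 _]]]]]].
pose mu1 := upd mu 7 (mu (mu a)); pose mu2 := upd mu1 (mu1 b) (mu1 7).
pose mu3 := upd mu2 0 (mu2 0 + mu2 2); pose mu4 := upd mu3 3 (mu3 3 + mu3 5).
pose mu5 := upd mu4 4 (mu4 4 - mu4 5).
have b8 : b < 4 by move: ab; lia.
have a8 : a < 4 by move: ab; lia.
have e1 x : x != 7 -> mu1 x = mu x by move=> nx; rewrite /mu1 /upd (negbTE nx).
have e2 x : x != mu b -> mu2 x = mu1 x.
  by move=> nx; rewrite /mu2 e1; [rewrite /upd (negbTE nx)|lia].
have lo x : x < 8 -> x != 7 -> mu2 x = mu x by move=> x8 x7; rewrite e2 ?e1 //; lia.
have e50 : mu5 0 = mu 0 + 16 by rewrite /mu5 /mu4 /mu3 /upd /= !lo ?m2.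
have e53 : mu5 3 = mu 3 + 1 by rewrite /mu5 /mu4 /mu3 /upd /= !lo ?m5.
have e54 : mu5 4 = c by rewrite /mu5 /mu4 /mu3 /upd /= !lo ?m4 ?m5 // subn1.
have ex x : x \notin [:: 0; 3; 4] -> mu5 x = mu2 x.
  by rewrite !inE !negb_or => /and3P[/negbTE x0 /negbTE x3 /negbTE x4]; rewrite /mu5 /mu4 /mu3 /upd x0 x3 x4.
have e5a : mu5 a = mu a + stride a by case/orP: ab => /andP[/eqP-> _].
have e5b : mu5 b = mu b + stride b by case/orP: ab => /andP[_ /eqP->].
have [|||||||t [mu' [le r fi fx]]] := IH p a b mu5 code ab; rewrite ?e5a ?e5b //.
- by rewrite ex ?lo.
- by rewrite ex ?lo.
- by rewrite ex ?lo.
- lia.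
- lia.
- by move=> i j ic jc; rewrite -!addnA -!mulSn; apply: dis.
rewrite e5a e5b in fi fx.
have st0 z : 0 < stride z by rewrite /stride; case: ifP.
exists (7 + t), mu'; split.
- by lia.
- apply: reach_trans r; apply: (reachS h1); rewrite [istep _ _ _]/= m4 /=.
  apply: (reachS h2); apply: (reachS h3); apply: (reachS h4); apply: (reachS h5).
  apply: (reachS h6).
  have s7 q : istep (IJz 6 p) q mu5 = MState p mu5 by rewrite /istep ex ?lo // m6.
  exact: (reach1 h7 (s7 _)).
- case=> [|i] ic.
    rewrite !mul0n !addn0 fx.
    + have nb : mu b \notin [:: 0; 3; 4] by rewrite !inE; lia.
      have b7 : b != 7 by lia.
      by rewrite ex // /mu2 (e1 b b7) {1}/upd eqxx /mu1 /upd eqxx.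
    + by rewrite !inE; lia.
    + by move=> i ic'; have := st0 b; rewrite -addnA -mulSn mulSn; lia.
  have := fi i ic; rewrite -!addnA -!mulSn => ->.
  have big : 8 <= mu a + i.+1 * stride a by lia.
  rewrite ex ?inE; last by lia.
  rewrite e2 ?e1 //; first by lia.
  by have := dis i.+1 0 ic isT; rewrite mul0n addn0.
move=> x nx ni; rewrite fx // ?ex ?e2 ?e1 //.
- by move: nx; rewrite !inE !negb_or => /and4P[].
- by have := ni 0 isT; rewrite mul0n addn0.
- by move: nx; rewrite !inE !negb_or => /and4P[? ? ? _]; apply/and3P.
- by move=> i ic; have := ni i.+1 ic; rewrite mulSn addnA.
Qed.
End Raw.

(* Relocation of the input: the base address is [n + 128 * m]; entry [i] of the
   input array [aIN] receives input cell [i + 2]. Cells 2 .. 99 are moved by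
   straight-line code, the others by a loop. *)
Definition prologue_setup : program :=
  [:: IConst 3 1552; ISub 50 0 3; IAdd 4 1 1; IAdd 4 4 1; IConst 5 96; ISub 4 4 5;
      IConst 3 100; IConst 5 1; IConst 6 0; IAdd 0 0 2].

Definition prologue (p : nat) : program :=
  nseq 128 (IAdd 0 0 1) ++ [:: IStore 0 2; IConst 2 16] ++ save_code 3 97 ++ prologue_setup
  ++ move_loop (p + 334) 3 0 ++ [:: IConst 2 0; IAdd 0 2 50] ++ nseq 128 (ISub 0 0 1).

Lemma size_prologue p : size (prologue p) = 471. Proof. by []. Qed.

(** For [m > 0], [128 * m] exceeds both 100 and the input length [3 * m + 4], so the arrays lie
    beyond the registers and the unread input. *)
Lemma prologue_reach P p input n m : code_at P p (prologue p) -> size input = 3 * m + 4 ->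
  0 < m -> nth 0 input 0 = n -> nth 0 input 1 = m ->
  exists t mu s, [/\ t <= 21 * m + 500, reach P t (MState p (nth 0 input)) (MState (p + 471) mu),
    rep (n + 128 * m) s mu, vr s iN = n /\ vr s iM = m &
    forall i, i < 3 * m + 2 -> ar s aIN i = nth 0 input i.+2].
Proof.
move=> code sz m0 in0 in1; set B := n + 128 * m.
have B128 : 128 <= B by rewrite /B; lia.
case/code_at_cat: code => h1 /code_at_cat[/code_at_cons[h2 /code_at_cons[h3 _]]].
case/code_at_cat => h4 /code_at_cat[h5 /code_at_cat[h6]].
case/code_at_cat => /code_at_cons[h7 /code_at_cons[h8 _]] h9.
have [mu1 [r1 e10 e1x]] := add_loop_reach (nth 0 input) h1.
rewrite in0 in1 -/B in e10.
pose mu2 := upd mu1 B (mu1 2); pose mu3 := upd mu2 2 16.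
have e3x x : x != 2 -> x != B -> x != 0 -> mu3 x = nth 0 input x.
  by move=> x2 xB x0; rewrite /mu3 /mu2 /upd (negbTE x2) (negbTE xB) e1x.
have e30 : mu3 0 = B by rewrite /mu3 /mu2 /upd !ifN // ?e10; lia.
have e32 : mu3 2 = 16 by [].
have e3B : mu3 B = nth 0 input 2.
  by rewrite /mu3 /mu2 /upd eqxx ifN ?e1x //; lia.
have [|mu4 [r4 e40 e4i e4x]] := save_reach h4 isT e32; first by rewrite e30; lia.
rewrite e30 in e40 e4i e4x.
have e4in x : 100 <= x -> x < B -> mu4 x = nth 0 input x.
  move=> x100 xB; rewrite e4x; [apply: e3x; lia|lia|].
  by move=> i _; lia.
have e4B : mu4 B = nth 0 input 2 by rewrite e4x ?e3B //; [lia|move=> i _; lia].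
have e4s i : i < 97 -> mu4 (B + 16 * i.+1) = nth 0 input (3 + i).
  by move=> i97; rewrite e4i // e3x //; lia.
have e42 : mu4 2 = 16 by rewrite e4x // => i _; lia.
have e41 : mu4 1 = m by rewrite e4x ?e3x ?in1 //; [lia|move=> i _; lia].
(* [1552 = 16 * 97] undoes the pointer advance of [save_code], giving [B] back for cell 50. Of the
   [3 * m + 4] input cells, [3 * m - 96] are left from cell 100 on. *)
have [mu5 [r5 [e50 e51 e52 e53] [e54 e55 e56 e5B] e5x]] : exists mu5, [/\
    reach P 10 (MState (p + 324) mu4) (MState (p + 334) mu5),
    [/\ mu5 0 = B + 16 * 98, mu5 1 = m, mu5 2 = 16 & mu5 3 = 100],
    [/\ mu5 4 = 3 * m - 96, mu5 5 = 1, mu5 6 = 0 & mu5 50 = B] &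
    forall x, 100 <= x -> mu5 x = mu4 x].
  have c0 : code_at P (p + 324) prologue_setup by move: h5; rewrite -!addnA.
  move: c0; rewrite /prologue_setup; do 10![case/code_at_cons => ?] => _.
  eexists; split.
  - rewrite (_ : p + 334 = (p + 324).+4.+4.+2); last by lia.
    by do 10![apply: reachS; first eassumption; rewrite [istep _ _ _]/=].
  - by split; rewrite /upd /= ?e40 ?e42 ?e41 //; lia.
  - by split; rewrite /upd /= ?e40 ?e42 ?e41 //; lia.
  by move=> x x100; rewrite /upd !ifN //; lia.
have c6 : code_at P (p + 334) (move_loop (p + 334) 3 0) by move: h6; rewrite -!addnA.
have [||i j ic jc|t6 [mu6 [le6 r6 e6i e6x]]] := move_reach c6 isT e52 e55 e56 e54.
- by rewrite e53.
- by rewrite e50; lia.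
- by rewrite e50 e53 /stride /= /B; lia.
rewrite e50 e53 /stride /= in e6i e6x.
pose mu7 := upd mu6 2 0; pose mu8 := upd mu7 0 (mu7 2 + mu7 50).
have c9 : code_at P (p + 343) (nseq 128 (ISub 0 0 1)) by move: h9; rewrite -!addnA.
have [mu9 [r9 e90 e9x]] := sub_loop_reach mu8 c9.
have e6l x : x \notin [:: 0; 3; 4; 7] -> x < 100 -> mu6 x = mu5 x.
  by move=> nx x100; apply: e6x => // i ic; lia.
have e9l x : x != 0 -> x != 2 -> mu9 x = mu6 x.
  by move=> x0 x2; rewrite e9x // /mu8 /mu7 /upd (negbTE x0) (negbTE x2).
have e91 : mu9 1 = m by rewrite e9l ?e6l.
have e950 : mu9 50 = B by rewrite e9l ?e6l.
have e90' : mu9 0 = n.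
  have -> : mu9 0 = mu8 0 - 128 * m by rewrite e90 -e91 e9x.
  by rewrite /mu8 /mu7 /upd /= e6l // e5B; lia.
exists (128 + (2 + (2 * 97 + (10 + (t6 + (2 + 128)))))), mu9.
(* The store is read off the memory: whatever the cells contain serves as initial value. *)
exists (Store mu9 (fun a j => mu9 (B + 16 * j + a))); split.
- by move: le6; lia.
- have r23 : reach P 2 (MState (p + 128) mu1) (MState (p + 130) mu3).
    rewrite (_ : p + 130 = (p + 128).+2); last by lia.
    by apply: (reachS h2); rewrite /istep e10; apply: (reach1 h3).
  have r4' : reach P (2 * 97) (MState (p + 130) mu3) (MState (p + 324) mu4).
    by move: r4; rewrite -!addnA.
  have r6' : reach P t6 (MState (p + 334) mu5) (MState (p + 341) mu6).
    by move: r6; rewrite -!addnA.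
  have r78 : reach P 2 (MState (p + 341) mu6) (MState (p + 343) mu8).
    have h7' : nth IHalt P (p + 341) = IConst 2 0 by move: h7; rewrite -!addnA.
    have h8' : nth IHalt P (p + 341).+1 = IAdd 0 2 50 by move: h8; rewrite -!addnA.
    rewrite (_ : p + 343 = (p + 341).+2); last by lia.
    by apply: (reachS h7'); apply: (reach1 h8').
  have r9' : reach P 128 (MState (p + 343) mu8) (MState (p + 471) mu9).
    by move: r9; rewrite -addnA.
  by do 6![apply: reach_trans; first eassumption].
- by split.
- by split.
move=> i ib /=; rewrite addn0.
have far : mu9 (B + 16 * i) = mu6 (B + 16 * i) by rewrite e9l //; lia.
rewrite far; have [i98|i98] := ltnP i 98; last first.
  have -> : B + 16 * i = B + 16 * 98 + (i - 98) * 16 by lia.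
  rewrite e6i; last by lia.
  by rewrite e5x ?e4in; [congr nth; lia|rewrite /B; lia|lia|lia].
rewrite e6x; [|by rewrite !inE; lia|by move=> j _; lia].
rewrite e5x; last by lia.
by case: i {ib far} i98 => [|i] i98; rewrite ?muln0 ?addn0 ?e4B // e4s.
Qed.

(** [1595 = 16 * 99 + 11] is the offset of entry 99 of [aOUT], which belongs in cell 100; [m - 99]
    entries remain from there. *)
Definition epilogue_setup : program :=
  [:: IConst 0 1595; IAdd 0 0 50; IConst 2 16; IConst 3 100; IConst 4 99; ISub 4 1 4;
      IConst 5 1; IConst 6 0].

Definition restore_setup : program := [:: IConst 0 11; IAdd 0 0 50; IConst 99 16].

(** The loop runs while its registers are alive. Then cells 1 to 98 are filled with cell 0 as
    pointer and cell 99 as stride, and cells 99 and 0 come last. Copying past entry [m] is harmless,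
    as only [m] flags are read. *)
Definition epilogue (p : nat) : program :=
  [:: IJz iRES (p + 218)] ++ epilogue_setup ++ move_loop (p + 9) 0 3 ++ restore_setup ++ restore_code 1 98
  ++ [:: ILoad 99 0; IConst 0 1; IHalt; IConst 0 0; IHalt].

Lemma epilogue_infeasible P p B s mu : code_at P p (epilogue p) -> rep B s mu -> vr s iRES = 0 ->
  exists q mu', [/\ reach P 2 (MState p mu) (MState q mu'), nth IHalt P q = IHalt & mu' 0 = 0].
Proof.
move=> /code_at_cat[/code_at_cons[h1 _] /code_at_cat[_ /code_at_cat[_ /code_at_cat[_ /code_at_cat[_]]]]].
do 3![case/code_at_cons => _]; case/code_at_cons => h2 /code_at_cons[h3 _] rp r0.
have [rv _ _] := rp.
have h2' : nth IHalt P (p + 218) = IConst 0 0 by move: h2; rewrite -!addnA -!addnS.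
have s1 : istep (IJz iRES (p + 218)) p mu = MState (p + 218) mu by rewrite /istep rv // r0.
exists (p + 218).+1, (upd mu 0 0); split=> //.
- by apply: (reachS h1); rewrite s1; apply: (reach1 h2').
by move: h3; rewrite -!addnA -!addnS.
Qed.

Lemma epilogue_feasible P p B s mu m : code_at P p (epilogue p) -> rep B s mu -> vr s iRES != 0 ->
  vr s iM = m -> 100 <= B -> m < B ->
  exists t q mu', [/\ t <= 7 * m + 500, reach P t (MState p mu) (MState q mu'),
    nth IHalt P q = IHalt, mu' 0 = 1 & forall e, e < m -> mu' e.+1 = ar s aOUT e].
Proof.
move=> code rp nz eM B100 mB.
case/code_at_cat: code => /code_at_cons[h1 _] /code_at_cat[h2 /code_at_cat[h3]].
case/code_at_cat => h4 /code_at_cat[h5 h6].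
have [rv rB ra] := rp.
have o_out e : mu (B + 16 * e + 11) = ar s aOUT e by rewrite ra.
have [mu1 [r1 [e10 e12 e13 e14] [e15 e16 e1B] e1x]] : exists mu1, [/\
    reach P 8 (MState (p + 1) mu) (MState (p + 9) mu1),
    [/\ mu1 0 = B + 1595, mu1 2 = 16, mu1 3 = 100 & mu1 4 = m - 99],
    [/\ mu1 5 = 1, mu1 6 = 0 & mu1 50 = B] & forall x, 100 <= x -> mu1 x = mu x].
  have c0 : code_at P (p + 1) epilogue_setup := h2.
  move: c0; rewrite /epilogue_setup; do 8![case/code_at_cons => ?] => _.
  eexists; split.
  - rewrite (_ : p + 9 = (p + 1).+4.+4); last by lia.
    by do 8![apply: reachS; first eassumption; rewrite [istep _ _ _]/=].
  - by split; rewrite /upd /= ?rB ?rv ?eM //; lia.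
  - by split; rewrite /upd /= ?rB.
  by move=> x x100; rewrite /upd !ifN //; lia.
have c3 : code_at P (p + 9) (move_loop (p + 9) 0 3) by move: h3; rewrite -!addnA.
have [||i j ic jc|t2 [mu2 [le2 r2 e2i e2x]]] := move_reach c3 isT e12 e15 e16 e14.
- by rewrite e10; lia.
- by rewrite e13.
- by rewrite e10 e13 /stride /=; lia.
rewrite e10 e13 /stride /= in e2i e2x.
have e2B : mu2 50 = B by rewrite e2x // => i _; lia.
have e2o e : mu2 (B + 16 * e + 11) = ar s aOUT e.
  rewrite e2x ?e1x ?o_out //; [lia|rewrite !inE; lia|move=> i im; lia].
have [mu3 [r3 e30 e399 e3x]] : exists mu3, [/\
    reach P 3 (MState (p + 16) mu2) (MState (p + 19) mu3), mu3 0 = B + 11, mu3 99 = 16 &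
    forall x, 100 <= x -> mu3 x = mu2 x].
  have c0 : code_at P (p + 16) restore_setup by move: h4; rewrite -!addnA.
  move: c0; rewrite /restore_setup; do 3![case/code_at_cons => ?] => _.
  eexists; split.
  - rewrite (_ : p + 19 = (p + 16).+3); last by lia.
    by do 3![apply: reachS; first eassumption; rewrite [istep _ _ _]/=].
  - by rewrite /upd /= e2B addnC.
  - by [].
  by move=> x x100; rewrite /upd !ifN //; lia.
have c5 : code_at P (p + 19) (restore_code 1 98) by move: h5; rewrite -!addnA.
have [||mu4 [r4 e40 e4i e4x]] := restore_reach c5 isT e399 => //; first by rewrite e30; lia.
rewrite e30 in e40 e4i.
have c6 : code_at P (p + 215) [:: ILoad 99 0; IConst 0 1; IHalt; IConst 0 0; IHalt].
  by move: h6; rewrite -!addnA.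
case/code_at_cons: c6 => k1 /code_at_cons[k2 /code_at_cons[k3 _]].
pose mu5 := upd mu4 99 (mu4 (mu4 0)); pose mu6 := upd mu5 0 1.
exists (1 + (8 + (t2 + (3 + (2 * 98 + 2))))), (p + 215).+2, mu6; split=> //.
- by move: le2; lia.
- have r0 : reach P 1 (MState p mu) (MState (p + 1) mu).
    by apply: (reach1 h1); rewrite /istep rv // (negbTE nz) addn1.
  have r2' : reach P t2 (MState (p + 9) mu1) (MState (p + 16) mu2).
    by move: r2; rewrite -addnA.
  have r4' : reach P (2 * 98) (MState (p + 19) mu3) (MState (p + 215) mu4).
    by move: r4; rewrite -addnA.
  have r5 : reach P 2 (MState (p + 215) mu4) (MState (p + 215).+2 mu6).
    by apply: (reachS k1); apply: (reach1 k2).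
  by do 5![apply: reach_trans; first eassumption].
move=> e em; rewrite /mu6 /upd /= /mu5 /upd.
case: eqP => [e99|/eqP n99].
  rewrite e40 e4x; [|lia|lia]; rewrite e3x; last lia.
  by rewrite (_ : _ + _ = B + 16 * e + 11) ?e2o //; lia.
have [e98|e98] := ltnP e 98.
  have -> : e.+1 = 1 + e by [].
  rewrite e4i // e3x; last lia.
  by rewrite (_ : _ + _ = B + 16 * e + 11) ?e2o //; lia.
rewrite e4x //; last lia.
rewrite e3x; last lia.
have -> : e.+1 = 100 + (e - 99) * 1 by lia.
rewrite e2i; last lia.
rewrite e1x; last lia.
by rewrite -o_out; congr mu; lia.
Qed.

(** * The complete machine *)

Definition poly_bounded (f : nat -> nat) := exists c, forall x, f x <= c * x.+1 ^ c.

Lemma poly_const a : poly_bounded (fun => a).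
Proof. by exists a => x; rewrite leq_pmulr // expn_gt0. Qed.

Lemma poly_id : poly_bounded id.
Proof. by exists 1 => x; rewrite mul1n expn1. Qed.

Lemma poly_add f g : poly_bounded f -> poly_bounded g -> poly_bounded (fun x => f x + g x).
Proof.
move=> [a fa] [b gb]; exists (a + b) => x; rewrite mulnDl.
apply: leq_add; [apply: leq_trans (fa x) _|apply: leq_trans (gb x) _].
  by rewrite leq_mul2l leq_pexp2l ?orbT // leq_addr.
by rewrite leq_mul2l leq_pexp2l ?orbT // leq_addl.
Qed.

Lemma poly_mul f g : poly_bounded f -> poly_bounded g -> poly_bounded (fun x => f x * g x).
Proof.
move=> [a fa] [b gb]; exists (a * b + (a + b)) => x.
apply: leq_trans (leq_mul (fa x) (gb x)) _; rewrite mulnACA -expnD.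
by apply: leq_mul; [exact: leq_addr|rewrite leq_pexp2l // leq_addl].
Qed.

Lemma poly_cost c N : poly_bounded N -> poly_bounded (fun x => cost c (N x)).
Proof.
move=> pN; elim: c => [|y e|a i e|c1 IH1 c2 IH2|e c1 IH1 c2 IH2|y b c IH];
  try exact: poly_const.
- exact: poly_add.
- by apply: poly_add => //; apply: poly_add => //; apply: poly_const.
by apply: poly_add; [apply: poly_mul => //; apply: poly_add => //|]; apply: poly_const.
Qed.

Definition algorithm := Seq Check (Seq SetP (Seq SetPP (Seq SetCM Main))).

(** [Check] leaves at most [2 * m] vertices, so [ubound] dominates [P] and [loop_bound] dominates
    every loop bound, the largest being [iCM]. *)
Definition ubound m := 2 * m * (2 * m) + (2 * m + 1).
Definition loop_bound m := (2 * m + 1) * (ubound m * ubound m) + 4 * m.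
Definition algorithm_cost m := let N := loop_bound m in
  cost Check 0 + (cost SetP N + (cost SetPP N + (cost SetCM N + cost Main N))).

Lemma poly_algorithm_cost : poly_bounded algorithm_cost.
Proof.
have pm a : poly_bounded (fun m => a * m) by apply: poly_mul; [apply: poly_const|apply: poly_id].
have pu : poly_bounded ubound.
  by apply: poly_add; [apply: poly_mul|apply: poly_add => //; apply: poly_const].
have pN : poly_bounded loop_bound.
  apply: poly_add => //; apply: poly_mul; last exact: poly_mul.
  by apply: poly_add => //; apply: poly_const.
by do ?[apply: poly_add; first (exact: poly_const || exact: poly_cost)]; apply: poly_cost.
Qed.

(** Joins stages with different lists of loop bounds, whose values are known only after the
    preceding stage has run. *)
Lemma comp_seq_reach P c1 c2 B p s mu t1 t2 : code_at P p (comp (Seq c1 c2) p) ->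
  (code_at P p (comp c1 p) -> exists t m', [/\ t <= t1,
     reach P t (MState p mu) (MState (p + size (comp c1 p)) m') & rep B (exec c1 s) m']) ->
  (forall m', rep B (exec c1 s) m' -> let p' := p + size (comp c1 p) in
     code_at P p' (comp c2 p') -> exists t m'', [/\ t <= t2,
     reach P t (MState p' m') (MState (p' + size (comp c2 p')) m'') &
     rep B (exec c2 (exec c1 s)) m'']) ->
  exists t m', [/\ t <= t1 + t2,
    reach P t (MState p mu) (MState (p + size (comp (Seq c1 c2) p)) m') &
    rep B (exec (Seq c1 c2) s) m'].
Proof.
case/code_at_cat => h1 h2 r1 r2; have [t [m' [le1 re1 rp1]]] := r1 h1.
have [t' [m'' [le2 re2 rp2]]] := r2 _ rp1 h2.
exists (t + t'), m''; split=> //; first exact: leq_add.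
by apply: reach_trans re1 _; rewrite size_cat addnA.
Qed.

Lemma Check_vN s n m : vr s iN = n -> vr s iM = m -> vr (exec Check s) iN <= m + m.
Proof.
move=> eN eM; have [_] := Check_spec eN eM.
by case: ltnP => [_ [_ ->] //|le [_ ->]].
Qed.

Lemma Final_bad t : vr t iBAD != 0 -> vr (exec Final t) iRES = 0.
Proof.
move=> tb; have -> : exec Final t = setv t iRES 0.
  by rewrite /Final; unf; rewrite ev_and ev_not; unf; rewrite tb andbF.
by unf.
Qed.

(** * The whole algorithm on an encoded graph *)

Section Run.
Variables (s : store) (n m : nat).
Hypotheses (eN : vr s iN = n) (eM : vr s iM = m).

Let s1 := exec Check s.
Let s2 := exec SetP s1.
Let s3 := exec SetPP s2.
Let s4 := exec SetCM s3.
Let n1 := vr s1 iN.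
Let P1 := n1 * n1 + (n1 + 1).

Lemma run_consts :
  [/\ [/\ vr s2 iP = P1, vr s3 iP = P1 & vr s4 iP = P1], vr s3 iPP = P1 * P1,
    [/\ vr s2 iN = n1, vr s3 iN = n1 & vr s4 iN = n1], vr s4 iPP = P1 * P1 &
    vr s4 iCM = n1.+1 * (P1 * P1)].
Proof.
have h2N : vr s2 iN = n1 by rewrite /s2; unf.
have h3N : vr s3 iN = n1 by rewrite /s3; unf.
have h4N : vr s4 iN = n1 by rewrite /s4; unf.
have h2P : vr s2 iP = P1 by apply: SetP_spec.
have h3P : vr s3 iP = P1 by rewrite /s3; unf.
have h4P : vr s4 iP = P1 by rewrite /s4; unf.
have h3PP : vr s3 iPP = P1 * P1 by apply: SetPP_spec.
have h4PP : vr s4 iPP = P1 * P1 by rewrite /s4; unf.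
have h4C : vr s4 iCM = n1.+1 * (P1 * P1) by apply: SetCM_spec.
by split.
Qed.

Lemma algorithm_reach P B p mu : code_at P p (comp algorithm p) -> 100 <= B -> rep B s mu ->
  exists t mu', [/\ t <= algorithm_cost m,
    reach P t (MState p mu) (MState (p + size (comp algorithm p)) mu') &
    rep B (exec algorithm s) mu'].
Proof.
move=> code B100 rp; have [[p2 p3 p4] pp3 [k2 k3 k4] pp4 cm4] := run_consts.
have n1m : n1 <= 2 * m by rewrite mul2n -addnn; apply: Check_vN eN eM.
have P1m : P1 <= ubound m by rewrite /P1 /ubound; apply: leq_add; [apply: leq_mul|lia].
have u0 : 0 < ubound m by rewrite /ubound; lia.
have PPm : P1 * P1 <= ubound m * ubound m by apply: leq_mul.
have PleN x : x <= ubound m * ubound m -> x <= loop_bound m.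
  move=> le; apply: leq_trans le _; rewrite /loop_bound; apply: leq_trans (leq_addr _ _).
  by rewrite leq_pmull //; lia.
have uleN : ubound m <= loop_bound m by apply: PleN; rewrite leq_pmull.
have n1N : n1 <= loop_bound m by apply: leq_trans uleN; rewrite /ubound; lia.
have mN : 4 * m <= loop_bound m by rewrite leq_addl.
have [[eM2 _ eM1 eNE] _] := Check_spec eN eM.
apply: (comp_seq_reach code) => [c|mu1 rp1 p1 c1].
  by apply: (comp_reach B100 c rp wf_Check).
apply: (comp_seq_reach c1) => [c|mu2 rp2 q2 c2].
  by apply: (comp_reach B100 c rp1 wf_SetP) => b; rewrite inE => /eqP->.
apply: (comp_seq_reach c2) => [c|mu3 rp3 q3 c3].
  apply: (comp_reach B100 c rp2 wf_SetPP) => b; rewrite inE => /eqP->.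
  by rewrite p2 (leq_trans P1m).
apply: (comp_seq_reach c3) => [c|mu4 rp4 q4 c4].
  apply: (comp_reach B100 c rp3 wf_SetCM) => b; rewrite inE => /eqP->.
  by rewrite pp3 PleN.
have v4 x : x \in [:: iM; iM2; iNE] -> vr s4 x = vr s1 x.
  by rewrite !inE => /or3P[]/eqP->; rewrite /s4 /s3 /s2; unf.
apply: (comp_reach B100 c4 rp4 wf_Main) => b; rewrite !inE.
case/or4P=> [/eqP->|/eqP->|/eqP->|/or4P[]/eqP->].
- by rewrite k4.
- by rewrite v4 // eM1; lia.
- by rewrite v4 // eM2; lia.
- by rewrite v4 // eNE -/n1; lia.
- by rewrite p4 (leq_trans P1m).
- by rewrite pp4 PleN.
rewrite cm4 /loop_bound; apply: leq_trans (leq_addr _ _).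
by apply: leq_mul => //; lia.
Qed.

Section Result.
Variables (E : seq edge) (k : int).
Hypothesis E_simple : simple_graph n E.
Hypothesis E_bip : bipartite E.
Hypothesis mE : m = size E.
Hypothesis m_gt0 : 0 < m.
Hypothesis inp : input_ok E (ar s aIN).
Hypothesis inp_sign : ar s aIN (m + (m + m)) = (k < 0)%R.
Hypothesis inp_k : ar s aIN (m + (m + m + 1)) = absz k.

Let s' := exec algorithm s.

(** Each vertex lies on an edge of [M] and each edge has two ends; this justifies the early
    rejection in [Check]. *)
Lemma pm_size (M : {set 'I_(size E)}) : perfect_matching n E M -> n <= m + m.
Proof.
move=> /forallP pm; have -> : n = \sum_(x < n) #|[set i in M | incident (nth e0 E i) x]|.
  by rewrite (eq_bigr (fun=> 1)) ?sum1_card ?card_ord // => x _; apply/eqP.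
rewrite (eq_bigr (fun x : 'I_n => \sum_(i < size E) (i \in M) && incident (nth e0 E i) x)); last first.
  by move=> x _; rewrite -sum1_card big_mkcond; apply: eq_bigr => i _; rewrite inE; case: (_ && _).
rewrite exchange_big /= addnn -muln2 mE -[in leqRHS](card_ord (size E)) -sum_nat_const.
apply: leq_sum => i _.
apply: leq_trans (_ : \sum_(x < n) ((eu (nth e0 E i) == x) + (ev (nth e0 E i) == x)) <= 2).
  by apply: leq_sum => x _; rewrite /incident; case: (_ \in _); case: (_ == _); case: (_ == _).
rewrite big_split /=.
have one a : \sum_(x < n) (a == x :> nat) <= 1.
  have [an|na] := ltnP a n.
    rewrite (bigD1 (Ordinal an)) //= eqxx big1 // => x /eqP xa.
    by case: eqP => // E'; case: xa; apply/val_inj.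
  by rewrite big1 // => x _; rewrite gtn_eqF // (leq_trans _ na).
exact: (leq_add (one (eu (nth e0 E i))) (one (ev (nth e0 E i)))).
Qed.

Lemma run_infeasible : vr s1 iBAD != 0 -> vr s' iRES = 0.
Proof.
move=> bad; have -> : s' = exec Final (exec Candidates (exec Parse s4)) := erefl _.
set t := exec Candidates _; have tb : vr t iBAD != 0.
  by rewrite /t /s4 /s3 /s2; unf.
exact: Final_bad.
Qed.

Lemma run_spec :
  ((exists M : {set 'I_(size E)}, feasible_pm n E k M) -> vr s' iRES = 1 /\
     exists M : {set 'I_(size E)}, [/\ forall i : 'I_(size E), (i \in M) = (ar s' aOUT i != 0),
       feasible_pm n E k M & kstar n E k <= 3 * nred E M]) /\
  (~ (exists M : {set 'I_(size E)}, feasible_pm n E k M) -> vr s' iRES = 0).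
Proof.
have [_] := Check_spec eN eM; rewrite -/s1 inp_sign inp_k.
have sign_int x : ((x%:Z <= k)%R : bool) = ~~ (k < 0)%R && (x <= absz k).
  by case: k => a.
case: ltnP => [nbig [bad _]|nle].
  split=> [[M /andP[/pm_size]]|_]; first by rewrite leqNgt nbig.
  by apply: run_infeasible; rewrite bad.
move=> [bad n1E kkE neE].
have [kneg|kpos] := boolP (k < 0)%R.
  split=> [[M /andP[_]]|_]; first by rewrite sign_int kneg.
  by apply: run_infeasible; rewrite bad kneg.
rewrite (negbTE kpos) in bad.
have [[_ _ p4] _ [_ _ k4] pp4 cm4] := run_consts.
rewrite /P1 /n1 n1E in p4 k4 pp4 cm4.
have [[eM2 eAr eM1 _] _] := Check_spec eN eM; rewrite -/s1 in eM2 eAr eM1.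
have [side sideP] := E_bip; have [E_lt _ _] := E_simple.
have in4 : ar s4 aIN = ar s aIN by rewrite /s4 /s3 /s2; unf; rewrite /s1 in eAr; rewrite eAr.
have pe4 : penv n E s4.
  by split; rewrite ?in4 -?mE // /s4 /s3 /s2; unf.
pose s5 := exec Parse s4; have par := Parse_spec E_lt sideP pe4; rewrite -/s5 in par.
pose T := ar s5 aT; pose H := ar s5 aH; pose RD := ar s5 aRD; pose CL := ar s5 aCL.
rewrite -/T -/H -/RD -/CL in par.
set P := n * n + (n + 1) in p4 pp4 cm4; set kk := minn (absz k) n in kkE.
have me5 : menv n m (m + m) (m + m + n) P kk T H RD CL s5.
  by split=> //; [split=> //; [split|..]|..]; rewrite /s5; unf => //; rewrite /s4 /s3 /s2; unf.
have TH := parsed_lt E_lt par; have RDle := parsed_RD_le E_lt par; rewrite -mE in TH RDle.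
have P_gt : n * n.+1 < P by rewrite /P mulnS; lia.
have loopE : forall x, x < n -> T (m + m + x) = x /\ H (m + m + x) = x.
  by move=> x xn; case: par => _ /(_ x xn); rewrite -mE.
have kk_le : kk <= n by rewrite geq_minr.
have [bs cov] := Candidates_spec TH P_gt (erefl _) (erefl _) loopE RDle kk_le me5.
set s6 := exec Candidates s5 in bs cov.
have me6 : menv n m (m + m) (m + m + n) P kk T H RD CL s6 by apply: menv_exec.
have n0 : 0 < n.
  have m0 : 0 < size E by rewrite -mE.
  by have [h _] := edge_lt E_lt m0; apply: leq_ltn_trans h.
have bad6 : vr s6 iBAD = 0 by rewrite /s6 /s5 /s4 /s3 /s2; unf.
have [yes no] := Final_spec TH P_gt (erefl _) (erefl _) RDle kk_le me6 n0 bs bad6 cov.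
have sE : s' = exec Final s6 := erefl _.
rewrite -{}sE in yes no; clearbody s'; clear bs cov me6 bad6; clearbody s6.
have feasE (M : {set 'I_(size E)}) : feasible_pm n E k M -> exists2 g,
    matching n (m + m) (m + m + n) T H g & nsum n RD g = nred E M /\ nred E M <= kk.
  case/andP=> pm; rewrite sign_int kpos /= => le.
  have [g [mg gE]] := pm_matching E_lt par pm; rewrite -mE in mg.
  exists g => //; split=> //; rewrite leq_min le -gE /=.
  exact: (nsum_RD_le RDle mg).
have matE f (M : {set 'I_(size E)}) : matching n (m + m) (m + m + n) T H f -> nsum n RD f <= kk ->
    (forall i : 'I_(size E), (i \in M) = chosen n m CL f i) ->
    feasible_pm n E k M /\ nred E M = nsum n RD f.
  move=> mf fk ME; rewrite mE in mf ME; have [pm nE] := matching_pm E_lt par mf ME.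
  split=> //; rewrite /feasible_pm pm sign_int kpos nE /=.
  by apply: leq_trans fk _; rewrite geq_minl.
split=> [[M0 f0]|nf].
  have [g mg [gE gk]] := feasE _ f0.
  have [|-> [f [mf fk fopt outE]]] := yes; first by exists g => //; rewrite gE.
  split=> //; exists [set i : 'I_(size E) | ar s' aOUT i != 0].
  have [|fM nE] := matE f [set i : 'I_(size E) | ar s' aOUT i != 0] mf fk.
    by move=> i; rewrite inE outE // mE.
  split=> //; first by move=> i; rewrite inE.
  apply/bigmax_leqP => M fM'; have [g' mg' [g'E g'k]] := feasE _ fM'.
  by rewrite nE -g'E; apply: fopt => //; rewrite g'E.
apply: no => -[g mg gk]; apply: nf.
exists [set i : 'I_(size E) | chosen n m CL g i].
by have [] := matE g [set i : 'I_(size E) | chosen n m CL g i] mg gk; [move=> i; rewrite inE|].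
Qed.
End Result.
End Run.

Lemma nth_encode n E k : let input := encode n E k in let m := size E in
  [/\ size input = 3 * m + 4, nth 0 input 0 = n, nth 0 input 1 = m,
    input_ok E (fun i => nth 0 input i.+2) &
    nth 0 input (m + (m + m)).+2 = (k < 0)%R /\
    nth 0 input (m + (m + m + 1)).+2 = absz k].
Proof.
pose tri (E : seq edge) := flatten [seq [:: eu e; ev e; nat_of_bool (ered e)] | e <- E].
have sz E' : size (tri E') = 3 * size E'.
  by elim: E' => [|e E' IH] //=; rewrite IH mulnS.
have nt E' i j : i < size E' -> j < 3 ->
    nth 0 (tri E') (i + (i + i) + j) =
    nth 0 [:: eu (nth e0 E' i); ev (nth e0 E' i); nat_of_bool (ered (nth e0 E' i))] j.
  elim: E' i => [|e E' IH] [|i] //= ie j3; first by case: j {IH} j3 => [|[|[|]]].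
  by rewrite !addnS !addSn /= -IH.
cbv zeta; rewrite /encode -/(tri E) /=; split=> //=.
- by rewrite size_cat sz /= !addnS.
- move=> e em; rewrite /= !nth_cat sz.
  have := nt E e 0 em isT; have := nt E e 1 em isT; have := nt E e 2 em isT.
  rewrite addn0 /= => h2 h1 h0; rewrite !ifT ?h0 ?h1; [|lia|lia|lia].
  by rewrite -h2; split=> //; congr nth; lia.
rewrite /= !nth_cat sz !ifN; [|lia|lia].
by split; [have -> : size E + (size E + size E) - 3 * size E = 0 by lia
  |have -> : size E + (size E + size E + 1) - 3 * size E = 1 by lia].
Qed.

(** Every entry counts at least one bit, so a bound in the number of edges becomes one in the input
    size. *)
Lemma size_le_bitsize (input : seq nat) : size input <= bitsize input.
Proof.
rewrite /bitsize -sum1_size; elim: input => [|x s IH]; first by rewrite !big_nil.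
by rewrite !big_cons; apply: leq_add.
Qed.

(** Only the empty matching is left, feasible when there is no vertex and [k] is not negative. The
    sum of cells 0 and 2, vertex count and sign bit, is 0 exactly then. *)
Definition no_edge_code (p : nat) : program :=
  [:: IAdd 0 0 2; IJz 0 (p + 4); IConst 0 0; IHalt; IConst 0 1; IHalt].

(* The prologue ends at 472 and the epilogue has length 220. Inputs without edges are
   treated apart, as they leave no room for the base address. *)
Definition layout (mc : program) : program :=
  let q := 692 + size mc in
  [:: IJz 1 q] ++ prologue 1 ++ mc ++ epilogue (472 + size mc) ++ no_edge_code q.

Lemma code_at_self P : code_at P 0 P.
Proof. by exists [::], [::]; rewrite cats0. Qed.

Definition laid_out (P mc : program) (q : nat) :=
  [/\ nth IHalt P 0 = IJz 1 q, code_at P 1 (prologue 1), code_at P 472 mc,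
    code_at P (472 + size mc) (epilogue (472 + size mc)) & code_at P q (no_edge_code q)].

Lemma layout_code mc : laid_out (layout mc) mc (692 + size mc).
Proof.
suff h P : code_at P 0 (layout mc) -> laid_out P mc (692 + size mc).
  by apply: h; apply: code_at_self.
rewrite /layout => /code_at_cat[/code_at_cons[h1 _]].
case/code_at_cat => h2; rewrite size_prologue => /code_at_cat[h3 /code_at_cat[h4 h5]].
have sz : size [:: IJz 1 (692 + size mc)] + 471 + size mc + size (epilogue (472 + size mc)) =
    692 + size mc.
  by rewrite (_ : size (epilogue _) = 220) // [size [:: _]]/=; lia.
by split=> //; rewrite -{1}sz.
Qed.

Lemma reach_halted P t input q mu : reach P t (init_state input) (MState q mu) ->
  nth IHalt P q = IHalt ->
  ram_halted P (ram_run P t input) /\ ram_mem (ram_run P t input) = mu.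
Proof. by rewrite /reach /ram_run => -> hq; rewrite /ram_halted /fetch /= hq. Qed.

Lemma no_edge_spec P mc sp n (k : int) : laid_out P mc sp -> let input := encode n [::] k in exists t, [/\ t <= 4,
  ram_halted P (ram_run P t input) &
  ram_mem (ram_run P t input) 0 = ((n == 0) && ~~ (k < 0)%R)].
Proof.
case=> h0 _ _ _ hs.
case/code_at_cons: hs => h1 /code_at_cons[h2 /code_at_cons[h3 /code_at_cons[h4
  /code_at_cons[h5 /code_at_cons[h6 _]]]]].
cbv zeta; set mu := nth 0 (encode n [::] k).
pose mu1 := upd mu 0 (n + (k < 0)%R).
have s0 : istep (IJz 1 sp) 0 mu = MState sp mu by [].
have s1 : istep (IAdd 0 0 2) sp mu = MState sp.+1 mu1 by [].
have s2 : istep (IJz 0 (sp + 4)) sp.+1 mu1 =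
    MState (if n + (k < 0)%R == 0 then sp.+4 else sp.+2) mu1.
  by rewrite /istep /mu1 {1}/upd eqxx addn4.
have cnd : ((n == 0) && ~~ (k < 0)%R) = (n + (k < 0)%R == 0).
  by rewrite addn_eq0; case: (k < 0)%R.
rewrite cnd; case: eqP s2 => _ s2.
  have r : reach P 4 (init_state (encode n [::] k)) (MState sp.+4.+1 (upd mu1 0 1)).
    apply: (reachS h0); rewrite s0; apply: (reachS h1); rewrite s1; apply: (reachS h2).
    by rewrite s2; apply: (reach1 h5).
  by exists 4; have [hh ->] := reach_halted r h6.
have r : reach P 4 (init_state (encode n [::] k)) (MState sp.+3 (upd mu1 0 0)).
  apply: (reachS h0); rewrite s0; apply: (reachS h1); rewrite s1; apply: (reachS h2).
  by rewrite s2; apply: (reach1 h3).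
by exists 4; have [hh ->] := reach_halted r h4.
Qed.

Definition total_cost m := 28 * m + 1010 + algorithm_cost m.

Lemma poly_total_cost : poly_bounded total_cost.
Proof.
apply: poly_add; last exact: poly_algorithm_cost.
apply: poly_add; last exact: poly_const.
by apply: poly_mul; [apply: poly_const|apply: poly_id].
Qed.

Lemma em_program_spec P q n E k : laid_out P (comp algorithm 472) q -> simple_graph n E -> bipartite E -> 0 < size E ->
  let input := encode n E k in exists t, [/\ t <= total_cost (size E),
    ram_halted P (ram_run P t input) &
    let mu := ram_mem (ram_run P t input) in
    ((exists M : {set 'I_(size E)}, feasible_pm n E k M) -> mu 0 = 1 /\
      feasible_pm n E k (out_matching E mu) /\
      kstar n E k <= 3 * nred E (out_matching E mu)) /\
    (~ (exists M : {set 'I_(size E)}, feasible_pm n E k M) -> mu 0 = 0)].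
Proof.
move=> [h0 hp hm he _] simp bip m0; cbv zeta.
have [sz in0 in1 inp [ins ink]] := nth_encode n E k.
set input := encode n E k in sz in0 in1 inp ins ink *; set m := size E in sz in1 ins ink m0 *.
have [t1 [mu1 [s [le1 r1 rp1 [eN eM] IN]]]] := prologue_reach hp sz m0 in0 in1.
have B100 : 100 <= n + 128 * m by lia.
have [t2 [mu2 [le2 r2 rp2]]] := algorithm_reach eN eM hm B100 rp1.
have inp' : input_ok E (ar s aIN).
  by move=> e em; have [i0 i1 i2] := inp e em; rewrite !IN; [|move: em; rewrite -/m; lia..].
have ins' : ar s aIN (m + (m + m)) = (k < 0)%R by rewrite IN //; lia.
have ink' : ar s aIN (m + (m + m + 1)) = absz k by rewrite IN //; lia.
have [yes no] := run_spec eN eM simp bip (erefl _) m0 inp' ins' ink'.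
have rpre : reach P (1 + (t1 + t2)) (init_state input)
    (MState (472 + size (comp algorithm 472)) mu2).
  apply: reach_trans (reach_trans r1 r2).
  apply: (reach1 h0); rewrite /istep in1.
  by case: (m) m0.
have [ex|nex] : (exists M : {set 'I_(size E)}, feasible_pm n E k M) \/
    ~ (exists M : {set 'I_(size E)}, feasible_pm n E k M).
  case: (boolP [exists M : {set 'I_(size E)}, feasible_pm n E k M]) => [/existsP|/existsP]; tauto.
- have [res [M [ME fM opt]]] := yes ex.
  have nz : vr (exec algorithm s) iRES != 0 by rewrite res.
  have eM' : vr (exec algorithm s) iM = m by rewrite exec_vr.
  have mB : m < n + 128 * m by lia.
  have [t3 [pc3 [mu3 [le3 r3 hq z out]]]] := epilogue_feasible he rp2 nz eM' B100 mB.
  exists (1 + (t1 + t2) + t3); have [hh ->] := reach_halted (reach_trans rpre r3) hq.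
  split=> //; first by rewrite /total_cost -/m; lia.
  split=> // _; have -> : out_matching E mu3 = M.
    by apply/setP => i; rewrite inE ME out.
  by [].
have res := no nex.
have [pc3 [mu3 [r3 hq z]]] := epilogue_infeasible he rp2 res.
exists (1 + (t1 + t2) + 2); have [hh ->] := reach_halted (reach_trans rpre r3) hq.
by split=> //; rewrite /total_cost -/m; lia.
Qed.

Lemma card_set_ord0 (A : {set 'I_0}) : #|A| = 0.
Proof. by apply/eqP; rewrite -leqn0; apply: leq_trans (max_card _) _; rewrite card_ord. Qed.

Lemma nred_nil (M : {set 'I_0}) : nred [::] M = 0.
Proof. exact: card_set_ord0. Qed.

Lemma feasible_nil n k (M : {set 'I_0}) :
  feasible_pm n [::] k M = (n == 0) && ~~ (k < 0)%R.
Proof.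
rewrite /feasible_pm nred_nil; case: k => k; rewrite /= ?andbF // !andbT.
apply/forallP/eqP => [pm|n0 x]; last by case: x => x; rewrite n0.
case: n pm => // n /(_ ord0).
by rewrite card_set_ord0.
Qed.

Theorem theorem1 :
  exists (P : program) (c : nat),
    forall (n : nat) (E : seq edge) (k : int),
      simple_graph n E -> bipartite E ->
      let input := encode n E k in
      exists t : nat,
        t <= c * (bitsize input).+1 ^ c /\
        ram_halted P (ram_run P t input) /\
        let m := ram_mem (ram_run P t input) in
        ((~~ [exists M : {set 'I_(size E)}, feasible_pm n E k M]) ->
           out_infeasible m) /\
        ([exists M : {set 'I_(size E)}, feasible_pm n E k M] ->
           ~~ out_infeasible m /\
           perfect_matching n E (out_matching E m) /\
           kstar n E k <= 3 * nred E (out_matching E m) /\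
           nred E (out_matching E m) <= kstar n E k).
Proof.
have [c cP] := poly_total_cost.
exists (layout (comp algorithm 472)), c => n E k simp bip; cbv zeta.
have bound t : t <= total_cost (size E) -> t <= c * (bitsize (encode n E k)).+1 ^ c.
  move=> le; apply: leq_trans le _; apply: leq_trans (cP _) _.
  rewrite leq_mul2l; apply/orP; right.
  have [sz _ _ _ _] := nth_encode n E k; have := size_le_bitsize (encode n E k).
  by rewrite sz => lebs; case: (posnP c) => [->|c0]; rewrite ?expn0 ?leq_exp2r //; lia.
have [/size0nil E0|m0] := posnP (size E).
  subst E; have [t [le hh res]] := no_edge_spec n k (layout_code (comp algorithm 472)).
  exists t; split; first by apply: bound; apply: leq_trans le _; rewrite /total_cost; lia.
  split=> //; move: (ram_mem _) res => mu res; rewrite /out_infeasible res; split=> [|/existsP[M]].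
    by move/existsPn => /(_ set0); rewrite feasible_nil => /negbTE->.
  rewrite feasible_nil => feas; rewrite feas.
  have : feasible_pm n [::] k (out_matching [::] mu) by rewrite feasible_nil.
  case/andP => pm _; split=> //; split=> //; rewrite !nred_nil muln0; split=> //.
  by apply/bigmax_leqP => M' _; rewrite nred_nil.
have [t [le hh [yes no]]] := em_program_spec k (layout_code _) simp bip m0.
exists t; split; first exact: bound; split=> //; split=> [/existsP/no z|/existsP/yes[z [fM opt]]].
  by rewrite /out_infeasible z.
rewrite /out_infeasible z; have /andP[pm _] := fM.
do 3!(split=> //).
exact: leq_bigmax_cond fM.
Qed.
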